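(* Let $n\ge 3$ and let $K$ be a compact Lie group which is an almost direct product of copies of $SU(2)$ and of the circle group $S^1$. For $(\phi_1,\ldots,\phi_n)\in K^n$ let $\lambda_1=\lambda_1(\phi_1,\ldots,\phi_n)$ be the supremum of the eigenvalues of the self-adjoint operator $\phi_1+\phi_1^{-1}+\cdots+\phi_n+\phi_n^{-1}$ acting on $L^2_0(K)$. Then either $\lambda_1<2n$ for almost every $(\phi_1,\ldots,\phi_n)\in K^n$, or $\lambda_1=2n$ for almost every $(\phi_1,\ldots,\phi_n)\in K^n$.
   Context: $L^2_0(K)$ is the orthogonal complement of the constant functions in $L^2(K)$, where $K$ carries Haar measure. An element $\phi\in K$ acts unitarily on $L^2_0(K)$ through the left translation action, $(\phi f)(x)=f(\phi^{-1}x)$, and sums of group elements denote the corresponding sums of unitary operators. ''Almost every'' is with respect to the product Haar measure on $K^n$. An almost direct product of groups is the quotient of their direct product by a finite central subgroup. One always has $\lambda_1\le 2n$. *)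

(* Defs.v *)
From HB Require Import structures.
From mathcomp Require Import all_boot all_order all_algebra.
From mathcomp Require Import sesquilinear spectral complex.
From mathcomp Require Import all_classical all_reals all_analysis.

Set Implicit Arguments.
Unset Strict Implicit.
Unset Printing Implicit Defensive.

Import Order.TTheory GRing.Theory Num.Theory.
Import numFieldNormedType.Exports.

Local Open Scope classical_set_scope.
Local Open Scope ring_scope.
Local Open Scope complex_scope.

(* The distinguished point of the carrier is arbitrary data: the measurable
   types of the library are pointed, so it is needed to speak of Borel measures
   on the group. *)
HB.mixin Record isTopologicalGroup G & Group G & PointedTopological G := {
  mulg_continuous : continuous (fun x : G * G => (x.1 * x.2)%g) ;
  invg_continuous : continuous (fun x : G => (x^-1)%g) ;
}.

#[short(type="topologicalGroupType")]
HB.structure Definition TopologicalGroup :=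
  {G of Group G & PointedTopological G & isTopologicalGroup G}.

HB.instance Definition _ (R : realType) :=
  PseudoPointedMetric.copy R[i] (R[i])^o.

Section almost_direct_product.
Variable R : realType.

Definition SU2 : set 'M[R[i]]_2 :=
  [set A | A \is unitarymx /\ \det A = 1].

Definition circle : set R[i] := [set z | `|z| = 1].

(* SU(2)^a x (S^1)^b is SU2_torus below, a subset of M_2(C)^a x C^b with
   componentwise multiplication and the topology induced by the product
   topology. *)
Definition SU2_torus_ambient (a b : nat) : Type :=
  ({ptws 'I_a -> 'M[R[i]]_2} * {ptws 'I_b -> R[i]})%type.

HB.instance Definition _ a b := Topological.on (SU2_torus_ambient a b).

Definition SU2_torus (a b : nat) : set (SU2_torus_ambient a b) :=
  [set x | (forall i, SU2 (x.1 i)) /\ (forall j, circle (x.2 j))].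

Arguments SU2_torus : clear implicits.

Definition SU2_torus_mul (a b : nat) (x y : SU2_torus_ambient a b) :
    SU2_torus_ambient a b :=
  (fun i => x.1 i *m y.1 i, fun j => x.2 j * y.2 j).

(* p exhibits the topological group K as the quotient of SU(2)^a x (S^1)^b by a
   finite central subgroup, namely the kernel of p. Only the restriction of p to
   SU2_torus a b is meaningful; the last clause says that K carries the quotient
   topology. As SU(2)^a x (S^1)^b is a compact Lie group, so is K. *)
Definition is_finite_central_quotient (K : topologicalGroupType) (a b : nat)
    (p : SU2_torus_ambient a b -> K) : Prop :=
  let G := SU2_torus a b in
  let Z := [set z | G z /\ p z = 1%g] in
  [/\ forall x y, G x -> G y -> p (SU2_torus_mul x y) = (p x * p y)%g,
      p @` G = [set: K],
      finite_set Z,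
      forall z x, Z z -> G x -> SU2_torus_mul z x = SU2_torus_mul x z &
      forall U : set K, open U <-> open (p @^-1` U : set (subspace G))].

Definition almost_direct_product (K : topologicalGroupType) : Prop :=
  exists (a b : nat) (p : SU2_torus_ambient a b -> K),
    is_finite_central_quotient p.

End almost_direct_product.

Definition borel (K : ptopologicalType) := g_sigma_algebraType (@open K).
HB.instance Definition _ (K : ptopologicalType) := Measurable.on (borel K).

(* Haar measure of a compact group, normalised to be a probability. *)
Definition is_haar (R : realType) (K : topologicalGroupType)
    (mu : probability (borel K) R) : Prop :=
  forall (g : K) (A : set (borel K)), measurable A ->
    mu [set (g * x)%g | x in (A : set K)] = mu A.

Section power_measure.
Context d (T : measurableType d) (R : realType) (P : probability T R).

Definition tuple_cons (n : nat) (x : T * n.-tuple T) : n.+1.-tuple T :=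
  [the n.+1.-tuple T of x.1 :: x.2].

Let measurable_tuple_cons n : measurable_fun [set: _] (@tuple_cons n).
Proof. exact: measurable_cons. Qed.

HB.instance Definition _ n :=
  isMeasurableFun.Build _ _ _ _ (@tuple_cons n) (@measurable_tuple_cons n).

(* The product measure P x ... x P (n factors), on T^n = T x T^(n-1). *)
Fixpoint power_measure (n : nat) : probability (n.-tuple T) R :=
  match n with
  | 0 => \d_ [tuple]
  | n.+1 => distribution (P \x power_measure n)%E (@tuple_cons n)
  end.

End power_measure.

Section first_eigenvalue.
Variables (R : realType) (K : topologicalGroupType).
Variable mu : probability (borel K) R.
Implicit Types (f g : K -> R[i]).

Definition square_integrable f : Prop :=
  ((@complex.Re R \o f : borel K -> R) \in Lfun mu 2%:E) /\
  ((@complex.Im R \o f : borel K -> R) \in Lfun mu 2%:E).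

Definition inner f g : R[i] :=
  (\int[mu]_x @complex.Re R (f x * (g x)^*)) +i*
  (\int[mu]_x @complex.Im R (f x * (g x)^*)).

(* Functions representing the elements of L^2_0(K). *)
Definition L20 f : Prop :=
  square_integrable f /\ forall c : R[i], inner f (fun=> c) = 0.

Definition translate (phi : K) f : K -> R[i] := fun x => f (phi^-1 * x)%g.

Definition sum_translates (n : nat) (phi : n.-tuple (borel K)) f : K -> R[i] :=
  fun x => \sum_(i < n) (translate (tnth phi i) f x +
                         translate (tnth phi i : K)^-1%g f x).

Definition eigenvalue_on_L20 (n : nat) (phi : n.-tuple (borel K)) (c : R[i]) :
    Prop :=
  exists f, [/\ L20 f, ~ {ae mu, forall x, f x = 0} &
    {ae mu, forall x, sum_translates phi f x = c * f x}].

(* The operator is self-adjoint, so that its eigenvalues are real. *)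
Definition lambda1 (n : nat) (phi : n.-tuple (borel K)) : \bar R :=
  ereal_sup [set c%:E | c in [set c : R | eigenvalue_on_L20 phi c%:C]].

End first_eigenvalue.

(* Main.v *)
Require Import Defs.
From mathcomp Require Import all_boot all_order all_algebra.
From mathcomp Require Import sesquilinear spectral complex.
From mathcomp Require Import ring lra finmap.
From mathcomp Require Import all_classical all_reals all_analysis.
From mathcomp Require Import measurable_realfun.

(* By the Peter-Weyl decomposition of L^2_0(K) into finite-dimensional translation-invariant spaces,
   lambda_1 = 2n means that the spaces contain unit vectors moved arbitrarily little by every phi_i. This
   condition depends only on the group generated by the phi_i, so it is unchanged when some phi_k is
   replaced by phi_i phi_k with i <> k.

   For almost every pair (x, y), no nonconstant function is fixed by both x and y. On each of countably many
   finite-dimensional spaces, having a common fixed vector is the vanishing of a function of (x, y) which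
   is representative in each variable. Such a function vanishes almost everywhere only if it is zero, and it
   is nonzero when x topologically almost generates a maximal torus T and y = w x w^-1, because
   K = T (w T w^-1) T (Euler angles). A set invariant under such x and y has measure 0 or 1.

   For n >= 3, fix two generic coordinates: the set of the remaining ones for which lambda_1 = 2n is
   invariant under both, hence null or conull. Applying this with different pairs of fixed coordinates and
   Fubini's theorem, the set of all phi with lambda_1 = 2n is null or conull. *)

Set Implicit Arguments.
Unset Strict Implicit.
Unset Printing Implicit Defensive.

Import Order.TTheory GRing.Theory Num.Theory.
Import numFieldNormedType.Exports.

Local Open Scope classical_set_scope.
Local Open Scope ring_scope.

(** * Haar integration of continuous functions *)

(** The representative functions have an explicit source. On SU(2)^a x (S^1)^b a squared distance to
    a point is a quadratic polynomial in the real entries, and left multiplication is linear in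
    these entries, so its translates span a finite-dimensional space. Multiplying over the fibres of
    the covering brings it down to [K]; rational centres and levels then give countably many
    functions whose positivity sets generate the Borel sets. Their finite products are again
    representative, and an integrable function orthogonal to all of them vanishes almost everywhere:
    this is the Peter-Weyl statement used. Countability serves twice, to unite the exceptional null
    sets of pairs and to make the set of [phi] with $\lambda_1=2n$ measurable. The bound [n >= 3]
    leaves, beside any coordinate being varied, two others that stay unchanged and act on it. One
    translation would not do: the closure of a cyclic group is abelian, so on a nonabelian [K] a
    single translation is never ergodic. *)

Section measure_preserving.
Context d (T : measurableType d) (R : realType).

Lemma bounded_integrable (mu : probability T R) (f : T -> R) : measurable_fun setT f ->
  (exists M : R, forall x, `|f x| <= M) -> mu.-integrable setT (EFin \o f).
Proof.
move=> mf [M HM]; apply: measurable_bounded_integrable => //.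
  by rewrite (le_lt_trans (probability_le1 mu _)) ?ltry.
exists M; split; first exact: num_real.
by move=> y /ltW My x _ /=; exact: le_trans (HM x) My.
Qed.

Lemma integral_preserving (mu : {measure set T -> \bar R}) (phi : T -> T) (f : T -> R) :
  measurable_fun setT phi ->
  (forall A, measurable A -> mu (phi @^-1` A) = mu A) ->
  mu.-integrable setT (EFin \o f) ->
  mu.-integrable setT (EFin \o (f \o phi)) /\
  \int[mu]_x f (phi x) = \int[mu]_x f x.
Proof.
move=> mphi E If; have mf := measurable_int _ If.
pose mx := isMeasurableFun.Build _ _ _ _ _ mphi.
pose P : {mfun T >-> T} := MeasurableFun.Pack (MeasurableFun.Class mx).
have If' : mu.-integrable setT ((EFin \o f) \o P).
  apply/integrableP; split; first by apply: measurableT_comp => //.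
  have /integrableP[_] := If.
  rewrite (eq_measure_integral (pushforward mu P)); last first.
    by move=> A mA _; rewrite -E.
  rewrite ge0_integral_pushforward//.
  by apply: measurableT_comp => //.
split => //.
rewrite /Rintegral; congr fine.
rewrite [RHS](eq_measure_integral (pushforward mu P)); last by move=> A mA _; rewrite -E.
by rewrite (@integral_pushforward _ _ _ _ _ P mphi mu setT (EFin \o f)).
Qed.
End measure_preserving.

Section integration.
Variables (R : realType) (K : topologicalGroupType).
Hypothesis Kc : compact [set: K].
Local Notation bK := (Defs_borel__canonical__measurable_structure_Measurable K).
Variable mu : probability bK R.
Hypothesis muH : is_haar mu.

Lemma open_borel (U : set K) : open U -> measurable (U : set (bK)).
Proof. by move=> oU; apply: sub_sigma_algebra. Qed.

Lemma closed_borel (U : set K) : closed U -> measurable (U : set (bK)).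
Proof.
by move=> cU; rewrite -[U]setCK; apply: measurableC; apply: open_borel; apply: closed_openC.
Qed.

Lemma continuous_borel (f : K -> R) :
  continuous f -> measurable_fun [set: bK] (f : bK -> R).
Proof.
move=> cf; apply: (measurability _ (RGenOInfty.measurableE R)) => _ [_ [x ->] <-].
rewrite setTI; apply: open_borel; apply: open_comp => // y _; exact: cf.
Qed.

Lemma continuous_bounded (f : K -> R) :
  continuous f -> exists M : R, forall x, `|f x| <= M.
Proof.
move=> cf; have /compact_bounded : compact (f @` [set: K]).
  by apply: continuous_compact => //; exact: continuous_subspaceT.
move=> [M [_ H]]; exists (M + 1) => x.
by apply: (H (M + 1)); [rewrite ltrDl | exists x].
Qed.

Lemma continuous_integrable (f : K -> R) :
  continuous f -> mu.-integrable setT (EFin \o (f : bK -> R)).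
Proof.
move=> cf; apply: bounded_integrable; first exact: continuous_borel.
exact: continuous_bounded.
Qed.

Lemma continuous_mulgl (g : K) : continuous (fun x : K => (g * x)%g).
Proof.
move=> x; apply: (@continuous_comp _ _ _ (fun x => (g, x)) (fun z => (z.1 * z.2)%g)).
  by apply: cvg_pair; [exact: cvg_cst | exact: cvg_id].
exact: mulg_continuous.
Qed.

Lemma continuous_mulgr (g : K) : continuous (fun x : K => (x * g)%g).
Proof.
move=> x; apply: (@continuous_comp _ _ _ (fun x => (x, g)) (fun z => (z.1 * z.2)%g)).
  by apply: cvg_pair; [exact: cvg_id | exact: cvg_cst].
exact: mulg_continuous.
Qed.

Lemma measurable_mulgl (g : K) :
  measurable_fun [set: bK] (fun x : bK => (g * x)%g : bK).
Proof.
apply: (@measurability _ _ (bK) (bK) _ _ open) => // _ [U oU <-].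
rewrite setTI; apply: open_borel; apply: open_comp => // y _.
exact: continuous_mulgl.
Qed.

Lemma preimage_mulgl (g : K) (A : set K) :
  (fun x => (g * x)%g) @^-1` A = [set (g^-1 * x)%g | x in A].
Proof.
apply/seteqP; split => [x Ax|_ [x Ax <-]].
  by exists (g * x)%g => //; rewrite mulKg.
by rewrite /preimage /= mulVKg.
Qed.

Lemma haar_mulgl (g : K) (A : set (bK)) : measurable A ->
  mu ((fun x : K => (g * x)%g) @^-1` A) = mu A.
Proof. by move=> mA; rewrite preimage_mulgl muH. Qed.

Lemma integral_mulgl (g : K) (f : bK -> R) : mu.-integrable setT (EFin \o f) ->
  mu.-integrable setT (EFin \o (fun x : bK => f ((g : K) * x)%g)) /\
  \int[mu]_x f ((g : K) * x)%g = \int[mu]_x f x.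
Proof.
move=> If; apply: (@integral_preserving _ _ _ mu (fun x : bK => ((g : K) * x)%g)) => //.
  exact: measurable_mulgl.
by move=> A mA; exact: haar_mulgl.
Qed.

(** By compactness finitely many translates of a nonempty open set cover [K]; they share its
    measure, which is therefore positive. *)
Lemma open_null (U : set K) : open U -> mu U = 0%E -> U = set0.
Proof.
move=> oU mU0; have [//|/set0P[x0 Ux0]] := eqVneq U set0; exfalso.
pose f (g : K) := (fun x : K => (g * x)%g) @^-1` U.
have of_ g : open (f g) by apply: open_comp => // y _; exact: continuous_mulgl.
have := Kc; rewrite compact_cover => /(_ K setT f (fun i _ => of_ i)) [].
  by move=> x _; exists (x0 * x^-1)%g => //; rewrite /f /preimage /= mulgVK.
move=> D _ DK.
have : (mu [set: bK] <= \sum_(i \in [set` D]) mu (f i : set (bK)))%E.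
  by apply: content_sub_fsum => // i _; exact: open_borel.
rewrite fsbig1 => [|i _]; first by rewrite (probability_setT mu) lee_fin ler10.
by rewrite -mU0; apply: haar_mulgl; exact: open_borel.
Qed.
End integration.

(** * Representative functions and frames *)

Section continuous_matrices.
Variables (R : realType) (K : topologicalType).

Definition cmx m n (e : K -> 'M[R]_(m, n)) := forall i j, continuous (fun x => e x i j).

Lemma continuous_bigsum (I : Type) (s : seq I) (F : I -> K -> R) :
  (forall i, continuous (F i)) -> continuous (fun x => \sum_(i <- s) F i x).
Proof.
move=> cF x; elim: s => [|i s IH].
  by under eq_fun do rewrite big_nil; exact: cvg_cst.
have -> : (fun y => \sum_(j <- i :: s) F j y) = (fun y => F i y + \sum_(j <- s) F j y).
  by apply/funext => y; rewrite big_cons.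
by apply: cvgD => //; exact: cF.
Qed.

Lemma continuous_bigprod (I : Type) (s : seq I) (F : I -> K -> R) :
  (forall i, continuous (F i)) -> continuous (fun x => \prod_(i <- s) F i x).
Proof.
move=> cF x; elim: s => [|i s IH].
  by under eq_fun do rewrite big_nil; exact: cvg_cst.
have -> : (fun y => \prod_(j <- i :: s) F j y) = (fun y => F i y * \prod_(j <- s) F j y).
  by apply/funext => y; rewrite big_cons.
by apply: cvgM => //; exact: cF.
Qed.

Lemma cmx_cst m n (B : 'M[R]_(m, n)) : cmx (fun=> B).
Proof. by move=> i j x; exact: cvg_cst. Qed.

Lemma cmxM m n p (e : K -> 'M[R]_(m, n)) (f : K -> 'M[R]_(n, p)) :
  cmx e -> cmx f -> cmx (fun x => e x *m f x).
Proof.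
move=> ce cf i j; under eq_fun do rewrite mxE.
by apply: continuous_bigsum => k x; apply: cvgM; [exact: ce | exact: cf].
Qed.

Lemma cmxD m n (e f : K -> 'M[R]_(m, n)) : cmx e -> cmx f -> cmx (fun x => e x + f x).
Proof.
by move=> ce cf i j; under eq_fun do rewrite mxE; move=> x; apply: cvgD; [exact: ce | exact: cf].
Qed.

Lemma cmxN m n (e : K -> 'M[R]_(m, n)) : cmx e -> cmx (fun x => - e x).
Proof.
by move=> ce i j; under eq_fun do rewrite mxE; move=> x; apply: cvgN; exact: ce.
Qed.

Lemma cmxT m n (e : K -> 'M[R]_(m, n)) : cmx e -> cmx (fun x => (e x)^T).
Proof. by move=> ce i j; under eq_fun do rewrite mxE; exact: ce. Qed.

(** Points are chosen whose rows have the largest possible rank; a row outside their span could be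
    adjoined and would raise it. *)
Lemma finite_span (T : Type) m (c : T -> 'rV[R]_m) :
  exists r (t : 'I_r -> T), forall x, (c x <= \matrix_k c (t k))%MS.
Proof.
pose P k := `[< exists r (t : 'I_r -> T), \rank (\matrix_i c (t i)) = k >].
have exP : exists k, P k.
  exists (\rank (\matrix_(i < 0) (0 : 'rV[R]_m))); apply/asboolP.
  by exists 0, (fun i : 'I_0 => match notF (ltn_ord i) with end); congr mxrank; apply/matrixP => -[].
have ubP k : P k -> (k <= m)%N by move=> /asboolP[r [t <-]]; exact: rank_leq_col.
case: (ex_maxnP exP ubP) => k /asboolP[r [t rk]] kmax.
exists r, t => x; apply: contrapT => /negP Nx.
pose t' (i : 'I_(1 + r)) := if fintype.split i is inr j then t j else x.
have E : \matrix_i c (t' i) = col_mx (c x) (\matrix_i c (t i)).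
  apply/matrixP => i j; rewrite !mxE /t'.
  by case: (fintype.split i) => a; rewrite ?mxE ?ord1.
have /kmax : P (\rank (\matrix_i c (t' i))) by apply/asboolP; exists _, t'.
rewrite E -rk leqNgt => /negP; apply; apply: rank_ltmx.
have sub : (\matrix_i c (t i) <= col_mx (c x) (\matrix_i c (t i)))%MS.
  by rewrite -addsmxE addsmxSr.
rewrite ltmxE sub /=; apply/negP => h; move/negP: Nx; apply; apply: submx_trans h.
by rewrite -addsmxE addsmxSl.
Qed.
End continuous_matrices.

Ltac cmx_tac := repeat lazymatch goal with
  | |- cmx (fun _ => ?B) => exact: cmx_cst
  | |- cmx (fun x => @mulmx _ _ _ _ (@?e x) (@?f x)) => apply: (@cmxM _ _ _ _ _ e f)
  | |- cmx (fun x => @trmx _ _ _ (@?e x)) => apply: (@cmxT _ _ _ _ e)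
  | |- cmx (fun x => GRing.add (@?e x) (@?f x)) => apply: (@cmxD _ _ _ _ e f)
  | |- cmx (fun x => GRing.opp (@?e x)) => apply: (@cmxN _ _ _ _ e)
  | |- cmx _ => assumption
  end.

Section representative_functions.
Variables (R : realType) (K : topologicalGroupType).

(** A representative function: its left translates span a finite-dimensional space. The components
    of [e] are arbitrary functions, possibly discontinuous, and their span need not be stable under
    translation. This keeps products and the descent to a quotient easy; [rep_frame] recovers a
    continuous family stable under translation. *)
Definition rep (f : K -> R) : Prop := continuous f /\
  exists m (e : K -> 'cV[R]_m), forall g, exists c : 'rV_m,
  forall x, f (g^-1 * x)%g = (c *m e x) 0 0.

Lemma rep_cst (a : R) : rep (fun=> a).
Proof.
split; first by move=> x; exact: cvg_cst.
exists 1%N, (fun=> a%:M) => g; exists 1%:M => x.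
by rewrite mul1mx !mxE eqxx mulr1n.
Qed.

Lemma repD (f h : K -> R) : rep f -> rep h -> rep (fun x => f x + h x).
Proof.
move=> [cf [m [e He]]] [ch [m' [e' He']]]; split.
  by move=> x; apply: cvgD; [exact: cf | exact: ch].
exists (m + m')%N, (fun x => col_mx (e x) (e' x)) => g.
have [c Hc] := He g; have [c' Hc'] := He' g.
by exists (row_mx c c') => x; rewrite mul_row_col [in RHS]mxE Hc Hc'.
Qed.

Lemma repM (f h : K -> R) : rep f -> rep h -> rep (fun x => f x * h x).
Proof.
move=> [cf [m [e He]]] [ch [m' [e' He']]]; split.
  by move=> x; apply: cvgM; [exact: cf | exact: ch].
exists (m * m')%N, (fun x => (mxvec (e x *m (e' x)^T))^T) => g.
have [c Hc] := He g; have [c' Hc'] := He' g.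
exists (mxvec (c^T *m c')) => x; rewrite mxvec_dotmul.
rewrite -!mulmxA mulmxA -trmx_mul [in RHS]mxE big_ord_recl big_ord0 addr0.
by rewrite Hc Hc' [in X in _ = _ * X]mxE.
Qed.

Lemma rep_sum (I : Type) (s : seq I) (F : I -> K -> R) :
  (forall i, rep (F i)) -> rep (fun x => \sum_(i <- s) F i x).
Proof.
move=> rF; elim: s => [|i s IH].
  by under eq_fun do rewrite big_nil; exact: rep_cst.
by under eq_fun do rewrite big_cons; exact: repD.
Qed.

Lemma rep_prod (I : Type) (s : seq I) (F : I -> K -> R) :
  (forall i, rep (F i)) -> rep (fun x => \prod_(i <- s) F i x).
Proof.
move=> rF; elim: s => [|i s IH].
  by under eq_fun do rewrite big_nil; exact: rep_cst.
by under eq_fun do rewrite big_cons; exact: repM.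
Qed.

Lemma repN (f : K -> R) : rep f -> rep (fun x => - f x).
Proof.
by move=> rf; under eq_fun do rewrite -mulN1r; apply: repM => //; exact: rep_cst.
Qed.

(** The functions [(u *m e x) 0 0] of [x] form a translation-invariant space, and [g] acts on their
    coefficient rows by [u *m A g]; hence the reversed order in [A (g * h) = A h *m A g] below. The
    components of [e] may be dependent here, so that [A] is determined, and multiplicative, only
    after orthonormalisation. *)
Definition frame m (e : K -> 'cV[R]_m) (A : K -> 'M[R]_m) :=
  cmx e /\ forall g x, e (g^-1 * x)%g = A g *m e x.

Lemma continuous_invg_mul (x : K) : continuous (fun g : K => (g^-1 * x)%g).
Proof.
move=> g; apply: (@continuous_comp _ _ _ (fun g : K => (g^-1)%g) (fun g => (g * x)%g)).
  exact: invg_continuous.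
exact: continuous_mulgr.
Qed.

(* Finitely many translates [x |-> f ((t k)^-1 x)], chosen with coefficient rows of maximal rank,
   span all of them. *)
Lemma rep_frame (f : K -> R) : rep f ->
  exists m (e : K -> 'cV[R]_m) A (u : 'rV_m), frame e A /\ forall x, f x = (u *m e x) 0 0.
Proof.
move=> [cf [m [e]]] /choice[c Hc].
have [r [t Ht]] := finite_span c.
pose e' (x : K) : 'cV[R]_r := \col_k f ((t k)^-1 * x)%g.
have Ee' x : e' x = (\matrix_k c (t k)) *m e x.
  apply/matrixP => i j; rewrite !mxE Hc mxE ord1.
  by apply: eq_bigr => k _; rewrite mxE.
have /choice[D HD] : forall g, exists d : 'rV[R]_r, forall x, f (g^-1 * x)%g = (d *m e' x) 0 0.
  move=> g; have /submxP[d Hd] := Ht g; exists d => x.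
  by rewrite Hc Hd Ee' mulmxA.
exists r, e', (fun g => \matrix_k D (g * t k)%g), (D 1%g); split; [split|].
- move=> i j; under eq_fun do rewrite mxE.
  move=> x; apply: (@continuous_comp _ _ _ (fun x : K => ((t i)^-1 * x)%g) f).
    exact: continuous_mulgl.
  exact: cf.
- move=> g x; apply/matrixP => i j; rewrite !mxE ord1 mulgA -invgM HD mxE.
  by apply: eq_bigr => k _; rewrite [X in _ = X * _]mxE.
- by move=> x; rewrite -HD invg1 mul1g.
Qed.

Lemma frame_rep m (e : K -> 'cV[R]_m) A i : frame e A -> rep (fun x => e x i 0).
Proof.
move=> [ce He]; split; first exact: ce.
exists m, e => g; exists (row i (A g)) => x.
by rewrite He [in LHS]mxE [in RHS]mxE; apply: eq_bigr => k _; rewrite mxE.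
Qed.

End representative_functions.

Section orthonormal_frames.
Variables (R : realType) (K : topologicalGroupType).
Hypothesis Kc : compact [set: K].
Local Notation bK := (Defs_borel__canonical__measurable_structure_Measurable K).
Variable mu : probability bK R.
Hypothesis muH : is_haar mu.
Let cint := continuous_integrable Kc mu.

Definition mI m n (e : K -> 'M[R]_(m, n)) : 'M[R]_(m, n) :=
  \matrix_(i, j) \int[mu]_x e x i j.

Lemma int_cst (a : R) : \int[mu]_(x in setT) a = a.
Proof.
rewrite Rintegral_cst// -[RHS]mulr1; congr (_ * _).
by have := congr1 fine (probability_setT mu).
Qed.

Lemma int_sum (I : Type) (s : seq I) (F : I -> K -> R) :
  (forall i, continuous (F i)) ->
  \int[mu]_x (\sum_(i <- s) F i x) = \sum_(i <- s) \int[mu]_x F i x.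
Proof.
move=> cF; elim: s => [|i s IH].
  by rewrite big_nil; under eq_Rintegral do rewrite big_nil; rewrite int_cst.
rewrite big_cons -IH; under eq_Rintegral do rewrite big_cons.
by rewrite RintegralD//; apply: cint => //; exact: continuous_bigsum.
Qed.

Lemma mI_mull m n p (B : 'M[R]_(p, m)) (e : K -> 'M[R]_(m, n)) : cmx e ->
  mI (fun x => B *m e x) = B *m mI e.
Proof.
move=> ce; apply/matrixP => i j; rewrite !mxE.
under eq_Rintegral do rewrite mxE.
rewrite int_sum => [|k]; last by move=> x; apply: cvgM; [exact: cvg_cst | exact: ce].
by apply: eq_bigr => k _; rewrite RintegralZl ?mxE//; exact: cint.
Qed.

Lemma mI_tr m n (e : K -> 'M[R]_(m, n)) : mI (fun x => (e x)^T) = (mI e)^T.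
Proof. by apply/matrixP => i j; rewrite !mxE; under eq_Rintegral do rewrite mxE. Qed.

Lemma mI_mulr m n p (e : K -> 'M[R]_(m, n)) (B : 'M[R]_(n, p)) : cmx e ->
  mI (fun x => e x *m B) = mI e *m B.
Proof.
move=> ce; rewrite -[RHS]trmxK trmx_mul -mI_tr -mI_mull; last exact: cmxT.
by rewrite -mI_tr; congr mI; apply/funext => x; rewrite trmx_mul !trmxK.
Qed.

Lemma mID m n (e f : K -> 'M[R]_(m, n)) : cmx e -> cmx f ->
  mI (fun x => e x + f x) = mI e + mI f.
Proof.
move=> ce cf; apply/matrixP => i j; rewrite !mxE.
by under eq_Rintegral do rewrite mxE; rewrite RintegralD//; exact: cint.
Qed.

Lemma mI_cst m n (B : 'M[R]_(m, n)) : mI (fun=> B) = B.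
Proof. by apply/matrixP => i j; rewrite !mxE int_cst. Qed.

Lemma mI_mulgl m n (g : K) (e : K -> 'M[R]_(m, n)) : cmx e ->
  mI (fun x => e (g * x)%g) = mI e.
Proof.
move=> ce; apply/matrixP => i j; rewrite !mxE.
have [_ H] := integral_mulgl muH g (cint (ce i j)); exact: H.
Qed.

(** The set where [f] is positive is open and null, hence empty. *)
Lemma int_ge0_eq0 (f : K -> R) : continuous f -> (forall x, 0 <= f x) ->
  \int[mu]_x f x = 0 -> forall x, f x = 0.
Proof.
move=> cf f0 I0 x; apply/eqP; rewrite eq_le f0 andbT leNgt; apply/negP => fx.
suff : [set y | 0 < f y] = set0 by move/seteqP => [/(_ x fx)].
apply: (open_null Kc muH).
  by apply: (@open_comp _ _ f [set y | 0 < y]) => // y _; exact: cf.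
have : ae_eq mu setT (EFin \o (f : bK -> R)) (cst 0%E).
  have mf := measurable_int _ (cint cf).
  apply/(ae_eq_integral_abs _ measurableT mf).
  have /fineK <- := integrable_fin_num measurableT (integrable_abse (cint cf)).
  rewrite -[RHS]/(0%:E) -I0; congr EFin; congr fine; apply: eq_integral => y _.
  by rewrite /= ger0_norm.
move=> [N [mN N0 sub]]; apply/eqP; rewrite -measure_le0 -N0.
apply: le_measure; rewrite ?inE//.
  apply: open_borel; apply: (@open_comp _ _ f [set y | 0 < y]) => // y _; exact: cf.
by move=> y fy; apply: sub => /= /(_ I) [fy0]; rewrite /= fy0 ltxx in fy.
Qed.

Lemma mI_block m1 m2 n1 n2 (a : K -> 'M[R]_(m1, n1)) b c (d : K -> 'M[R]_(m2, n2)) :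
  mI (fun x => block_mx (a x) (b x) (c x) (d x)) = block_mx (mI a) (mI b) (mI c) (mI d).
Proof.
apply/matrixP => i j; rewrite mxE.
have [i' ->|i' ->] := split_ordP i; have [j' ->|j' ->] := split_ordP j.
- by under eq_Rintegral do rewrite block_mxEul; rewrite block_mxEul mxE.
- by under eq_Rintegral do rewrite block_mxEur; rewrite block_mxEur mxE.
- by under eq_Rintegral do rewrite block_mxEdl; rewrite block_mxEdl mxE.
- by under eq_Rintegral do rewrite block_mxEdr; rewrite block_mxEdr mxE.
Qed.

(** The induction orthonormalises the tail and then treats the first component. Dependent components
    disappear, so [r] may be smaller than [m]; the transition matrices carry an action [A] to
    [C *m A g *m B]. *)
Lemma gram_schmidt m (e : K -> 'cV[R]_m) : cmx e ->
  exists (r : nat) (e' : K -> 'cV[R]_r) (B : 'M[R]_(m, r)) (C : 'M[R]_(r, m)),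
  [/\ forall x, e x = B *m e' x, forall x, e' x = C *m e x &
   mI (fun x => e' x *m (e' x)^T) = 1%:M].
Proof.
elim: m e => [|m IH]; last rewrite -[m.+1]/(1 + m)%N; move=> e ce.
  exists 0, (fun=> 0), 0, 0; split => [x|x|]; first by rewrite mulmx0; apply/matrixP => -[].
    by apply/matrixP => -[].
  by apply/matrixP => -[].
pose e1 x : 'M[R]_1 := usubmx (e x).
pose e2 x : 'cV[R]_m := dsubmx (e x).
have eE x : e x = col_mx (e1 x) (e2 x) by rewrite vsubmxK.
have ce1 : cmx e1 by move=> i j; under eq_fun do rewrite mxE; exact: ce.
have ce2 : cmx e2 by move=> i j; under eq_fun do rewrite mxE; exact: ce.
have [r [e' [B [C [He2 He' ON]]]]] := IH _ ce2.
have ce' : cmx e'.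
  by rewrite (_ : e' = fun x => C *m e2 x); [cmx_tac | exact/funext].
pose p : 'M[R]_(1, r) := mI (fun x => e1 x *m (e' x)^T).
pose d x : 'M[R]_1 := e1 x - p *m e' x.
have cd : cmx d by rewrite /d; cmx_tac.
have dO : mI (fun x => d x *m (e' x)^T) = 0.
  rewrite (_ : (fun x => _) = fun x => e1 x *m (e' x)^T + (- p) *m (e' x *m (e' x)^T)).
    by rewrite mID ?mI_mull ?ON ?mulmx1 ?subrr//; cmx_tac.
  by apply/funext => x; rewrite /d mulmxDl !mulNmx mulmxA.
have cdd : continuous (fun x => d x 0 0 ^+ 2).
  by under eq_fun do rewrite expr2; move=> x; apply: cvgM; exact: cd.
pose n := \int[mu]_x (d x 0 0 ^+ 2).
have n0 : 0 <= n by apply: Rintegral_ge0 => x _; exact: sqr_ge0.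
(* A residual of norm zero vanishes everywhere by continuity, so the first component lies in the
   span of the others and is dropped. *)
have [nE|nN] := eqVneq n 0.
  exists r, e', (col_mx p B), (row_mx (0 : 'M[R]_(r, 1)) C); split => // x; last first.
    by rewrite eE mul_row_col mul0mx add0r -He'.
  rewrite eE mul_col_mx -He2; congr col_mx; apply/eqP; rewrite -subr_eq0; apply/eqP.
  have /eqP := int_ge0_eq0 cdd (fun x => sqr_ge0 _) nE x.
  by rewrite sqrf_eq0 => /eqP d0; apply/matrixP => i j; rewrite !ord1 -/(d x) d0 mxE.
have sN : Num.sqrt n != 0 by rewrite sqrtr_eq0 -ltNge lt_neqAle eq_sym nN.
set s := Num.sqrt n in sN.
exists (1 + r)%N, (fun x => col_mx (s^-1 *: d x) (e' x)), (block_mx s%:M p 0 B),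
  (block_mx (s^-1)%:M (- s^-1 *: (p *m C)) 0 C); split => [x|x|].
- rewrite eE mul_block_col !mul0mx add0r -He2 mul_scalar_mx scalerA divff// scale1r.
  by rewrite /d subrK.
- rewrite eE mul_block_col !mul0mx add0r -He' mul_scalar_mx scaleNr mulNmx -scalemxAl.
  by rewrite -mulmxA -He' scalerBr.
- rewrite (_ : (fun x => _) = fun x => block_mx (s^-2 *: (d x *m (d x)^T))
     (s^-1 *: (d x *m (e' x)^T)) (s^-1 *: (d x *m (e' x)^T)^T) (e' x *m (e' x)^T)); last first.
    apply/funext => x; rewrite tr_col_mx mul_col_row; congr block_mx.
    + by rewrite linearZ /= -scalemxAl -scalemxAr scalerA -expr2 exprVn.
    + by rewrite -scalemxAl.
    + by rewrite trmx_mul trmxK linearZ /= -scalemxAr.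
  rewrite mI_block ON scalar_mx_block; congr block_mx.
  + apply/matrixP => i j; rewrite !ord1 !mxE eqxx mulr1n.
    have h (M : 'M[R]_1) : (s ^- 2 *: (M *m M^T)) 0 0 = s ^- 2 * M 0 0 ^+ 2.
      by rewrite !mxE big_ord_recl big_ord0 addr0 mxE expr2.
    under eq_Rintegral do rewrite h.
    by rewrite RintegralZl//; [rewrite -/n -[X in _ * X](sqr_sqrtr n0) -/s mulVf// expf_neq0 | exact: cint].
  + have -> : (fun x => s^-1 *: (d x *m (e' x)^T)) = fun x => (s^-1)%:M *m (d x *m (e' x)^T).
      by apply/funext => x; rewrite mul_scalar_mx.
    by rewrite mI_mull ?dO ?mulmx0//; cmx_tac.
  + have -> : (fun x => s^-1 *: (d x *m (e' x)^T)^T) = fun x => (s^-1)%:M *m (d x *m (e' x)^T)^T.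
      by apply/funext => x; rewrite mul_scalar_mx.
    by rewrite mI_mull ?mI_tr ?dO ?trmx0 ?mulmx0//; cmx_tac.
Qed.

(** The last clause places the span in $L^2_0(K)$; orthonormality makes [A] determined by [e]. *)
Definition onframe m (e : K -> 'cV[R]_m) (A : K -> 'M[R]_m) :=
  [/\ frame e A, mI (fun x => e x *m (e x)^T) = 1%:M & mI e = 0].

Lemma rep_onframe (f : K -> R) : rep f ->
  exists (m : nat) (e : K -> 'cV[R]_m) (A : K -> 'M[R]_m) (u : 'rV[R]_m),
  onframe e A /\ forall x, f x = \int[mu]_x f x + (u *m e x) 0 0.
Proof.
move=> /rep_frame[m [e0 [A0 [u0 [[ce0 He0] Hf]]]]].
pose e1 x := e0 x - mI e0.
have ce1 : cmx e1 by rewrite /e1; cmx_tac.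
(* Invariance of [mu] gives [A0 g *m mI e0 = mI e0], so centring is compatible with translations. *)
have He1 g x : e1 (g^-1 * x)%g = A0 g *m e1 x.
  by rewrite /e1 He0 mulmxBr -mI_mull// -[in LHS](mI_mulgl g^-1%g)//; under [in LHS]eq_fun do rewrite He0.
have [m' [e [B [C [HB HC ON]]]]] := gram_schmidt ce1.
have me1 : mI e1 = 0 by rewrite mID ?mI_cst ?subrr//; exact: cmx_cst.
exists m', e, (fun g => C *m A0 g *m B), (u0 *m B); split.
  split => //; last first.
    by rewrite (_ : e = fun x => C *m e1 x); [rewrite mI_mull// me1 mulmx0 | exact/funext].
  split; last by move=> g x; rewrite HC He1 HB !mulmxA.
  by rewrite (_ : e = fun x => C *m e1 x); [cmx_tac | exact/funext].
have -> : \int[mu]_x f x = (u0 *m mI e0) 0 0.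
  rewrite -mI_mull// mxE; apply: eq_Rintegral => x _; exact: Hf.
by move=> x; rewrite Hf -mulmxA -HB /e1 mulmxBr [X in _ + X]mxE [X in _ + (_ + X)]mxE addrC subrK.
Qed.

Section onframe_theory.
Variables (m : nat) (e : K -> 'cV[R]_m) (A : K -> 'M[R]_m).
Hypothesis onF : onframe e A.

Let ce : cmx e. Proof. by have [[]] := onF. Qed.
Let He g x : e (g^-1 * x)%g = A g *m e x. Proof. by have [[]] := onF. Qed.
Let ON : mI (fun x => e x *m (e x)^T) = 1%:M. Proof. by have [] := onF. Qed.

(** Multiplying by [(e x)^T] on the right and integrating recovers each matrix. *)
Lemma onframe_inj n (M N : 'M[R]_(n, m)) : (forall x, M *m e x = N *m e x) -> M = N.
Proof.
move=> MN; rewrite -[M]mulmx1 -[N]mulmx1 -ON -!mI_mull; try by cmx_tac.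
by under eq_fun do rewrite mulmxA MN -mulmxA.
Qed.

(** The left side is the Gram matrix of the translated frame, which invariance of [mu] equates with
    that of [e]. *)
Lemma onframe_orth g : A g *m (A g)^T = 1%:M.
Proof.
have ceT : cmx (fun x => e x *m (e x)^T) by cmx_tac.
rewrite -[LHS](congr1 (fun M => M *m _) (mulmx1 (A g))) -ON -mI_mull// -mI_mulr; last first.
  by cmx_tac.
rewrite -[RHS](mI_mulgl g^-1%g)//; congr mI; apply/funext => x.
by rewrite He trmx_mul !mulmxA.
Qed.

Lemma onframe_morph g h : A (g * h)%g = A h *m A g.
Proof. by apply: onframe_inj => x; rewrite -He invgM -mulgA He He mulmxA. Qed.

Lemma onframe1 : A 1%g = 1%:M.
Proof. by apply: onframe_inj => x; rewrite -He invg1 mul1g mul1mx. Qed.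

Lemma onframeV g : A g^-1%g = (A g)^T.
Proof.
by rewrite -[LHS]mul1mx -(mulmx1C (onframe_orth g)) -mulmxA -onframe_morph mulVg onframe1 mulmx1.
Qed.

(** The values of [e] at finitely many points [t k] span all columns, so [A g] is a fixed linear
    expression in the columns [e (g^-1 * t k)], which depend continuously on [g]. *)
Lemma onframe_cmx : cmx A.
Proof.
have [r [t Ht]] := finite_span (fun x => (e x)^T).
set S := \matrix_k _ in Ht.
(* A nonzero cokernel would be a linear relation between the components of [e] valid at every point,
   against [onframe_inj]. *)
have /row_fullP[B HB] : row_full S.
  rewrite -cokermx_eq0; apply/eqP; apply: trmx_inj; rewrite trmx0; apply: onframe_inj => x.
  rewrite mul0mx; apply: trmx_inj; rewrite trmx_mul trmxK trmx0.
  by have /submxP[D ->] := Ht x; rewrite -mulmxA mulmx_coker mulmx0.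
have -> : A = fun g => (B *m \matrix_k (e (g^-1 * t k)%g)^T)^T.
  apply/funext => g; rewrite -[LHS]trmxK; congr trmx; rewrite -[LHS]mul1mx -HB -mulmxA.
  congr (_ *m _); apply/row_matrixP => k; rewrite row_mul !rowK.
  by rewrite -trmx_mul He.
apply: cmxT; apply: cmxM; first exact: cmx_cst.
move=> i j; under eq_fun do rewrite !mxE; move=> g.
apply: (@continuous_comp _ _ _ (fun g : K => (g^-1 * t i)%g) (fun x => e x j 0)).
  exact: continuous_invg_mul.
exact: ce.
Qed.

(** As [A (g^-1 * x) = A x *m A g^-1], each row of [A], transposed, is itself a frame. *)
Lemma onframe_rep i j : rep (fun g => A g i j).
Proof.
have F : frame (fun g => (row i (A g))^T) (fun g => (A g^-1%g)^T).
  split; first by move=> a b; under eq_fun do rewrite !mxE; exact: onframe_cmx.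
  by move=> g x; rewrite onframe_morph -trmx_mul row_mul.
by have := frame_rep j F; under eq_fun do rewrite !mxE.
Qed.

End onframe_theory.
End orthonormal_frames.

(** * Zero sets of representative functions *)

Lemma submx_mul0 (F : fieldType) m1 m2 n p (A : 'M[F]_(m1, n)) (B : 'M[F]_(m2, n))
    (C : 'M[F]_(n, p)) : (A <= B)%MS -> B *m C = 0 -> A *m C = 0.
Proof. by move=> /submxP[D ->] BC; rewrite -mulmxA BC mulmx0. Qed.

Section zero_sets.
Variables (R : realType) (K : topologicalGroupType).
Hypothesis Kc : compact [set: K].
Local Notation bK := (Defs_borel__canonical__measurable_structure_Measurable K).
Variable mu : probability bK R.
Hypothesis muH : is_haar mu.

Lemma uniform_translation (phi : K -> R) (eps : R) : continuous phi -> 0 < eps ->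
  \forall g \near (1%g : K), forall x, `|phi (g^-1 * x)%g - phi x| < eps.
Proof.
move=> cphi eps0.
have := Kc; rewrite compact_near_coveringP => /(_ K (nbhs (1%g : K))
  (fun g x => `|phi (g^-1 * x)%g - phi x| < eps) _) H.
have {}H : \forall g \near (1%g : K), [set: K] `<=` (fun x => `|phi (g^-1 * x)%g - phi x| < eps).
  apply: H => x _.
  pose psi (z : K * K) := phi (z.2^-1 * z.1)%g - phi z.1.
  have cpsi : {for (x, 1%g : K), continuous psi}.
    apply: cvgB.
      apply: (@continuous_comp _ _ _ (fun z : K * K => (z.2^-1 * z.1)%g) phi); last exact: cphi.
      apply: (@continuous_comp _ _ _ (fun z : K * K => (z.2^-1%g, z.1)) (fun z => (z.1 * z.2)%g)).
        apply: cvg_pair => /=; last exact: cvg_fst.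
        by apply: cvg_comp; [exact: cvg_snd | exact: invg_continuous].
      exact: mulg_continuous.
    by apply: cvg_comp; [exact: cvg_fst | exact: cphi].
  have psi1 : psi (x, 1%g) = 0 by rewrite /psi /= invg1 mul1g subrr.
  have : \forall z \near (x, 1%g : K), `|psi z| < eps.
    move/cvgrPdist_lt : cpsi => /(_ _ eps0); rewrite psi1; apply: filterS => z.
    by rewrite sub0r normrN.
  by [].
by apply: filterS H => g Hg x; exact: Hg.
Qed.

(* Steinhaus' argument: the zero set and its small translates lie in [phi < 1/k], whose measure is
   less than twice that of the zero set for large [k]. *)
Lemma zero_set_meets_translates (phi : K -> R) : continuous phi -> (forall x, 0 <= phi x) ->
  (0 < mu [set x | phi x = 0%R])%E ->
  \forall g \near (1%g : K),
    (0 < mu ([set x | phi x = 0%R] `&` [set x | phi (g^-1 * x)%g = 0%R]))%E.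
Proof.
move=> cphi phi0 muZ; pose Z : set bK := [set x | phi x = 0].
have mZ : measurable Z.
  apply: closed_borel; rewrite [X in closed X](_ : _ = phi @^-1` [set 0])//.
  by apply: preimage_closed; [move=> x _; exact: cphi | exact: closed_eq].
pose U (k : nat) : set bK := [set x | phi x < k.+1%:R^-1].
have mU k : measurable (U k).
  apply: open_borel; apply: (@open_comp _ _ phi [set y | y < k.+1%:R^-1]) => //.
have UZ : \bigcap_n U n = Z.
  apply/seteqP; split => [x Ux|x Zx n _]; last by rewrite /U /= Zx invr_gt0.
  apply/eqP; rewrite eq_le phi0 andbT; apply/ler_addgt0Pl => e e0; rewrite addr0.
  have /= := Ux (Num.trunc e^-1) I => /ltW/le_trans; apply.
  rewrite invf_ple ?posrE//; exact/ltW/truncnS_gt.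
have cvgU : mu (U n) @[n --> \oo] --> mu Z.
  rewrite -UZ; apply: nonincreasing_cvg_mu => //.
  - by rewrite (le_lt_trans (probability_le1 mu _)) ?ltry.
  - by rewrite UZ.
  - move=> a b ab; apply/subsetPset => x; rewrite /U /= => /lt_le_trans; apply.
    by rewrite lef_pV2 ?posrE// ler_nat ltnS.
have Zfin : mu Z \is a fin_num by exact: fin_num_measure.
have [k Uk] : exists k, (mu (U k) < mu Z + mu Z)%E.
  have lt : (mu Z < mu Z + mu Z)%E by rewrite lteDl.
  have [N _ /(_ N (leqnn N)) HN] := cvgU _ (open_ereal_lt' lt).
  by exists N.
have k0 : 0 < k.+1%:R^-1 :> R by rewrite invr_gt0.
near=> g.
have Hg : forall x, `|phi (g^-1 * x)%g - phi x| < k.+1%:R^-1.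
  by near: g; exact: uniform_translation.
pose gZ : set bK := [set x | phi (g^-1 * x)%g = 0].
have gZE : gZ = (fun x => (g^-1 * x)%g) @^-1` Z by [].
have mgZ : measurable gZ.
  by rewrite gZE -[X in measurable X]setTI; exact: measurable_mulgl.
rewrite lt_neqAle measure_ge0 andbT eq_sym; apply/negP => /eqP I0.
have : (mu (Z `|` gZ) <= mu (U k))%E.
  apply: le_measure; rewrite ?inE//; first exact: measurableU.
  move=> x [Zx|gZx]; first by rewrite /U /= Zx.
  rewrite /U /=; have := Hg x; rewrite gZx sub0r normrN => /(le_lt_trans _); apply.
  exact: ler_norm.
rewrite leNgt => /negP; apply; apply: (lt_le_trans Uk).
have -> : mu (Z `|` gZ) = (mu Z + mu gZ - mu (Z `&` gZ))%E.
  by apply: measureUfinl => //; rewrite ltey_eq Zfin.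
rewrite I0 sube0; suff -> : mu gZ = mu Z by [].
by rewrite gZE; exact: haar_mulgl.
Unshelve. all: by end_near.
Qed.

(** Connectedness enters in this form because the set of translations it is applied to is visibly
    closed under products. *)
Hypothesis Kconn : forall H : set K, nbhs (1%g : K) H ->
  (forall x y, H x -> H y -> H (x * y)%g) -> H = [set: K].

(* Among the common zero sets of positive measure of spaces of functions [u *m e x] containing [f], one
   belonging to a space of maximal rank is invariant under all small, hence under all, translations. *)
Lemma rep_zero_null (f : K -> R) : rep f -> (0 < mu [set x | f x = 0%R])%E ->
  forall x, f x = 0.
Proof.
move=> /rep_frame[m [e [A [u [[ce He] Hf]]]]] mu0.
pose phi (U : 'M[R]_m) x := \sum_i ((U *m e x) i 0) ^+ 2.
have phi0 U x : 0 <= phi U x by apply: sumr_ge0 => i _; exact: sqr_ge0.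
have cphi U : continuous (phi U).
  apply: continuous_bigsum => i; under eq_fun do rewrite expr2.
  by move=> x; apply: cvgM; apply: (@cmxM _ _ _ _ _ (fun=> U) e) => //; exact: cmx_cst.
have phiE U x : phi U x = 0 <-> U *m e x = 0.
  rewrite /phi; split=> [/eqP|->]; last by rewrite big1// => i _; rewrite mxE expr0n.
  rewrite psumr_eq0 => [|i _]; last exact: sqr_ge0.
  move=> /allP h; apply/matrixP => i j; rewrite ord1 [RHS]mxE; apply/eqP.
  by have := h i (mem_index_enum _); rewrite /= sqrf_eq0.
pose P k := `[< exists U : 'M[R]_m, [/\ (u <= U)%MS, \rank U = k &
  (0 < mu [set x | phi U x = 0%R])%E] >].
have exP : exists k, P k.
  exists (\rank <<u>>%MS); apply/asboolP; exists <<u>>%MS; split => //.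
    by rewrite genmxE.
  suff -> : [set x | phi <<u>>%MS x = 0] = [set x | f x = 0] by [].
  apply/seteqP; split => x /=; rewrite phiE Hf.
    by move=> h; rewrite (@submx_mul0 _ _ _ _ _ u <<u>>%MS) ?genmxE// mxE.
  move=> h; apply: (@submx_mul0 _ _ _ _ _ _ u); first by rewrite genmxE.
  by apply/matrixP => i j; rewrite !ord1 h mxE.
have ubP k : P k -> (k <= m)%N by move=> /asboolP[U [_ <- _]]; exact: rank_leq_col.
case: (ex_maxnP exP ubP) => k /asboolP[U [uU rU muU]] kmax.
pose H : set K := [set g | forall x, U *m e x = 0 -> U *m e (g^-1 * x)%g = 0].
have HT : H = [set: K].
  apply: Kconn; last first.
    by move=> x y Hx Hy z Uz; rewrite invgM -mulgA; apply: Hy; exact: Hx.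
  have := zero_set_meets_translates (cphi U) (phi0 U) muU.
  apply: filterS => g mug x Ux.
  pose V := (U + U *m A g)%MS.
  have /kmax : P (\rank V).
    apply/asboolP; exists V; split => //.
      exact: submx_trans uU (addsmxSl _ _).
    suff -> : [set x | phi V x = 0] =
       [set x | phi U x = 0] `&` [set x | phi U (g^-1 * x)%g = 0] by [].
    apply/seteqP; split => y /=; rewrite !phiE.
      move=> Vy; split; first exact: submx_mul0 (addsmxSl _ _) Vy.
      by rewrite He mulmxA; exact: submx_mul0 (addsmxSr _ _) Vy.
    move=> [U1 U2]; apply: (@submx_mul0 _ _ _ _ _ _ (col_mx U (U *m A g))).
      by rewrite addsmxE.
    by rewrite mul_col_mx U1 -mulmxA -He U2 col_mx0.
  rewrite -rU => rV.
  (* Maximality of the rank of [U] forces [U *m A g] into the row space of [U]. *)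
  rewrite He mulmxA; apply: submx_mul0 Ux; apply: submx_trans (addsmxSr U _) _.
  by rewrite -(geq_leqif (mxrank_leqif_sup (addsmxSl U (U *m A g)))).
have [x0 Zx0] : exists x0, U *m e x0 = 0.
  apply: contrapT => nx; move: muU.
  rewrite (_ : [set x | _] = set0) ?measure0 ?ltxx//.
  by apply/seteqP; split => // x /= /phiE Ux; apply: nx; exists x.
move=> x; have : H (x0 * x^-1)%g by rewrite HT.
move=> /(_ _ Zx0); rewrite invgM invgK mulgVK => Ux.
by rewrite Hf (submx_mul0 uU Ux) mxE.
Qed.
End zero_sets.

(** * Generic pairs *)

Section product_null_sets.
Local Open Scope ereal_scope.
Context d1 d2 (T1 : measurableType d1) (T2 : measurableType d2) (R : realType).
Variables (m1 : {measure set T1 -> \bar R}) (m2 : {sigma_finite_measure set T2 -> \bar R}).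

Lemma product_null (B : set (T1 * T2)) (N : set T1) : measurable B -> measurable N ->
  m1 N = 0 -> (forall x, ~ N x -> m2 (xsection B x) = 0) -> (m1 \x m2) B = 0.
Proof.
move=> mB mN N0 H; rewrite /product_measure1.
rewrite (@ge0_ae_eq_integral _ _ _ m1 setT _ (cst 0)) ?integral0//.
- exact: measurable_fun_xsection.
- exists N; split => // x /= nx; apply: contrapT => Nx; apply: nx => _.
  exact: H.
Qed.

Lemma ae_xsection_null (B : set (T1 * T2)) : measurable B -> (m1 \x m2) B = 0 ->
  {ae m1, forall x, m2 (xsection B x) = 0}.
Proof.
move=> mB B0.
have mf : measurable_fun setT (m2 \o xsection B) by exact: measurable_fun_xsection.
have /(ae_eq_integral_abs _ measurableT mf) : \int[m1]_x `|(m2 \o xsection B) x| = 0.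
  by rewrite -[RHS]B0; apply: eq_integral => x _; rewrite gee0_abs.
by apply: filterS => x /(_ I).
Qed.
End product_null_sets.

(** * Euclidean estimates for row vectors *)

Section squared_norm.
Variable R : realType.

Definition sqn m (u : 'rV[R]_m) : R := (u *m u^T) 0 0.

Lemma sqnE m (u : 'rV[R]_m) : sqn u = \sum_i u 0 i ^+ 2.
Proof. by rewrite /sqn mxE; apply: eq_bigr => i _; rewrite mxE expr2. Qed.

Lemma sqn_ge0 m (u : 'rV[R]_m) : 0 <= sqn u.
Proof. by rewrite sqnE; apply: sumr_ge0 => i _; exact: sqr_ge0. Qed.

Lemma sqn_eq0 m (u : 'rV[R]_m) : sqn u = 0 -> u = 0.
Proof.
rewrite sqnE => /eqP; rewrite psumr_eq0 => [|i _]; last exact: sqr_ge0.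
move=> /allP h; apply/matrixP => i j; rewrite ord1 mxE; apply/eqP.
by have := h j (mem_index_enum _); rewrite /= sqrf_eq0.
Qed.

Lemma sqn_orth m (u : 'rV[R]_m) (A : 'M[R]_m) : A *m A^T = 1%:M -> sqn (u *m A) = sqn u.
Proof. by move=> AO; rewrite /sqn trmx_mul mulmxA -[u *m A *m _]mulmxA AO mulmx1. Qed.

Lemma sqn_sub_orth m (u : 'rV[R]_m) (B : 'M[R]_m) : B *m B^T = 1%:M ->
  sqn (u - u *m B) = 2 * sqn u - 2 * (u *m B *m u^T) 0 0.
Proof.
move=> BO; pose f : R := (u *m B *m u^T) 0 0.
have E1 : (u *m (u *m B)^T) 0 0 = f by rewrite -[u *m _]trmxK trmx_mul trmxK mxE.
rewrite -/f /sqn linearB /= mulmxBl !mulmxBr [LHS]mxE [X in X + _]mxE [X in _ + X]mxE.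
rewrite [(- _ : 'M[R]_1) 0 0]mxE [(_ - _ : 'M[R]_1) 0 0]mxE [(- _ : 'M[R]_1) 0 0]mxE E1.
rewrite -[X in _ - (_ - X)]/(sqn (u *m B)) sqn_orth// -/f /sqn; ring.
Qed.

Lemma sqn_add2 m (a b : 'rV[R]_m) : sqn (a + b) <= 2 * (sqn a + sqn b).
Proof.
rewrite !sqnE -!big_split /= mulr_sumr; apply: ler_sum => i _; rewrite !mxE.
rewrite -subr_ge0 [leRHS](_ : _ = (a 0 i - b 0 i) ^+ 2); first exact: sqr_ge0.
by ring.
Qed.

Lemma sqn_add3 m (a b c : 'rV[R]_m) : sqn (a + b + c) <= 3 * (sqn a + sqn b + sqn c).
Proof.
rewrite !sqnE -!big_split /= mulr_sumr; apply: ler_sum => i _; rewrite !mxE.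
rewrite -subr_ge0 [leRHS](_ : _ = (a 0 i - b 0 i) ^+ 2 + (b 0 i - c 0 i) ^+ 2 + (a 0 i - c 0 i) ^+ 2).
  by rewrite !addr_ge0 ?sqr_ge0.
by ring.
Qed.

(** Lagrange's identity: twice the difference of the two sides is a double sum of squares. *)
Lemma cauchy_schwarz (I : finType) (a b : I -> R) :
  (\sum_i a i * b i) ^+ 2 <= (\sum_i a i ^+ 2) * (\sum_i b i ^+ 2).
Proof.
have : 0 <= \sum_i \sum_j (a i * b j - a j * b i) ^+ 2.
  by apply: sumr_ge0 => i _; apply: sumr_ge0 => j _; exact: sqr_ge0.
rewrite (_ : \sum_i _ = 2 * ((\sum_i a i ^+ 2) * (\sum_i b i ^+ 2)) - 2 * (\sum_i a i * b i) ^+ 2).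
  by move=> h; lra.
have dl (f g : I -> R) : \sum_i \sum_j f i * g j = (\sum_i f i) * (\sum_j g j).
  by rewrite big_distrlr.
transitivity (\sum_i \sum_j (a i ^+ 2 * b j ^+ 2 + b i ^+ 2 * a j ^+ 2 +
    (- 2 * (a i * b i)) * (a j * b j))).
  by apply: eq_bigr => i _; apply: eq_bigr => j _; ring.
under eq_bigr do rewrite !big_split /=.
by rewrite !big_split /= !dl -mulr_sumr; ring.
Qed.

Lemma sqn_mul m n (u : 'rV[R]_m) (M : 'M[R]_(m, n)) :
  sqn (u *m M) <= sqn u * \sum_j \sum_i M i j ^+ 2.
Proof.
rewrite [in leLHS]sqnE mulr_sumr; apply: ler_sum => j _; rewrite mxE sqnE.
exact: cauchy_schwarz.
Qed.
End squared_norm.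

Section generic_pairs.
Variables (R : realType) (K : topologicalGroupType).
Hypothesis Kc : compact [set: K].
Local Notation bK := (Defs_borel__canonical__measurable_structure_Measurable K).
Variable mu : probability bK R.
Hypothesis muH : is_haar mu.

Section one_frame.
Variables (m : nat) (e : K -> 'cV[R]_m) (A : K -> 'M[R]_m).
Hypothesis onF : onframe mu e A.

Let ce : cmx e. Proof. by have [[]] := onF. Qed.
Let He g x : e (g^-1 * x)%g = A g *m e x. Proof. by have [[]] := onF. Qed.
Let orth g : A g *m (A g)^T = 1%:M. Proof. exact: (onframe_orth Kc muH onF). Qed.
Let morph g h : A (g * h)%g = A h *m A g. Proof. exact: (onframe_morph Kc onF). Qed.
Let A1 : A 1%g = 1%:M. Proof. exact: (onframe1 Kc onF). Qed.
Let cA : cmx A. Proof. exact: (onframe_cmx Kc onF). Qed.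

(** The mean of [A] absorbs every [A h] on its right, so [mI mu A *m e y] does not depend on [y];
    its own mean is zero because [e] has mean zero. *)
Lemma mI_onframe : mI mu A = 0.
Proof.
have BA h : mI mu A *m A h = mI mu A.
  rewrite -(mI_mulr Kc mu _ cA) -[RHS](mI_mulgl Kc muH h cA).
  by congr mI; apply/funext => g; rewrite morph.
apply: (onframe_inj Kc onF) => x; rewrite mul0mx.
have cst y : mI mu A *m e y = mI mu A *m e x.
  have {1}-> : y = ((x / y)^-1 * x)%g by rewrite invgF mulgVK.
  by rewrite He mulmxA BA.
have [_ _ e0] := onF.
rewrite -[LHS](mI_cst mu) (_ : (fun=> _) = fun y => mI mu A *m e y); last by apply/funext.
by rewrite mI_mull// e0 mulmx0.
Qed.

(** The bound says that the inner product of [u *m A g] with [u] is at least half of [sqn u] for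
    every [g], while its mean over [g] is zero. *)
Lemma small_displacement_fixed0 (u : 'rV[R]_m) :
  (forall g, sqn (u - u *m A g) <= sqn u) -> u = 0.
Proof.
move=> H; apply: sqn_eq0; apply/eqP; rewrite eq_le sqn_ge0 andbT.
pose f g : R := (u *m A g *m u^T) 0 0.
have cf : cmx (fun g => u *m A g *m u^T) by cmx_tac.
have f0 : \int[mu]_g f g = 0.
  have := mI_mulr Kc mu u^T (cmxM (@cmx_cst R K _ _ u) cA).
  by rewrite (mI_mull Kc mu u cA) mI_onframe mulmx0 mul0mx => /matrixP/(_ 0 0); rewrite !mxE.
have : 0 <= \int[mu]_g (f g - 2^-1 * sqn u).
  by apply: Rintegral_ge0 => x _; have := H x; rewrite sqn_sub_orth// -/(f x); lra.
rewrite RintegralB//; last 2 first.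
- exact: (continuous_integrable Kc mu (cf 0 0)).
- apply: (continuous_integrable Kc mu (f := fun=> 2^-1 * sqn u)) => x; exact: cvg_cst.
by rewrite f0 int_cst; lra.
Qed.

Lemma near1_displacement (d : R) : 0 < d ->
  \forall g \near (1%g : K), forall u : 'rV[R]_m, sqn (u - u *m A g) <= d * sqn u.
Proof.
move=> d0; pose q g : R := \sum_j \sum_i (1%:M - A g) i j ^+ 2.
have cq : continuous q.
  have cB : cmx (fun g => 1%:M - A g) by cmx_tac.
  apply: continuous_bigsum => j; apply: continuous_bigsum => i.
  by under eq_fun do rewrite expr2; move=> x; apply: cvgM; exact: cB.
have q1 : q 1%g = 0.
  by rewrite /q A1 subrr big1// => j _; rewrite big1// => i _; rewrite mxE expr0n.
have : \forall g \near (1%g : K), `|q g| < d.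
  have /cvgrPdist_lt/(_ _ d0) := cq 1%g; rewrite q1; apply: filterS => g.
  by rewrite sub0r normrN.
apply: filterS => g /ltr_normlW /ltW qd u.
rewrite -[X in sqn (X - _)]mulmx1 -mulmxBr mulrC.
by apply: le_trans (sqn_mul _ _) _; apply: ler_wpM2l => //; exact: sqn_ge0.
Qed.

Variables (T : set K) (w : K).
Hypothesis Tdense : forall U : set K, nbhs (1%g : K) U ->
  exists x0, forall t, T t -> exists k : nat, exists2 v, U v & t = (v * x0 ^+ k)%g.
Hypothesis Tgen : forall g, exists t1 t2 t3, [/\ T t1, T t2, T t3 &
  g = (t1 * (w * t2 * w^-1) * t3)%g].

Lemma fixed_pow (u : 'rV[R]_m) x k : u *m A x = u -> u *m A (x ^+ k)%g = u.
Proof.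
move=> ux; elim: k => [|k IH]; first by rewrite expg0 A1 mulmx1.
by rewrite expgS morph mulmxA IH.
Qed.

(* [9 = 3 * 3]: a vector moved by at most a third of its length by each of three isometries is moved by
   at most its length by their product. *)
Lemma pair_without_fixed_vector : exists x0 y0,
  forall u : 'rV[R]_m, u *m A x0 = u -> u *m A y0 = u -> u = 0.
Proof.
have d0 : 0 < 9^-1 :> R by rewrite invr_gt0.
pose V : set K := [set g | forall u : 'rV[R]_m, sqn (u - u *m A g) <= 9^-1 * sqn u].
have V1 : nbhs (1%g : K) V by exact: near1_displacement d0.
(* The second element of the pair is [w * x0 * w^-1], so errors must remain small after conjugation
   by [w]. *)
have Vw : nbhs (1%g : K) [set g | V (w * g * w^-1)%g].
  have cw : continuous (fun g : K => (w * g * w^-1)%g).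
    move=> g; apply: (@continuous_comp _ _ _ (fun g : K => (w * g)%g) (fun g => (g * w^-1)%g)).
      exact: continuous_mulgl.
    exact: continuous_mulgr.
  by apply: cw; rewrite /= mulg1 mulgV.
have [x0 Hx0] := Tdense (filterI V1 Vw).
exists x0, (w * x0 * w^-1)%g => u ux uy; apply: small_displacement_fixed0 => g.
(* Powers of [x0] fix [u], so [t = v * x0 ^+ k] displaces [u] exactly as the small element [v]
   does. *)
have Tu t : T t -> sqn (u - u *m A t) <= 9^-1 * sqn u.
  move=> /Hx0[k [v [Vv _] ->]]; rewrite morph mulmxA fixed_pow//; exact: Vv.
have Tw t : T t -> sqn (u - u *m A (w * t * w^-1)%g) <= 9^-1 * sqn u.
  move=> /Hx0[k [v [_ Vv] ->]].
  have -> : (w * (v * x0 ^+ k) * w^-1 = (w * v * w^-1) * (w * x0 * w^-1) ^+ k)%g.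
    have -> : ((w * x0 * w^-1) ^+ k = w * x0 ^+ k * w^-1)%g.
      elim: k => [|k IH]; first by rewrite !expg0 mulg1 mulgV.
      by rewrite !expgS IH !mulgA mulgVK.
    by rewrite !mulgA mulgVK.
  by rewrite morph mulmxA fixed_pow//; exact: Vv.
have [t1 [t2 [t3 [T1 T2 T3 ->]]]] := Tgen g.
set s := (w * t2 * w^-1)%g.
have -> : u - u *m A (t1 * s * t3)%g = (u - u *m A t1) + (u - u *m A s) *m A t1 +
    (u - u *m A t3) *m (A s *m A t1).
  by rewrite !morph !mulmxBl !mulmxA -!addrA; congr (_ + _); rewrite !addKr.
apply: le_trans (sqn_add3 _ _ _) _.
rewrite (sqn_orth _ (orth t1)) (@sqn_orth _ _ _ (A s *m A t1)); last by rewrite -morph orth.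
have := Tu _ T1; have := Tw _ T2; have := Tu _ T3; rewrite -/s; lra.
Qed.

Hypothesis Kconn : forall H : set K, nbhs (1%g : K) H ->
  (forall x y, H x -> H y -> H (x * y)%g) -> H = [set: K].

(** For a row [u], [u *m D x y *m u^T] is the sum of the squared displacements of [u] by [x] and by
    [y]. Hence [Q x y] vanishes exactly when [x] and [y] have a common nonzero fixed vector, and it
    is a polynomial in matrix coefficients, so representative in each variable. *)
Let D x y : 'M[R]_m := (A x - 1%:M) *m (A x - 1%:M)^T + (A y - 1%:M) *m (A y - 1%:M)^T.
Let Q x y : R := \det (D x y).

Let QP x y : Q x y != 0 <-> forall u : 'rV[R]_m, u *m A x = u -> u *m A y = u -> u = 0.
Proof.
split=> [Q0 u ux uy|H].
  have uD : u *m D x y = 0.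
    rewrite /D mulmxDr !mulmxA !mulmxBr ux uy mulmx1 subrr !mul0mx addr0//.
  have Du : D x y \in unitmx by rewrite unitmxE unitfE.
  by rewrite -[u](mulmxK Du) uD mul0mx.
apply/negP => /eqP Q0.
have /det0P[u u0 uD] : \det (D x y) == 0 by apply/eqP.
have : sqn (u *m (A x - 1%:M)) + sqn (u *m (A y - 1%:M)) = 0.
  have := congr1 (fun M => (M *m u^T) 0 0) uD; rewrite mul0mx [RHS]mxE => <-.
  rewrite /sqn /D; move: (A x - 1%:M) (A y - 1%:M) => X Y.
  by rewrite mulmxDr mulmxDl [RHS]mxE !trmx_mul !mulmxA.
move=> /eqP; rewrite paddr_eq0 ?sqn_ge0// => /andP[/eqP/sqn_eq0 hx /eqP/sqn_eq0 hy].
move/eqP: u0; apply; apply: H; apply/eqP; rewrite -subr_eq0; apply/eqP.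
  by rewrite -hx mulmxBr mulmx1.
by rewrite -hy mulmxBr mulmx1.
Qed.

Let repA i j : rep (fun g => (A g - 1%:M) i j).
Proof.
under eq_fun do rewrite mxE [X in _ + X]mxE; apply: repD; last exact: rep_cst.
exact: (onframe_rep Kc onF).
Qed.

Let repN i j : rep (fun g => ((A g - 1%:M) *m (A g - 1%:M)^T) i j).
Proof.
under eq_fun do rewrite mxE; apply: rep_sum => k.
by under eq_fun do rewrite [(_ ^T) _ _]mxE; apply: repM.
Qed.

Let rep_det (M : K -> 'M[R]_m) : (forall i j, rep (fun g => M g i j)) -> rep (fun g => \det (M g)).
Proof.
move=> rM; apply: rep_sum => s; apply: repM; first exact: rep_cst.
by apply: rep_prod => i.
Qed.

Let repQl y : rep (Q ^~ y).
Proof.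
apply: rep_det => i j; under eq_fun do rewrite mxE; apply: repD => //; exact: rep_cst.
Qed.

Let repQr x : rep (Q x).
Proof.
apply: rep_det => i j; under eq_fun do rewrite mxE; apply: repD => //; exact: rep_cst.
Qed.

Let measurableQ : measurable_fun [set: bK * bK] (fun z : bK * bK => Q z.1 z.2).
Proof.
have mD i j : measurable_fun [set: bK * bK] (fun z : bK * bK => D z.1 z.2 i j).
  pose a (x : bK) : R := ((A x - 1%:M) *m (A x - 1%:M)^T) i j.
  have ma : measurable_fun [set: bK] a by apply: continuous_borel; case: (repN i j).
  rewrite (_ : (fun z : bK * bK => D z.1 z.2 i j) = (a \o fst) \+ (a \o snd)).
    by apply: measurable_funD; apply: measurableT_comp.
  by apply/funext => z; rewrite /D mxE.
apply: measurable_sum => s; apply: measurable_funM => //; apply: measurable_prod => i _.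
exact: mD.
Qed.

(** With [Q x0 y0] nonzero, the zeros of [Q] in its first variable at [y0] form a null set; for [x]
    outside it the function [Q x] is not identically zero, so its zeros are null too, and Fubini
    applies. *)
Lemma generic_pair_frame : exists B : set (bK * bK),
  [/\ measurable B, (mu \x mu)%E B = 0%E &
   forall x y : K, ~ B (x, y) -> forall u : 'rV[R]_m, u *m A x = u -> u *m A y = u -> u = 0].
Proof.
exists [set z | Q z.1 z.2 = 0].
have mB : measurable [set z : bK * bK | Q z.1 z.2 = 0].
  by have := measurableQ measurableT (measurable_set1 0); rewrite setTI.
split => //; last by move=> x y /= /eqP /QP.
have [x0 [y0 /QP Q0]] := pair_without_fixed_vector.
have nul (f : K -> R) : rep f -> (exists x, f x != 0) -> mu [set x | f x = 0] = 0%E.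
  move=> rf [x fx]; apply/eqP; rewrite -measure_le0 leNgt; apply/negP => mf0.
  by have := rep_zero_null Kc muH Kconn rf mf0 x => /eqP; exact/negP.
apply: (@product_null _ _ _ _ _ mu mu _ [set x | Q x y0 = 0]) => //.
- have mQ : measurable_fun setT (Q ^~ y0 : bK -> R) by apply: continuous_borel; case: (repQl y0).
  by have := mQ measurableT _ (measurable_set1 0); rewrite setTI.
- by apply: (nul (Q ^~ y0)) => //; exists x0.
- move=> x /eqP Qx.
  rewrite (_ : xsection _ _ = [set y | Q x y = 0]); first by apply: nul => //; exists y0.
  by apply/seteqP; split => y /=; rewrite /xsection /= inE.
Qed.

End one_frame.
End generic_pairs.

(** * Determinacy by moments and ergodicity of generic pairs *)

Lemma lim_norm_le (R : realType) (u : nat -> R) (l B : R) :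
  (forall n, `|u n| <= B) -> u n @[n --> \oo] --> l -> `|l| <= B.
Proof.
move=> uB ul; have cn : `|u n| @[n --> \oo] --> `|l| by exact: cvg_norm.
rewrite -(cvg_lim (@Rhausdorff R) cn).
by apply: limr_le; [exact: cvgP cn | exact: nearW].
Qed.

Section moment_determinacy.
Context d (T : measurableType d) (R : realType) (mu : probability T R).
Variable g : T -> R.
Hypothesis ig : mu.-integrable setT (EFin \o g).
Variable F : nat -> T -> R.
Hypothesis mF : forall i, measurable_fun setT (F i).
Hypothesis F1 : forall i x, `|F i x| <= 1.

Let mg : measurable_fun setT g.
Proof. exact/measurable_EFinP/(measurable_int _ ig). Qed.

Definition bmeas (k : T -> R) :=
  measurable_fun setT k /\ exists M : R, forall x, `|k x| <= M.

Lemma integrable_mul_bmeas (k : T -> R) : bmeas k ->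
  mu.-integrable setT (EFin \o (fun x => g x * k x)).
Proof.
move=> [mk [M kM]].
apply: (@le_integrable _ _ _ mu setT measurableT _ (EFin \o (fun x => `|M| * g x))).
- by apply/measurable_EFinP; exact: measurable_funM.
- move=> x _ /=; rewrite lee_fin !normrM mulrC normr_id ler_wpM2r//.
  exact: le_trans (kM x) (ler_norm _).
- have := @integrableZl _ _ _ mu setT measurableT `|M| _ ig.
  by apply: eq_integrable => // x _; rewrite /= EFinM.
Qed.

Lemma bmeas_cst (a : R) : bmeas (fun=> a).
Proof. by split; [exact: measurable_cst | exists `|a|]. Qed.

Lemma bmeasM (k l : T -> R) : bmeas k -> bmeas l -> bmeas (fun x => k x * l x).
Proof.
move=> [mk [M kM]] [ml [N lN]]; split; first exact: measurable_funM.
by exists (M * N) => x; rewrite normrM ler_pM.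
Qed.

Lemma bmeasD (k l : T -> R) : bmeas k -> bmeas l -> bmeas (fun x => k x + l x).
Proof.
move=> [mk [M kM]] [ml [N lN]]; split; first exact: measurable_funD.
by exists (M + N) => x; rewrite (le_trans (ler_normD _ _))// lerD.
Qed.

Lemma bmeas_prod (s : seq nat) : bmeas (fun x => \prod_(i <- s) F i x).
Proof.
elim: s => [|i s IH]; first by under eq_fun do rewrite big_nil; exact: bmeas_cst.
under eq_fun do rewrite big_cons; apply: bmeasM => //; split => //.
by exists 1.
Qed.

Lemma bounded_limit_int0 (u_ : nat -> T -> R) (u : T -> R) (B : R) :
  (forall n, measurable_fun setT (u_ n)) -> (forall n x, `|u_ n x| <= B) ->
  (forall x, u_ n x @[n --> \oo] --> u x) ->
  (forall n, \int[mu]_x (g x * u_ n x) = 0) -> \int[mu]_x (g x * u x) = 0.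
Proof.
move=> mu_ uB cu I0.
have mu' : measurable_fun setT u.
  by apply: (@measurable_fun_cvg _ _ _ setT u_) => // x _; exact: cu.
have uB' x : `|u x| <= B.
  by apply: lim_norm_le (cu x) => n; exact: uB.
have E n : (\int[mu]_x (g x * u_ n x)%:E = 0)%E.
  have := integrable_fin_num measurableT (integrable_mul_bmeas (conj (mu_ n) (ex_intro _ B (uB n)))).
  by move=> /fineK <-; rewrite -[RHS]/(0%:E) -(I0 n).
rewrite /Rintegral; suff -> : (\int[mu]_x (g x * u x)%:E = 0)%E by [].
have := @dominated_convergence _ _ _ mu setT measurableT (fun n x => (g x * u_ n x)%:E)
  (fun x => (g x * u x)%:E) (fun x => (`|B| * `|g x|)%:E).
case.
- by move=> n; apply/measurable_EFinP; exact: measurable_funM.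
- by apply/measurable_EFinP; exact: measurable_funM.
- apply: aeW => x _; apply: cvg_EFin; first by near=> n.
  by apply: cvgM; [exact: cvg_cst | exact: cu].
- have := integrable_abse ig => /(@integrableZl _ _ _ mu setT measurableT `|B|).
  by apply: eq_integrable => // x _; rewrite /= EFinM.
- apply: aeW => x n _ /=; rewrite lee_fin normrM mulrC ler_wpM2r//.
  exact: le_trans (uB n x) (ler_norm _).
move=> _ _ /=; under eq_fun do rewrite E.
by move=> /cvg_lim <-//; rewrite lim_cst.
Unshelve. all: by end_near.
Qed.

Definition orthogonal_moments (k : T -> R) :=
  forall s : seq nat, \int[mu]_x (g x * (k x * \prod_(i <- s) F i x)) = 0.

(** Quantifying over all [k], and not only [k = 1], makes multipliers closed under products by
    composition. They are also closed under linear combinations and bounded pointwise limits, which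
    is enough to pass from the [F i] to the indicators of all measurable sets. *)
Definition multiplier (m : T -> R) := bmeas m /\
  forall k, bmeas k -> orthogonal_moments k -> orthogonal_moments (fun x => k x * m x).

Lemma multiplier_cst (a : R) : multiplier (fun=> a).
Proof.
split; first exact: bmeas_cst.
move=> k bk zk s.
have -> : (fun x => g x * (k x * a * \prod_(i <- s) F i x)) =
    (fun x => a * (g x * (k x * \prod_(i <- s) F i x))) by apply/funext => x; ring.
rewrite RintegralZl//; first by rewrite zk mulr0.
by apply: integrable_mul_bmeas; apply: bmeasM => //; exact: bmeas_prod.
Qed.

Lemma multiplier_F i : multiplier (F i).
Proof.
split; first by split => //; exists 1.
move=> k bk zk s; rewrite -[RHS](zk (i :: s)); apply: eq_Rintegral => x _.
by rewrite big_cons !mulrA.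
Qed.

Lemma multiplierM (m n : T -> R) : multiplier m -> multiplier n -> multiplier (fun x => m x * n x).
Proof.
move=> [bm zm] [bn zn]; split; first exact: bmeasM.
move=> k bk zk s; have := zn _ (bmeasM bk bm) (zm _ bk zk) s.
by move=> <-; apply: eq_Rintegral => x _; rewrite !mulrA.
Qed.

Lemma multiplierD (m n : T -> R) : multiplier m -> multiplier n -> multiplier (fun x => m x + n x).
Proof.
move=> [bm zm] [bn zn]; split; first exact: bmeasD.
move=> k bk zk s.
have -> : (fun x => g x * (k x * (m x + n x) * \prod_(i <- s) F i x)) =
   (fun x => g x * (k x * m x * \prod_(i <- s) F i x) + g x * (k x * n x * \prod_(i <- s) F i x)).
  by apply/funext => x; ring.
rewrite RintegralD//; last 2 first.
- by apply: integrable_mul_bmeas; apply: bmeasM; [exact: bmeasM | exact: bmeas_prod].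
- by apply: integrable_mul_bmeas; apply: bmeasM; [exact: bmeasM | exact: bmeas_prod].
by rewrite zm// zn// addr0.
Qed.

Lemma multiplierB (m n : T -> R) : multiplier m -> multiplier n -> multiplier (fun x => m x - n x).
Proof.
move=> hm hn; under eq_fun do rewrite -mulN1r; apply: multiplierD => //.
by apply: multiplierM => //; exact: multiplier_cst.
Qed.

Lemma multiplierX (m : T -> R) n : multiplier m -> multiplier (fun x => m x ^+ n).
Proof.
move=> hm; elim: n => [|n IH]; first by under eq_fun do rewrite expr0; exact: multiplier_cst.
by under eq_fun do rewrite exprS; exact: multiplierM.
Qed.

Lemma multiplier_lim (m_ : nat -> T -> R) (m : T -> R) (B : R) :
  (forall n, multiplier (m_ n)) -> (forall n x, `|m_ n x| <= B) ->
  (forall x, m_ n x @[n --> \oo] --> m x) -> multiplier m.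
Proof.
move=> zm mB cm.
have bm : bmeas m.
  split.
    by apply: (@measurable_fun_cvg _ _ _ setT m_) => // n; case: (zm n) => -[].
  by exists B => x; apply: lim_norm_le (cm x) => n; exact: mB.
split => // k bk zk s; have [mk [M kM]] := bk.
have [mp [P pP]] := bmeas_prod s.
have M0 : 0 <= M := le_trans (normr_ge0 _) (kM point).
apply: (@bounded_limit_int0 (fun n x => k x * m_ n x * \prod_(i <- s) F i x) _ (M * B * P)).
- by move=> n; apply: measurable_funM => //; apply: measurable_funM => //; case: (zm n) => -[].
- by move=> n x; rewrite !normrM ler_pM// ?mulr_ge0// ler_pM.
- by move=> x; apply: cvgM; [apply: cvgM; [exact: cvg_cst | exact: cm] | exact: cvg_cst].
- by move=> n; have [_] := zm n; apply.
Unshelve. all: by end_near.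
Qed.

(* Polynomials in [f] increasing to [|f|] when [|f| <= 1]. *)
Fixpoint abs_iter (f : T -> R) n x : R :=
  if n is n'.+1 then abs_iter f n' x + 2^-1 * (f x ^+ 2 - abs_iter f n' x ^+ 2) else 0.

Lemma abs_iter_bound (f : T -> R) n x : `|f x| <= 1 ->
  0 <= abs_iter f n x <= `|f x| /\
  `|f x| - abs_iter f n x <= `|f x| * (1 - 2^-1 * `|f x|) ^+ n.
Proof.
move=> f1; have f0 := normr_ge0 (f x); elim: n => [|n [/andP[p0 pf] IH]] /=.
  by rewrite expr0 mulr1 subr0 !lexx f0.
rewrite -real_normK ?num_real//; set p := abs_iter f n x in p0 pf IH *.
set a := `|f x| in f1 f0 pf IH *.
(* The error is multiplied at each stage by a factor between 0 and [1 - a / 2], as [p] lies between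
   0 and [a], and [a] is at most 1. *)
have E : a - (p + 2^-1 * (a ^+ 2 - p ^+ 2)) = (a - p) * (1 - 2^-1 * (a + p)) by field.
split; last first.
  rewrite E exprSr mulrA; apply: ler_pM => //; [lra | lra | lra].
apply/andP; split; first by rewrite addr_ge0// mulr_ge0 ?invr_ge0// subr_ge0 ler_pXn2r.
by rewrite -subr_ge0 E mulr_ge0//; lra.
Qed.

Lemma abs_iter_cvg (f : T -> R) x : `|f x| <= 1 ->
  abs_iter f n x @[n --> \oo] --> `|f x|.
Proof.
move=> f1; apply/cvgrPdist_le => e e0; have f0 := normr_ge0 (f x).
have [fx0|fx0] := eqVneq (f x) 0.
  apply: nearW => n; have [/andP[p0 pf] _] := abs_iter_bound n f1.
  by rewrite ger0_norm ?subr_ge0//; move: pf p0; rewrite fx0 normr0; lra.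
have fp : 0 < `|f x| by rewrite normr_gt0.
have /cvgrPdist_le/(_ _ e0) : `|f x| * (1 - 2^-1 * `|f x|) ^+ n @[n --> \oo] --> `|f x| * 0.
  apply: cvgM; first exact: cvg_cst.
  by apply: cvg_expr; rewrite ger0_norm; lra.
apply: filterS => n; rewrite mulr0 sub0r normrN => h.
have [/andP[p0 pf] hn] := abs_iter_bound n f1.
rewrite ger0_norm ?subr_ge0//; apply: le_trans hn (le_trans _ h); exact: ler_norm.
Qed.

Lemma multiplier_norm (f : T -> R) : multiplier f -> (forall x, `|f x| <= 1) ->
  multiplier (fun x => `|f x|).
Proof.
move=> hf f1; apply: (@multiplier_lim (abs_iter f) _ 1).
- elim=> [|n IH] /=; first exact: multiplier_cst.
  apply: multiplierD => //; apply: multiplierM; first exact: multiplier_cst.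
  by apply: multiplierB; exact: multiplierX.
- move=> n x; have [/andP[p0 pf] _] := abs_iter_bound n (f1 x).
  by rewrite ger0_norm//; exact: le_trans pf (f1 x).
- by move=> x; exact: abs_iter_cvg.
Qed.

(** With [p] the positive part of [f], the functions [1 - (1 - p) ^+ n] converge to the indicator of
    the points where [p] is positive. *)
Lemma multiplier_pos (f : T -> R) : multiplier f -> (forall x, `|f x| <= 1) ->
  multiplier \1_[set x | 0 < f x].
Proof.
move=> hf f1; pose p x : R := 2^-1 * (f x + `|f x|).
have p0 x : 0 <= p x <= 1.
  have := f1 x; have := ler_norm (f x); have := ler_norm (- f x); rewrite normrN /p.
  by move=> *; apply/andP; split; lra.
have hp : multiplier p.
  apply: multiplierM; first exact: multiplier_cst.
  by apply: multiplierD => //; exact: multiplier_norm.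
apply: (@multiplier_lim (fun n x => 1 - (1 - p x) ^+ n) _ 1).
- move=> n; apply: multiplierB; first exact: multiplier_cst.
  by apply: multiplierX; apply: multiplierB => //; exact: multiplier_cst.
- move=> n x; have /andP[p0x p1x] := p0 x.
  have : 0 <= (1 - p x) ^+ n <= 1 by rewrite exprn_ge0 ?exprn_ile1//; lra.
  by move=> /andP[? ?]; rewrite ler_norml; apply/andP; split; lra.
- move=> x; rewrite indicE; have /andP[p0x p1x] := p0 x.
  have [fx|fx] := ltP 0 (f x).
    rewrite mem_set// -[X in _ --> X]subr0; apply: cvgB; first exact: cvg_cst.
    apply: cvg_expr; rewrite ger0_norm ?subr_ge0// ltrBlDr ltrDl /p.
    by have := ler_norm (f x); lra.
  rewrite memNset; last by apply/negP; rewrite -leNgt.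
  have -> : p x = 0 by rewrite /p ler0_norm// subrr mulr0.
  under eq_fun do rewrite subr0 expr1n subrr; exact: cvg_cst.
Qed.

Hypothesis genF : @measurable _ T = <<s [set [set x | 0 < F i x] | i in [set: nat]] >>.
Hypothesis momF : forall s : seq nat, \int[mu]_x (g x * \prod_(i <- s) F i x) = 0.

(** The sets whose indicators are multipliers form a sigma-algebra containing the generators of
    [genF]. *)
Lemma multiplier_indic (A : set T) : measurable A -> multiplier \1_A.
Proof.
suff sub : @measurable _ T `<=` [set A | multiplier (\1_A : T -> R)] by exact: sub.
rewrite genF; apply: smallest_sub; first split.
- rewrite /= (_ : \1_set0 = fun=> 0) ?indic0//; exact: multiplier_cst.
- move=> B /= zB; rewrite setTD.
  have -> : \1_(~` B) = (fun x => 1 - \1_B x) :> (T -> R).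
    by apply/funext => x; rewrite !indicE in_setC; case: (x \in B); rewrite ?subrr ?subr0.
  by apply: multiplierB => //; exact: multiplier_cst.
- move=> B zB /=; pose m_ n : T -> R := fun x => 1 - \prod_(i < n) (1 - \1_(B i) x).
  have ind01 i x : (\1_(B i) x : R) = 0 \/ (\1_(B i) x : R) = 1.
    by rewrite indicE; case: (x \in _); [right | left].
  have m01 n x : 0 <= \prod_(i < n) (1 - \1_(B i) x : R) <= 1.
    apply/andP; split; first by apply: prodr_ge0 => i _; case: (ind01 i x) => ->; lra.
    by apply: prodr_ile1 => i _; case: (ind01 i x) => ->; apply/andP; split; lra.
  apply: (@multiplier_lim m_ _ 1).
  + move=> n; apply: multiplierB; first exact: multiplier_cst.
    elim: n => [|n IH]; first by under eq_fun do rewrite big_ord0; exact: multiplier_cst.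
    under eq_fun do rewrite big_ord_recr; apply: multiplierM => //.
    by apply: multiplierB; [exact: multiplier_cst | exact: zB].
  + move=> n x; have /andP[? ?] := m01 n x.
    by rewrite ler_norml /m_; apply/andP; split; lra.
  + move=> x; apply: cvg_near_cst; have [xB|xB] := pselect ((\bigcup_i B i) x).
      have [k _ Bk] := xB; exists k.+1 => // n /= kn.
      rewrite indicE mem_set// /m_ (bigD1 (Ordinal kn))//= indicE mem_set//.
      by rewrite subrr mul0r subr0.
    apply: nearW => n; rewrite indicE memNset// /m_ big1 ?subrr// => i _.
    by rewrite indicE memNset ?subr0// => Bi; apply: xB; exists i.
- by move=> _ [i _ <-] /=; apply: multiplier_pos => //; exact: multiplier_F.
Qed.

Lemma moments_eq0 : {ae mu, forall x, g x = 0}.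
Proof.
have : ae_eq mu setT (EFin \o g) (cst 0%E).
  apply: integral_ae_eq => // A _ mA.
  rewrite integral0 integral_mkcond.
  have [_ /(_ _ (bmeas_cst 1))] := multiplier_indic mA.
  have z1 : orthogonal_moments (fun=> 1).
    by move=> s; under eq_Rintegral do rewrite mul1r; exact: momF.
  move=> /(_ z1 [::]) I0.
  have bA : bmeas (\1_A : T -> R) by have [] := multiplier_indic mA.
  have I1 : \int[mu]_x (g x * \1_A x) = 0.
    by rewrite -[RHS]I0; apply: eq_Rintegral => x _; rewrite big_nil mul1r mulr1.
  have FK := fineK (integrable_fin_num measurableT (integrable_mul_bmeas bA)).
  rewrite -[RHS](etrans (esym FK) (congr1 EFin I1)); apply: eq_integral => x _ /=.
  by rewrite /patch indicE; case: (x \in A); rewrite ?mulr1 ?mulr0.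
by apply: filterS => x /(_ I) [].
Qed.

End moment_determinacy.

(** * Peter-Weyl completeness and ergodicity of pairs without fixed vectors *)

Section complete_frames.
Variables (R : realType) (K : topologicalGroupType).
Hypothesis Kc : compact [set: K].
Local Notation bK := (Defs_borel__canonical__measurable_structure_Measurable K).
Variable mu : probability bK R.
Hypothesis muH : is_haar mu.

Record onfr := OnFr { od : nat ; oe : K -> 'cV[R]_od ; oA : K -> 'M[R]_od ;
  onfrP : onframe mu oe oA }.

(** Completeness in $L^2_0(K)$, asked of all integrable functions of mean zero; for a probability
    these include both the square-integrable eigenfunctions and the centred indicators to which it
    is applied. *)
Definition complete (Phi : nat -> onfr) := forall g : bK -> R,
  mu.-integrable setT (EFin \o g) -> \int[mu]_x g x = 0 ->
  (forall j i, \int[mu]_x (g x * oe (Phi j) x i 0) = 0) ->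
  {ae mu, forall x, g x = 0}.

Lemma continuous_bmeas (f : K -> R) : continuous f -> bmeas (f : bK -> R).
Proof. by move=> cf; split; [exact: continuous_borel | exact: continuous_bounded]. Qed.

Lemma int_mul_mx m (g : bK -> R) (u : 'rV[R]_m) (e : K -> 'cV[R]_m) :
  mu.-integrable setT (EFin \o g) -> cmx e ->
  \int[mu]_x (g x * (u *m e x) 0 0) = \sum_i u 0 i * \int[mu]_x (g x * e x i 0).
Proof.
move=> ig ce.
have h (s : seq 'I_m) : \int[mu]_x (g x * \sum_(i <- s) u 0 i * e x i 0) =
    \sum_(i <- s) u 0 i * \int[mu]_x (g x * e x i 0).
  elim: s => [|i s IH].
    by rewrite big_nil; under eq_Rintegral do rewrite big_nil mulr0; rewrite int_cst.
  rewrite big_cons -IH -RintegralZl//; last first.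
    by apply: integrable_mul_bmeas => //; exact: (continuous_bmeas (ce i 0)).
  rewrite -RintegralD//.
  - by apply: eq_Rintegral => x _; rewrite big_cons; ring.
  - have -> : (fun x => u 0 i * (g x * e x i 0)) = (fun x => g x * (u 0 i * e x i 0)).
      by apply/funext => x; ring.
    apply: integrable_mul_bmeas => //.
    by apply: bmeasM; [exact: bmeas_cst | exact: (continuous_bmeas (ce i 0))].
  - apply: integrable_mul_bmeas => //; apply: (@continuous_bmeas (fun x => \sum_(i <- s) u 0 i * e x i 0)).
    by apply: continuous_bigsum => k x; apply: cvgM; [exact: cvg_cst | exact: ce].
by rewrite -h; apply: eq_Rintegral => x _; rewrite mxE.
Qed.

(** Each finite product of the rescaled functions is a constant plus an element of the span of one
    frame. Orthogonality to constants and to all these frames therefore kills every moment, and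
    [moments_eq0] concludes. Rescaling bounds the functions by 1 without changing where they are
    positive. *)
Lemma complete_frames (F : nat -> K -> R) : (forall i, rep (F i)) ->
  @measurable _ bK = <<s [set [set x | 0 < F i x] | i in [set: nat]] >> ->
  exists Phi, complete Phi.
Proof.
move=> rF genF.
have /choice[B HB] : forall i, exists B : R, forall x, `|F i x| <= B.
  by move=> i; apply: continuous_bounded => //; case: (rF i).
have Bp i : 0 < `|B i| + 1 by rewrite ltr_wpDl.
pose G i x : R := (`|B i| + 1)^-1 * F i x.
have rG i : rep (G i) by apply: repM => //; exact: rep_cst.
have G1 i x : `|G i x| <= 1.
  rewrite normrM gtr0_norm ?invr_gt0// mulrC ler_pdivrMr// mul1r.
  by rewrite (le_trans (HB i x))// (le_trans (ler_norm _))// lerDl.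
have genG : @measurable _ bK = <<s [set [set x | 0 < G i x] | i in [set: nat]] >>.
  rewrite genF; congr (<<s _ >>); apply/seteqP; split => _ [i _ <-]; exists i => //;
  by apply/seteqP; split => x; rewrite /= /G pmulr_rgt0 ?invr_gt0.
have /choice[psi Hpsi] : forall s : seq nat, exists P : onfr, exists u : 'rV_(od P),
    forall x, \prod_(i <- s) G i x = \int[mu]_x \prod_(i <- s) G i x + (u *m oe P x) 0 0.
  move=> s; have [m [e [A [u [onF Hu]]]]] := rep_onframe Kc muH (rep_prod s rG).
  by exists (OnFr onF), u.
(* A natural number coding no sequence receives the frame of the empty product. *)
exists (fun n => psi (odflt [::] (@choice.unpickle (seq nat) n))) => g ig g0 gorth.
apply: (moments_eq0 ig (F := G)) => //.
- by move=> i; apply: continuous_borel; case: (rG i).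
- move=> s; have [u Hu] := Hpsi s.
  under eq_Rintegral do rewrite Hu mulrDr.
  have ce : cmx (oe (psi s)) by have [[]] := onfrP (psi s).
  have cu : continuous (fun x => (u *m oe (psi s) x) 0 0).
    by apply: (@cmxM _ _ _ _ _ (fun=> u) (oe (psi s))) => //; exact: cmx_cst.
  rewrite RintegralD//; last 2 first.
  - by apply: integrable_mul_bmeas => //; exact: bmeas_cst.
  - by apply: integrable_mul_bmeas => //; exact: (continuous_bmeas cu).
  rewrite RintegralZr// g0 mul0r add0r int_mul_mx// big1// => i _.
  by have := gorth (choice.pickle s); rewrite choice.pickleK /= => ->; rewrite mulr0.
Qed.

Section coefficients.
Variables (m : nat) (e : K -> 'cV[R]_m) (A : K -> 'M[R]_m).
Hypothesis onF : onframe mu e A.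

Let ce : cmx e. Proof. by have [[]] := onF. Qed.
Let He g x : e (g^-1 * x)%g = A g *m e x. Proof. by have [[]] := onF. Qed.

Definition frame_coef (f : bK -> R) : 'rV[R]_m := \row_i \int[mu]_x (f x * e x i 0).

Let bce i : bmeas ((fun x => e x i 0) : bK -> R).
Proof. apply: continuous_bmeas; exact: ce. Qed.

(** Invariance of [mu] moves the translation onto [e], where it appears as [A g^-1], the transpose
    of [A g]. *)
Lemma frame_coef_translate (f : bK -> R) (g : K) : mu.-integrable setT (EFin \o f) ->
  frame_coef (fun x : bK => f ((g^-1 : K) * x)%g) = frame_coef f *m A g.
Proof.
move=> If; apply/matrixP => i0 i; rewrite !mxE.
have [If' _] := integral_mulgl muH g^-1%g If.
have Ih := integrable_mul_bmeas If' (bce i).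
have [_ <-] := integral_mulgl muH g Ih.
under eq_Rintegral do rewrite mulKg.
have E x : e (g * x)%g i 0 = (row i (A g)^T *m e x) 0 0.
  by rewrite -[in LHS](invgK g) He (onframeV Kc muH onF) -row_mul [RHS]mxE.
under eq_Rintegral do rewrite E.
by rewrite int_mul_mx//; apply: eq_bigr => k _; rewrite !mxE mulrC.
Qed.

Lemma frame_coefD (f h : bK -> R) : mu.-integrable setT (EFin \o f) -> mu.-integrable setT (EFin \o h) ->
  frame_coef (fun x => f x + h x) = frame_coef f + frame_coef h.
Proof.
move=> If Ih; apply/matrixP => i0 i; rewrite !mxE.
under eq_Rintegral do rewrite mulrDl.
by rewrite RintegralD//; exact: integrable_mul_bmeas.
Qed.

Lemma frame_coefZ (f : bK -> R) a : mu.-integrable setT (EFin \o f) ->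
  frame_coef (fun x => a * f x) = a *: frame_coef f.
Proof.
move=> If; apply/matrixP => i0 i; rewrite !mxE.
under eq_Rintegral do rewrite -mulrA.
by rewrite RintegralZl//; exact: integrable_mul_bmeas.
Qed.

Lemma eq_frame_coef (f h : bK -> R) : mu.-integrable setT (EFin \o f) ->
  mu.-integrable setT (EFin \o h) ->
  {ae mu, forall x, f x = h x} -> frame_coef f = frame_coef h.
Proof.
move=> If Ih fh; apply/matrixP => i0 i; rewrite !mxE; congr fine.
apply: ae_eq_integral => //.
- exact: measurable_int (integrable_mul_bmeas If (bce i)).
- exact: measurable_int (integrable_mul_bmeas Ih (bce i)).
- by apply: filterS fh => x /= -> _.
Qed.

End coefficients.

(** The coefficient rows of the centred indicator of [S] are fixed by both [x] and [y], hence zero.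
    By completeness the indicator is almost everywhere the constant [mu S], which must then be 0 or
    1. *)
Lemma invariant_set_trivial (Phi : nat -> onfr) (x y : K) : complete Phi ->
  (forall j (u : 'rV_(od (Phi j))), u *m oA (Phi j) x = u -> u *m oA (Phi j) y = u -> u = 0) ->
  forall S : set bK, measurable S -> (forall z : K, S (x * z)%g <-> S z) ->
  (forall z : K, S (y * z)%g <-> S z) -> mu S = 0%E \/ mu S = 1%E.
Proof.
move=> cPhi fix0 S mS Sx Sy.
pose c := fine (mu S).
have cE : mu S = c%:E by rewrite fineK//; exact: fin_num_measure.
pose g (z : bK) : R := \1_S z - c.
have bg : bmeas g.
  by split; [apply: measurable_funB | exists (1 + `|c|) => z; rewrite (le_trans (ler_normB _ _))// lerD// indicE; case: (_ \in _); rewrite ?normr1 ?normr0].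
have ig : mu.-integrable setT (EFin \o g) by apply: bounded_integrable; case: bg.
have g0 : \int[mu]_z g z = 0.
  rewrite RintegralB//; last 2 first.
  - apply: bounded_integrable => //; exists 1 => z; rewrite indicE.
    by case: (_ \in _); rewrite ?normr1 ?normr0.
  - by apply: bounded_integrable => //; exists `|c|.
  by rewrite int_cst /Rintegral integral_indic// setIT subrr.
have inv (w : K) : (forall z : K, S (w * z)%g <-> S z) ->
    (fun z : bK => g ((w^-1 : K) * z)%g) = g.
  move=> Sw; apply/funext => z; rewrite /g !indicE.
  suff -> : ((w^-1 * z)%g \in S) = (z \in S) by [].
  have H := Sw (w^-1 * z)%g; rewrite mulVKg in H.
  by apply/idP/idP; rewrite !inE => /H.
have := cPhi g ig g0; case.
  move=> j i; have onF := onfrP (Phi j).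
  have : frame_coef (oe (Phi j)) g = 0.
    apply: (fix0 j); rewrite -(frame_coef_translate onF)//.
    - by rewrite inv.
    - by rewrite inv.
  by move=> /matrixP/(_ 0 i); rewrite !mxE.
move=> N [mN N0 sub].
have [c0|c0] := eqVneq c 0; first by left; rewrite cE c0.
have [c1|c1] := eqVneq c 1; first by right; rewrite cE c1.
exfalso; have : (mu [set: bK] <= mu N)%E.
  apply: le_measure; rewrite ?inE// => z _; apply: sub => /=; rewrite /g indicE.
  by case: (_ \in _) => /eqP; rewrite subr_eq0 eq_sym; apply/negP.
by rewrite N0 (probability_setT mu) lee_fin ler10.
Qed.

End complete_frames.

(** * Eigenvalues and almost invariant vectors *)

Section symmetric_eigenvector.
Variable R : realType.
Local Notation toC := (real_complex R).

Lemma Re_mulmx m n p (w : 'M[R[i]]_(m, n)) (M : 'M[R]_(n, p)) :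
  map_mx (@complex.Re R) (w *m map_mx toC M) = map_mx (@complex.Re R) w *m M.
Proof.
apply/matrixP => i j; rewrite !mxE.
have -> : complex.Re (\sum_k w i k * map_mx toC M k j) = \sum_k complex.Re (w i k * map_mx toC M k j).
  by rewrite (big_morph (@complex.Re R) (id1 := 0) (op1 := +%R))// => -[? ?] [? ?].
by apply: eq_bigr => k _; rewrite !mxE; case: (w i k) => a b /=; rewrite mulr0 subr0.
Qed.

Lemma Im_mulmx m n p (w : 'M[R[i]]_(m, n)) (M : 'M[R]_(n, p)) :
  map_mx (@complex.Im R) (w *m map_mx toC M) = map_mx (@complex.Im R) w *m M.
Proof.
apply/matrixP => i j; rewrite !mxE.
have -> : complex.Im (\sum_k w i k * map_mx toC M k j) = \sum_k complex.Im (w i k * map_mx toC M k j).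
  by rewrite (big_morph (@complex.Im R) (id1 := 0) (op1 := +%R))// => -[? ?] [? ?].
by apply: eq_bigr => k _; rewrite !mxE; case: (w i k) => a b /=; rewrite mulr0 add0r mulrC.
Qed.

Lemma complex_eigenvector m (M : 'M[R]_m) (c : R) (w : 'rV[R[i]]_m) : w != 0 ->
  w *m map_mx toC M = c%:C%C *: w -> exists2 v : 'rV[R]_m, v != 0 & v *m M = c *: v.
Proof.
move=> w0 wM.
have reE : map_mx (@complex.Re R) w *m M = c *: map_mx (@complex.Re R) w.
  rewrite -Re_mulmx wM; apply/matrixP => i j; rewrite !mxE.
  by case: (w i j) => a b /=; rewrite mul0r subr0.
have imE : map_mx (@complex.Im R) w *m M = c *: map_mx (@complex.Im R) w.
  rewrite -Im_mulmx wM; apply/matrixP => i j; rewrite !mxE.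
  by case: (w i j) => a b /=; rewrite mul0r addr0.
have [re0|re0] := eqVneq (map_mx (@complex.Re R) w) 0; last by exists (map_mx (@complex.Re R) w).
exists (map_mx (@complex.Im R) w) => //; apply: contra_neq w0 => im0.
apply/matrixP => i j; move/matrixP: re0 => /(_ i j); move/matrixP: im0 => /(_ i j).
by rewrite !mxE; case: (w i j) => a b /= -> ->.
Qed.

(** In a complex unitary eigenbasis [rho * sqn u] minus the quadratic form is a sum of multiples of
    the [|z_i|^2] by [rho] minus the eigenvalues. If all eigenvalues were below [rho], this
    nonpositive sum would have nonnegative terms, forcing [z], hence [u], to vanish. *)
Lemma symmetric_rayleigh m (M : 'M[R]_m) (u : 'rV[R]_m) (rho : R) : M^T = M -> u != 0 ->
  rho * sqn u <= (u *m M *m u^T) 0 0 ->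
  exists c (v : 'rV[R]_m), [/\ rho <= c, v != 0 & v *m M = c *: v].
Proof.
move=> Msym u0 Hu; apply: contrapT => nex.
pose Mc := map_mx toC M; pose uc := map_mx toC u.
pose P := spectralmx Mc; pose dd := spectral_diag Mc.
have Mherm : Mc \is hermsymmx.
  apply: realsym_hermsym; last by apply/mxOverP => i j; rewrite mxE; apply/complex_realP; eexists.
  by apply/is_hermitianmxP; rewrite expr0 scale1r map_mx_id// /Mc map_trmx Msym.
have ME : Mc = invmx P *m diag_mx dd *m P by exact/orthomx_spectralP/hermitian_normalmx.
have PU : P \in unitmx := spectral_unit _.
have ddr i : exists c : R, dd 0 i = c%:C%C.
  have /mxOverP/(_ 0 i) := hermitian_spectral_diag_real Mherm.
  by move=> /complex_realP.
have lt_rho i : dd 0 i < rho%:C%C.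
  have [c cE] := ddr i; rewrite cE ltcR ltNge; apply/negP => rc.
  have [||v v0 vE] := @complex_eigenvector m M c (row i P).
  - apply/eqP => r0; have := congr1 (fun x => x *m invmx P) r0.
    rewrite -row_mul mulmxV// mul0mx row1 => /matrixP/(_ 0 i).
    by rewrite !mxE !eqxx => /eqP; rewrite oner_eq0.
  - by rewrite -row_mul -/Mc ME !mulmxA mulmxV// mul1mx; apply/rowP => j; rewrite mxE mul_diag_mx !mxE cE.
  by apply: nex; exists c, v.
have PI : invmx P = (P ^t*)%sesqui by rewrite invmx_unitary// spectral_unitarymx.
pose z := uc *m invmx P.
have zT : (z ^t*)%sesqui = P *m (uc ^t*)%sesqui.
  by rewrite /z PI trmx_mul map_mxM /= trmxCK.
have ucT : (uc ^t*)%sesqui = map_mx toC u^T.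
  apply/matrixP => i j; rewrite !mxE; apply/CrealP; apply/complex_realP; by eexists.
have E1 : \sum_i dd 0 i * `|z 0 i| ^+ 2 = ((u *m M *m u^T) 0 0)%:C%C.
  have -> : ((u *m M *m u^T) 0 0)%:C%C = (uc *m Mc *m (uc ^t*)%sesqui) 0 0.
    by rewrite ucT /uc /Mc -!map_mxM [RHS]mxE.
  rewrite ME -!mulmxA -zT mulmxA mulmxA -/z [RHS]mxE; apply: eq_bigr => i _.
  by rewrite mul_mx_diag [in RHS]mxE [(_ ^t* )%sesqui _ _]mxE [(_^T) _ _]mxE normCK mulrCA mulrA.
have E2 : \sum_i `|z 0 i| ^+ 2 = (sqn u)%:C%C.
  have -> : (sqn u)%:C%C = (uc *m (uc ^t*)%sesqui) 0 0 by rewrite ucT /uc -!map_mxM [RHS]mxE.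
  have -> : uc *m (uc ^t*)%sesqui = z *m (z ^t*)%sesqui by rewrite zT /z mulmxA mulmxKV.
  by rewrite [RHS]mxE; apply: eq_bigr => i _; rewrite !mxE normCK.
have : \sum_i (rho%:C%C - dd 0 i) * `|z 0 i| ^+ 2 <= 0.
  under eq_bigr do rewrite mulrBl.
  rewrite big_split /= sumrN E1 -mulr_sumr E2 subr_le0 -rmorphM /=.
  by rewrite lecR.
have nn i : 0 <= (rho%:C%C - dd 0 i) * `|z 0 i| ^+ 2.
  by rewrite mulr_ge0 ?exprn_ge0// subr_ge0 ltW.
move=> le0; have /eqP : \sum_i (rho%:C%C - dd 0 i) * `|z 0 i| ^+ 2 = 0.
  by apply/eqP; rewrite eq_le le0 /= sumr_ge0.
rewrite psumr_eq0// => /allP h.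
move/eqP: u0; apply; apply: sqn_eq0; apply: complexI; rewrite -E2 big1// => i _.
have := h i (mem_index_enum _); rewrite mulf_eq0 subr_eq0 (gt_eqF (lt_rho i)) /=.
by move/eqP.
Qed.

End symmetric_eigenvector.

Section eigenvalues.
Variables (R : realType) (K : topologicalGroupType).
Hypothesis Kc : compact [set: K].
Local Notation bK := (Defs_borel__canonical__measurable_structure_Measurable K).
Variable mu : probability bK R.
Hypothesis muH : is_haar mu.
Variable Phi : nat -> onfr mu.
Hypothesis cPhi : complete Phi.

Local Notation A j := (oA (Phi j)).
Local Notation e j := (oe (Phi j)).
Let onF j : onframe mu (e j) (A j). Proof. exact: onfrP. Qed.

Definition Tmx (j n : nat) (phi : 'I_n -> K) : 'M[R]_(od (Phi j)) :=
  \sum_(i < n) (A j (phi i) + A j (phi i)^-1%g).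

Lemma coef_sum_translates (j n : nat) (phi : 'I_n -> K) (h : bK -> R) :
  mu.-integrable setT (EFin \o h) ->
  mu.-integrable setT (EFin \o (fun x : bK => \sum_(i < n) (h ((phi i)^-1 * x)%g + h (phi i * x)%g))) /\
  frame_coef mu (e j) (fun x : bK => \sum_(i < n) (h ((phi i)^-1 * x)%g + h (phi i * x)%g)) =
  frame_coef mu (e j) h *m Tmx j phi.
Proof.
move=> ih.
have i1 (g : K) : mu.-integrable setT (EFin \o (fun x : bK => h ((g : K) * x)%g)).
  by have [] := integral_mulgl muH g ih.
rewrite /Tmx mulmx_sumr.
suff H (s : seq 'I_n) :
  mu.-integrable setT (EFin \o (fun x : bK => \sum_(i <- s) (h ((phi i)^-1 * x)%g + h (phi i * x)%g))) /\
  frame_coef mu (e j) (fun x : bK => \sum_(i <- s) (h ((phi i)^-1 * x)%g + h (phi i * x)%g)) =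
  \sum_(i <- s) frame_coef mu (e j) h *m (A j (phi i) + A j (phi i)^-1%g) by exact: H.
elim: s => [|i s [IHi IHc]].
  have -> : (fun x : bK => \sum_(i <- [::]) (h ((phi i)^-1 * x)%g + h (phi i * x)%g)) = fun=> 0.
    by apply/funext => x; rewrite big_nil.
  split; first by apply: bounded_integrable => //; exists 0 => x; rewrite normr0.
  rewrite big_nil; apply/matrixP => a b; rewrite !mxE.
  by under eq_Rintegral do rewrite mul0r; rewrite int_cst.
have -> : (fun x : bK => \sum_(i0 <- i :: s) (h ((phi i0)^-1 * x)%g + h (phi i0 * x)%g)) =
   fun x : bK => (h ((phi i)^-1 * x)%g + h (phi i * x)%g) +
     \sum_(i <- s) (h ((phi i)^-1 * x)%g + h (phi i * x)%g).
  by apply/funext => x; rewrite big_cons.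
have i2 : mu.-integrable setT (EFin \o (fun x : bK => h ((phi i)^-1 * x)%g + h (phi i * x)%g)).
  by have := integrableD measurableT (i1 (phi i)^-1%g) (i1 (phi i)).
split; first by have := integrableD measurableT i2 IHi.
rewrite (frame_coefD Kc (onF j))// IHc big_cons (frame_coefD Kc (onF j))//.
rewrite (frame_coef_translate Kc muH (onF j))//.
have := frame_coef_translate Kc muH (onF j) (phi i)^-1%g ih; rewrite invgK => ->.
by rewrite mulmxDr.
Qed.

(** By completeness some coefficient row of [h] is nonzero, and taking coefficients turns the
    operator into the matrix [Tmx j phi]. *)
Lemma real_eigenfunction_frame n (phi : 'I_n -> K) (c : R) (h : bK -> R) :
  mu.-integrable setT (EFin \o h) -> \int[mu]_x h x = 0 ->
  ~ {ae mu, forall x, h x = 0} ->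
  {ae mu, forall x : bK, \sum_(i < n) (h ((phi i)^-1 * x)%g + h (phi i * x)%g) = c * h x} ->
  exists j (u : 'rV[R]_(od (Phi j))), u != 0 /\ u *m Tmx j phi = c *: u.
Proof.
move=> ih h0 hN hE; apply: contrapT => nex; apply: hN; apply: cPhi => // j i.
have [it ct] := coef_sum_translates j phi ih.
suff : frame_coef mu (e j) h = 0 by move/matrixP => /(_ 0 i); rewrite !mxE.
apply/eqP; apply: contrapT => /negP u0; apply: nex; exists j, (frame_coef mu (e j) h); split => //.
rewrite -ct -(frame_coefZ Kc (onF j))//; apply: (eq_frame_coef Kc (onF j)) => //.
by have := integrableZl measurableT c ih.
Qed.

(** The operator and [c] are real, so the real and imaginary parts of an eigenfunction satisfy the
    same equation, and one of them is not almost everywhere zero. *)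
Lemma eigenvalue_frame n (phi : n.-tuple (borel K)) (c : R) :
  eigenvalue_on_L20 mu phi (c%:C)%C ->
  exists j (u : 'rV[R]_(od (Phi j))), u != 0 /\ u *m Tmx j (tnth phi) = c *: u.
Proof.
move=> [f [[[fr fi] f0] fN fE]].
have L2int (h : bK -> R) : h \in Lfun mu 2%:E -> mu.-integrable setT (EFin \o h).
  move=> h2; apply/Lfun1_integrable; apply: Lfun_subset12 h2.
  exact: (fin_num_measure mu).
have {}fE : {ae mu, forall x : bK, sum_translates phi f x = (c%:C)%C * f x} := fE.
have {}fN : ~ {ae mu, forall x : bK, f x = 0} := fN.
have ir := L2int _ fr; have ii := L2int _ fi.
(* Orthogonality to the constant 1 already gives mean zero for both parts. *)
have := f0 1; rewrite /inner => -[Hr Hi].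
have r0 : \int[mu]_x (complex.Re (f x)) = 0.
  by rewrite -[RHS]Hr; apply: eq_Rintegral => x _; rewrite rmorph1 mulr1.
have i0 : \int[mu]_x (complex.Im (f x)) = 0.
  by rewrite -[RHS]Hi; apply: eq_Rintegral => x _; rewrite rmorph1 mulr1.
have [rN|rZ] := pselect (~ {ae mu, forall x : bK, complex.Re (f x) = 0}).
  apply: (real_eigenfunction_frame ir r0 rN); apply: filterS fE => x.
  move=> /(congr1 (@complex.Re R)).
  rewrite /sum_translates /translate (big_morph (@complex.Re R) (id1 := 0) (op1 := +%R))//; last by move=> [? ?] [? ?].
  move=> E; transitivity (complex.Re ((c%:C)%C * f x)); last by rewrite [in RHS]/=; case: (f x) => a b /=; rewrite mul0r subr0.
  rewrite -E; apply: eq_bigr => i _; rewrite invgK /=.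
  by case: (f ((tnth phi i)^-1 * x)%g) => ? ?; case: (f (tnth phi i * x)%g) => ? ?.
apply: (real_eigenfunction_frame ii i0).
  move=> iZ; apply: fN; have {}rZ : {ae mu, forall x : bK, complex.Re (f x) = 0} := contrapT rZ.
  have {}iZ : {ae mu, forall x : bK, complex.Im (f x) = 0} := iZ.
  have H : {ae mu, forall x : bK, f x = 0}; last exact: H.
  apply: filterS2 rZ iZ => x.
  by case: (f x) => a b /= -> ->.
apply: filterS fE => x.
move=> /(congr1 (@complex.Im R)).
rewrite /sum_translates /translate (big_morph (@complex.Im R) (id1 := 0) (op1 := +%R))//; last by move=> [? ?] [? ?].
move=> E; transitivity (complex.Im ((c%:C)%C * f x)); last by rewrite [in RHS]/=; case: (f x) => a b /=; rewrite mul0r addr0.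
rewrite -E; apply: eq_bigr => i _; rewrite invgK /=.
by case: (f ((tnth phi i)^-1 * x)%g) => ? ?; case: (f (tnth phi i * x)%g) => ? ?.
Qed.

Lemma bounded_Lfun2 (h : bK -> R) : bmeas h -> h \in Lfun mu 2%:E.
Proof.
move=> [mh [M hM]].
rewrite inE; apply/andP; split; first by rewrite inE.
rewrite inE /= /finite_norm unlock; apply: poweR_lty.
apply: (@le_lt_trans _ _ (\int[mu]_x ((`|M| `^ 2)%:E))%E); last first.
  by rewrite integral_cst//= [X in (_ * X)%E](probability_setT mu) mule1 ltry.
apply: ge0_le_integral => //.
- by move=> x _; rewrite lee_fin powR_ge0.
- apply/measurable_EFinP/(@measurableT_comp _ _ _ _ _ _ (fun x : R => x `^ 2)%R) => //.
  exact/measurableT_comp.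
- move=> x _; rewrite /= lee_fin ge0_ler_powR ?nnegrE//.
  exact: le_trans (hM x) (ler_norm _).
Qed.

Lemma frame_eigenvalue n (phi : n.-tuple (borel K)) (c : R) j (u : 'rV[R]_(od (Phi j))) :
  u != 0 -> u *m Tmx j (tnth phi) = c *: u -> eigenvalue_on_L20 mu phi (c%:C)%C.
Proof.
move=> u0 uE.
have [[ce He] _ me] := onF j.
pose h (x : K) : R := (u *m e j x) 0 0.
have ch : continuous h by apply: (@cmxM _ _ _ _ _ (fun=> u) (e j)) => //; exact: cmx_cst.
have h0 : \int[mu]_x h x = 0.
  have := mI_mull Kc mu u ce; rewrite me mulmx0 => /matrixP/(_ 0 0).
  by rewrite !mxE.
exists (fun x => (h x)%:C%C); split.
- split; first split.
  + exact: (bounded_Lfun2 (continuous_bmeas Kc ch)).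
  + have -> : (@complex.Im R \o (fun x => (h x)%:C%C)) = cst 0 by [].
    exact: Lfun_cst.
  + move=> [a b]; rewrite /inner.
    have cj : (Complex a b)^* = Complex a (- b) by [].
    have E1 : \int[mu]_x complex.Re ((h x)%:C%C * (Complex a b)^*) = 0.
      under eq_Rintegral do rewrite cj /= mul0r subr0.
      by rewrite RintegralZr// ?h0 ?mul0r//; exact: (continuous_integrable Kc mu ch).
    have E2 : \int[mu]_x complex.Im ((h x)%:C%C * (Complex a b)^*) = 0.
      under eq_Rintegral do rewrite cj /= mul0r addr0.
      by rewrite RintegralZr// ?h0 ?mul0r//; exact: (continuous_integrable Kc mu ch).
    by rewrite E1 E2.
(* A continuous function vanishing almost everywhere vanishes everywhere, and then [onframe_inj]
   gives [u = 0]. *)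
- move=> [N [mN N0 sub]]; move/eqP: u0; apply; apply: (onframe_inj Kc (onF j)) => x.
  rewrite mul0mx; apply/matrixP => a b; rewrite !ord1 [RHS]mxE -/(h x).
  have op : open [set x | h x != 0].
    by apply: (@open_comp _ _ h [set y | y != 0]) => // ; exact: open_neq.
  have : mu [set x | h x != 0] = 0%E.
    apply/eqP; rewrite -measure_le0 -N0; apply: le_measure; rewrite ?inE//.
      exact: open_borel.
    by move=> y /= hy; apply: sub => /= -[hy0]; rewrite hy0 eqxx in hy.
  move=> /(open_null Kc muH op) hz; apply/eqP; apply: contrapT => /negP hx.
  by have : [set x | h x != 0] x by []; rewrite hz.
- apply: aeW => x; rewrite /sum_translates /translate -rmorphM /=.
  have -> : c * h x = \sum_(i < n) (h ((tnth phi i)^-1 * x)%g + h ((tnth phi i)^-1^-1 * x)%g).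
    have -> : c * h x = ((c *: u) *m e j x) 0 0 by rewrite -scalemxAl mxE.
    rewrite -uE /Tmx mulmx_sumr mulmx_suml summxE; apply: eq_bigr => i _.
    by rewrite mulmxDr mulmxDl mxE /h !He !mulmxA.
  by rewrite rmorph_sum /=; apply: eq_bigr => i _; rewrite -rmorphD.
Qed.
End eigenvalues.

Lemma dense_rat_row (R : realType) m (U : set 'rV[R]_m) (u : 'rV[R]_m) : nbhs u U ->
  exists q : 'rV[rat]_m, U (map_mx ratr q).
Proof.
move=> /nbhs_ballP[e /= e0 eU].
have /choice[q Hq] : forall j, exists q : rat, `|u 0 j - ratr q| < e.
  move=> j; have lt : u 0 j - e < u 0 j + e by lra.
  have [q] := rat_in_itvoo lt; rewrite in_itv /= => /andP[q1 q2].
  by exists q; rewrite ltr_distlC; apply/andP; split.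
exists (\row_j q j); apply: eU; split => // i j.
by rewrite !mxE ord1; exact: Hq.
Qed.

Section almost_invariance.
Variables (R : realType) (K : topologicalGroupType).
Hypothesis Kc : compact [set: K].
Local Notation bK := (Defs_borel__canonical__measurable_structure_Measurable K).
Variable mu : probability bK R.
Hypothesis muH : is_haar mu.
Variable Phi : nat -> onfr mu.
Hypothesis cPhi : complete Phi.

Local Notation A j := (oA (Phi j)).
Let onF j : onframe mu (oe (Phi j)) (A j). Proof. exact: onfrP. Qed.
Let orth j g : A j g *m (A j g)^T = 1%:M. Proof. exact: (onframe_orth Kc muH (onF j)). Qed.

(** The inequalities are homogeneous in [u] rather than stated for unit vectors, so that [u] can be
    moved to a nearby rational row. *)
Definition almost_invariant n (phi : 'I_n -> K) := forall k : nat,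
  exists j (u : 'rV[R]_(od (Phi j))), 0 < sqn u /\
  forall i, sqn (u - u *m A j (phi i)) < k.+1%:R^-1 * sqn u.

(** This is the link between the two descriptions: a Rayleigh quotient close to [2 * n] means that
    every displacement is small, since all summands are nonnegative. *)
Lemma sum_displacements j n (phi : 'I_n -> K) (u : 'rV[R]_(od (Phi j))) :
  \sum_(i < n) sqn (u - u *m A j (phi i)) =
  (2 * n)%:R * sqn u - (u *m Tmx Phi j phi *m u^T) 0 0.
Proof.
rewrite /Tmx mulmx_sumr mulmx_suml summxE.
have -> : (2 * n)%:R * sqn u = \sum_(i < n) (2 * sqn u).
  by rewrite sumr_const card_ord natrM -[RHS]mulr_natl; ring.
rewrite -sumrB; apply: eq_bigr => i _; rewrite sqn_sub_orth//; congr (_ - _).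
have -> : A j (phi i)^-1%g = (A j (phi i))^T by exact: (onframeV Kc muH (onF j)).
rewrite mulmxDr mulmxDl [RHS]mxE.
have -> : (u *m (A j (phi i))^T *m u^T) 0 0 = (u *m A j (phi i) *m u^T) 0 0.
  have tr00 (M : 'M[R]_1) : M 0 0 = M^T 0 0 by rewrite mxE.
  by rewrite [RHS]tr00 !trmx_mul trmxK mulmxA.
by rewrite mulr_natl mulr2n.
Qed.

Lemma lambda1_le n (phi : n.-tuple (borel K)) : (lambda1 mu phi <= (2 * n)%:R%:E)%E.
Proof.
apply: ge_ereal_sup => _ [c /= /(eigenvalue_frame Kc muH cPhi)[j [u [u0 uE]]] <-].
rewrite lee_fin.
have sp : 0 < sqn u.
  rewrite lt_neqAle sqn_ge0 andbT eq_sym; apply/negP => /eqP /sqn_eq0 h.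
  by rewrite h eqxx in u0.
rewrite -(ler_pM2r sp) -subr_ge0.
have -> : c * sqn u = (u *m Tmx Phi j (tnth phi) *m u^T) 0 0.
  by rewrite uE -scalemxAl [RHS]mxE.
by rewrite -sum_displacements; apply: sumr_ge0 => i _; exact: sqn_ge0.
Qed.

Lemma lambda1_eq_almost_invariant n (phi : n.-tuple (borel K)) :
  lambda1 mu phi = (2 * n)%:R%:E -> almost_invariant (tnth phi).
Proof.
move=> l1 k; apply: contrapT => nex.
have k0 : 0 < k.+1%:R^-1 :> R by rewrite invr_gt0.
suff : (lambda1 mu phi <= ((2 * n)%:R - k.+1%:R^-1)%:E)%E.
  by rewrite l1 lee_fin leNgt => /negP; apply; rewrite ltrBlDr ltrDl.
apply: ge_ereal_sup => _ [c /= /(eigenvalue_frame Kc muH cPhi)[j [u [u0 uE]]] <-].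
rewrite lee_fin leNgt; apply/negP => ck; apply: nex; exists j, u.
have sp : 0 < sqn u.
  rewrite lt_neqAle sqn_ge0 andbT eq_sym; apply/negP => /eqP /sqn_eq0 h.
  by rewrite h eqxx in u0.
split => // i.
apply: (@le_lt_trans _ _ (\sum_(i < n) sqn (u - u *m A j (tnth phi i)))).
  by rewrite (bigD1 i)//= lerDl; apply: sumr_ge0 => l _; exact: sqn_ge0.
rewrite sum_displacements uE -scalemxAl mxE -/(sqn u) -mulrBl ltr_pM2r//.
by rewrite ltrBlDl -ltrBlDr.
Qed.

(** An almost invariant row has Rayleigh quotient at least [2 * n - n / (k + 1)], and
    [symmetric_rayleigh] produces an actual eigenvalue above this bound, as [lambda1] is a supremum
    of eigenvalues. *)
Lemma almost_invariant_lambda1 n (phi : n.-tuple (borel K)) :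
  almost_invariant (tnth phi) -> lambda1 mu phi = (2 * n)%:R%:E.
Proof.
move=> H; apply/eqP; rewrite eq_le lambda1_le /=.
have ge k : (((2 * n)%:R - n%:R * k.+1%:R^-1)%:E <= lambda1 mu phi)%E.
  have [j [u [sp Hu]]] := H k.
  have u0 : u != 0 by apply: contraTneq sp => ->; rewrite /sqn mul0mx mxE ltxx.
  have [|||c [v [hc v0 vE]]] := @symmetric_rayleigh R _ (Tmx Phi j (tnth phi)) u
      ((2 * n)%:R - n%:R * k.+1%:R^-1).
  - rewrite /Tmx raddf_sum; apply: eq_bigr => i _.
    have -> : A j (tnth phi i)^-1%g = (A j (tnth phi i))^T by exact: (onframeV Kc muH (onF j)).
    rewrite -[LHS]/((A j (tnth phi i) + (A j (tnth phi i))^T)^T).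
    by apply/matrixP => a b; rewrite !mxE addrC.
  - exact: u0.
  - suff : \sum_(i < n) sqn (u - u *m A j (tnth phi i)) <= n%:R * k.+1%:R^-1 * sqn u.
      by rewrite sum_displacements mulrBl lerBlDr -lerBlDl [leLHS]addrC.
    apply: (@le_trans _ _ (\sum_(i < n) k.+1%:R^-1 * sqn u)).
      by apply: ler_sum => i _; exact/ltW/Hu.
    by rewrite sumr_const card_ord -mulrA mulr_natl.
  apply: (@le_trans _ _ c%:E); first by rewrite lee_fin.
  apply: ereal_sup_ubound; exists c => //=.
  exact: (frame_eigenvalue Kc muH v0 vE).
apply/lee_addgt0Pr => e e0.
have [k Hk] : exists k : nat, n%:R * k.+1%:R^-1 <= e.
  exists (Num.trunc (n%:R / e)); rewrite ler_pdivrMr// mulrC -ler_pdivrMr//.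
  exact/ltW/truncnS_gt.
apply: le_trans (leeD2r _ (ge k)).
by rewrite -EFinD lee_fin -addrA lerDl addrC subr_ge0.
Qed.

Lemma almost_invariant_words n n' (phi : 'I_n -> K) (psi : 'I_n' -> K) :
  (forall i, exists b, psi i = phi b \/
     exists a, psi i = (phi a * phi b)%g \/ psi i = ((phi a)^-1 * phi b)%g) ->
  almost_invariant phi -> almost_invariant psi.
Proof.
move=> W H k.
(* A product of two elements has squared displacement at most twice the sum of theirs; hence a
   factor 4 on each. *)
have [j [u [sp Hu]]] := H (4 * k.+1)%N.
exists j, u; split => // i.
have dp (x : R) : x < (4 * k.+1).+1%:R^-1 * sqn u -> 4 * x < k.+1%:R^-1 * sqn u.
  move=> hx; apply: (@lt_le_trans _ _ (4 * ((4 * k.+1).+1%:R^-1 * sqn u))); first by rewrite ltr_pM2l.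
  rewrite mulrA ler_pM2r// ler_pdivrMr// mulrC ler_pdivlMr// -natrM ler_nat.
  by rewrite mulnC leqW.
have mul (g h : K) : sqn (u - u *m A j (g * h)%g) <=
    2 * (sqn (u - u *m A j g) + sqn (u - u *m A j h)).
  have -> : u - u *m A j (g * h)%g = (u - u *m A j g) + (u - u *m A j h) *m A j g.
    rewrite (onframe_morph Kc (onF j)) mulmxBl mulmxA -addrA; congr (_ + _).
    by rewrite addrA addNr add0r.
  apply: le_trans (sqn_add2 _ _) _.
  by rewrite (@sqn_orth _ _ _ (A j g)).
have inv (g : K) : sqn (u - u *m A j g^-1%g) = sqn (u - u *m A j g).
  rewrite -(sqn_orth _ (orth j g)) mulmxBl -mulmxA -(onframe_morph Kc (onF j)) mulgV.
  rewrite (onframe1 Kc (onF j)) mulmx1 -opprB /sqn linearN /= mulNmx mulmxN opprK //.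
have [b [->|[a ab]]] := W i.
  apply: le_lt_trans (dp _ (Hu b)); have := sqn_ge0 (u - u *m A j (phi b)); lra.
have := dp _ (Hu a); have := dp _ (Hu b); move: (k.+1%:R^-1 * sqn u) => c hb ha.
case: ab => ->; apply: le_lt_trans (mul _ _) _; rewrite ?inv; lra.
Qed.

(** The conditions are strict and continuous in [u], and finite in number, so rational rows suffice.
    The set then arises from open conditions on single coordinates by countable operations. *)
Lemma measurable_almost_invariant n :
  measurable [set phi : n.-tuple bK | almost_invariant (tnth phi)].
Proof.
pose E k j (q : 'rV[rat]_(od (Phi j))) := [set phi : n.-tuple bK |
  let u := map_mx ratr q : 'rV[R]_(od (Phi j)) in
  0 < sqn u /\ forall i, sqn (u - u *m A j (tnth phi i)) < k.+1%:R^-1 * sqn u].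
have -> : [set phi : n.-tuple bK | almost_invariant (tnth phi)] =
    \bigcap_k \bigcup_j \bigcup_q E k j q.
  apply/seteqP; split => phi /=; last first.
    move=> H k; have [j _ [q _ [Eq1 Eq2]]] := H k I.
    by exists j, (map_mx ratr q).
  move=> H k _; have [j [u [sp Hu]]] := H k.
  exists j => //.
  have cid : cmx (fun v : 'rV[R]_(od (Phi j)) => v) by move=> a b; exact: coord_continuous.
  pose d i (v : 'rV[R]_(od (Phi j))) := k.+1%:R^-1 * sqn v - sqn (v - v *m A j (tnth phi i)).
  have csq : continuous (fun v : 'rV[R]_(od (Phi j)) => sqn v).
    have cm : cmx (fun v : 'rV[R]_(od (Phi j)) => v *m v^T) by cmx_tac.
    exact: cm.
  have cd i : continuous (d i).
    have cm : cmx (fun v : 'rV[R]_(od (Phi j)) =>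
        (v - v *m A j (tnth phi i)) *m (v - v *m A j (tnth phi i))^T) by cmx_tac.
    move=> v; apply: (@continuousB _ _ _ (fun v => k.+1%:R^-1 * sqn v)
      (fun v => sqn (v - v *m A j (tnth phi i)))); last exact: cm.
    by apply: continuous_comp (csq v) _; exact: mulrl_continuous.
  have : nbhs u [set v | 0 < sqn v /\ forall i, 0 < d i v].
    have pos (f : 'rV[R]_(od (Phi j)) -> R) : continuous f -> 0 < f u -> nbhs u [set v | 0 < f v].
      by move=> cf f0; exact: (cvgr_gt (f u) (cf u) 0 f0).
    apply: (@filterI _ _ _ [set v | 0 < sqn v] [set v | forall i, 0 < d i v]); first exact: pos.
    have h i : nbhs u [set v | 0 < d i v] by apply: pos (cd i) _; rewrite /d subr_gt0.
    exact (@filter_forall _ _ (fun i v => is_true (0 < d i v)) _ (nbhs_filter u) h).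
  move=> /dense_rat_row[q [q1 q2]]; exists q => //; split => // i.
  by have := q2 i; rewrite /d subr_gt0.
apply: bigcapT_measurable => k; apply: bigcupT_measurable => j.
apply: countable_bigcupT_measurable => [|q]; first exact: countableP.
pose u := map_mx ratr q : 'rV[R]_(od (Phi j)).
rewrite (_ : E k j q = [set phi | 0 < sqn u] `&`
   \bigcap_(i in [set: 'I_n]) [set phi : n.-tuple bK | sqn (u - u *m A j (tnth phi i)) < k.+1%:R^-1 * sqn u]).
  apply: measurableI.
    have [s0|s0] := boolP (0 < sqn u); last by rewrite (_ : [set _ | _] = set0)// -subset0.
    by rewrite (_ : [set _ | _] = setT)//; apply/seteqP; split.
  apply: fin_bigcap_measurable => // i _.
  pose U : set K := [set x | sqn (u - u *m A j x) < k.+1%:R^-1 * sqn u].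
  have oU : open U.
    have cA : cmx (A j) by exact: (onframe_cmx Kc (onF j)).
    have cs : continuous (fun x => sqn (u - u *m A j x)).
      have cm : cmx (fun x => (u - u *m A j x) *m (u - u *m A j x)^T) by cmx_tac.
      exact: cm.
    by apply: (@open_comp _ _ _ [set y | y < k.+1%:R^-1 * sqn u]) => // x _; exact: cs.
  have := @measurable_tnth _ bK n i measurableT _ (open_borel oU).
  by rewrite setTI.
apply/seteqP; split => phi /= [h1 h2]; split => // i; [move=> _; exact: h2 | exact: h2].
Qed.

End almost_invariance.

(** * Zero-one laws *)

Lemma ae_imp d (T : semiRingOfSetsType d) (R : realType) (m : set T -> \bar R) (P Q : T -> Prop) :
  {ae m, forall x, P x} -> (forall x, P x -> Q x) -> {ae m, forall x, Q x}.
Proof.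
by case=> N [mN N0 sN] PQ; exists N; split => // x nQ; apply: sN => /PQ.
Qed.

Section zero_one.
Local Open Scope ereal_scope.
Context d1 d2 (T1 : measurableType d1) (T2 : measurableType d2) (R : realType).
Variables (P1 : probability T1 R) (P2 : probability T2 R).
Variable E : set (T1 * T2).
Hypothesis mE : measurable E.

Lemma measurable_xsection1 : measurable [set x | P2 (xsection E x) = 1].
Proof.
have := measurable_fun_xsection P2 mE.
by move=> /(_ measurableT _ (emeasurable_set1 1)); rewrite setTI.
Qed.

Lemma measurable_ysection1 : measurable [set y | P1 (ysection E y) = 1].
Proof.
have := measurable_fun_ysection P1 mE.
by move=> /(_ measurableT _ (emeasurable_set1 1)); rewrite setTI.
Qed.

Lemma product_xsection01 :
  {ae P1, forall x, P2 (xsection E x) = 0 \/ P2 (xsection E x) = 1} ->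
  (P1 \x P2) E = P1 [set x | P2 (xsection E x) = 1].
Proof.
move=> H; rewrite /product_measure1.
transitivity (\int[P1]_x (\1_[set x | P2 (xsection E x) = 1%E] x)%:E); last first.
  by rewrite integral_indic ?setIT//; exact: measurable_xsection1.
apply: ge0_ae_eq_integral => //.
- exact: measurable_fun_xsection.
- apply/measurable_EFinP; apply: measurable_indic; exact: measurable_xsection1.
apply: filterS H => x /= H _; rewrite indicE.
case: H => xE; rewrite xE; first by rewrite memNset//= xE => /eqP; rewrite eq_sym onee_eq0.
by rewrite mem_set.
Qed.

Lemma product_ysection01 :
  {ae P2, forall y, P1 (ysection E y) = 0 \/ P1 (ysection E y) = 1} ->
  (P1 \x P2) E = P2 [set y | P1 (ysection E y) = 1].
Proof.
move=> H.
rewrite (@product_measure_unique _ _ _ _ _ P1 P2 (P1 \x^ P2)); last 2 first.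
- by move=> A B mA mB; exact: product_measure2E.
- exact: mE.
rewrite /= /product_measure2.
transitivity (\int[P2]_y (\1_[set y | P1 (ysection E y) = 1%E] y)%:E); last first.
  by rewrite integral_indic ?setIT//; exact: measurable_ysection1.
apply: ge0_ae_eq_integral => //.
- exact: measurable_fun_ysection.
- apply/measurable_EFinP; apply: measurable_indic; exact: measurable_ysection1.
apply: filterS H => x /= H _; rewrite indicE.
case: H => xE; rewrite xE; first by rewrite memNset//= xE => /eqP; rewrite eq_sym onee_eq0.
by rewrite mem_set.
Qed.

(* Up to a null set, [E] is contained in the rectangle [A * B] of the points whose sections are full,
   while [P(E) = P1(A) = P2(B)]; hence [P(E) <= P(E)^2]. *)
Lemma product01 :
  {ae P1, forall x, P2 (xsection E x) = 0 \/ P2 (xsection E x) = 1} ->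
  {ae P2, forall y, P1 (ysection E y) = 0 \/ P1 (ysection E y) = 1} ->
  (P1 \x P2) E = 0 \/ (P1 \x P2) E = 1.
Proof.
move=> H1 H2.
set A := [set x | P2 (xsection E x) = 1]; set B := [set y | P1 (ysection E y) = 1].
have mA : measurable A by exact: measurable_xsection1.
have mB : measurable B by exact: measurable_ysection1.
have EA : (P1 \x P2) E = P1 A by exact: product_xsection01.
have EB : (P1 \x P2) E = P2 B by exact: product_ysection01.
have mEA : measurable (E `&` ~` (A `*` setT)) by apply: measurableI => //; apply: measurableC; exact: measurableX.
have mEB : measurable (E `&` ~` (setT `*` B)) by apply: measurableI => //; apply: measurableC; exact: measurableX.
have nA : (P1 \x P2) (E `&` ~` (A `*` setT)) = 0.
  rewrite /product_measure1 (@ge0_ae_eq_integral _ _ _ P1 setT _ (cst 0)) ?integral0//.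
    exact: measurable_fun_xsection.
  apply: filterS H1 => x Hx _ /=.
  have [Ax|nAx] := pselect (A x).
    rewrite (_ : xsection _ x = set0) ?measure0//; apply/seteqP; split => y //.
    by rewrite /xsection /= inE => -[_ []].
  apply/eqP; rewrite -measure_le0.
  have <- : P2 (xsection E x) = 0 by case: Hx => // /nAx.
  apply: le_measure; rewrite ?inE; [exact: measurable_xsection|exact: measurable_xsection|].
  by move=> y; rewrite /xsection /= !inE => -[].
have nB : (P1 \x P2) (E `&` ~` (setT `*` B)) = 0.
  rewrite (@product_measure_unique _ _ _ _ _ P1 P2 (P1 \x^ P2)); last 2 first.
  - by move=> C D mC mD; exact: product_measure2E.
  - exact: mEB.
  rewrite /= /product_measure2 (@ge0_ae_eq_integral _ _ _ P2 setT _ (cst 0)) ?integral0//.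
    exact: measurable_fun_ysection.
  apply: filterS H2 => y Hy _ /=.
  have [By|nBy] := pselect (B y).
    rewrite (_ : ysection _ y = set0) ?measure0//; apply/seteqP; split => x //.
    by rewrite /ysection /= inE => -[_ []].
  apply/eqP; rewrite -measure_le0.
  have <- : P1 (ysection E y) = 0 by case: Hy => // /nBy.
  apply: le_measure; rewrite ?inE; [exact: measurable_ysection|exact: measurable_ysection|].
  by move=> x; rewrite /ysection /= !inE => -[].
have le : (P1 \x P2) E <= P1 A * P2 B.
  rewrite -product_measure1E//.
  have mAB : measurable (A `*` B) by exact: measurableX.
  apply: (@le_trans _ _ ((P1 \x P2) ((A `*` B) `|` (E `&` ~` (A `*` setT)) `|` (E `&` ~` (setT `*` B))))).
    apply: le_measure; rewrite ?inE//; first by do 2 apply: measurableU => //.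
    move=> [x y] Exy /=.
    have [Ax|] := pselect (A x); last by move=> nA'; left; right; split => // -[].
    have [By|] := pselect (B y); last by move=> nA'; right; split => // -[].
    by left; left.
  apply: (le_trans (measureU2 _ _ _)) => //; first exact: measurableU.
  by rewrite [X in _ + X]nB adde0; apply: (le_trans (measureU2 _ _ _)) => //; rewrite [X in _ + X]nA adde0.
rewrite -EA -EB in le.
have fE : (P1 \x P2) E = (fine ((P1 \x P2) E))%:E.
  by rewrite EA fineK//; exact: (fin_num_measure P1).
have ge0 : 0 <= (P1 \x P2) E by exact: measure_ge0.
have le1 : (P1 \x P2) E <= 1 by rewrite EA; exact: probability_le1.
move: le ge0 le1; rewrite fE; move: (fine _) => c; rewrite -EFinM !lee_fin => h1 h2 h3.
have /eqP : (c * (1 - c) = 0)%R by apply/eqP; rewrite eq_le; apply/andP; split; nra.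
rewrite mulf_eq0 subr_eq0 => /orP[/eqP ->|/eqP <-]; [by left | by right].
Qed.
End zero_one.

Section words_zero_one.
Variables (R : realType) (K : topologicalGroupType).
Hypothesis Kc : compact [set: K].
Local Notation bK := (Defs_borel__canonical__measurable_structure_Measurable K).
Variable mu : probability bK R.
Hypothesis muH : is_haar mu.
Variable Phi : nat -> onfr mu.
Hypothesis cPhi : complete Phi.

Definition generic_pair (x y : K) := forall j (u : 'rV_(od (Phi j))),
  u *m oA (Phi j) x = u -> u *m oA (Phi j) y = u -> u = 0.

Lemma power_measureS n (A : set (n.+1.-tuple bK)) : power_measure mu n.+1 A =
  (mu \x power_measure mu n)%E (@tuple_cons _ bK n @^-1` A).
Proof. by []. Qed.

Lemma measurable_preimage_tuple_cons n (A : set (n.+1.-tuple bK)) : measurable A ->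
  measurable (@tuple_cons _ bK n @^-1` A).
Proof. by move=> mA; rewrite -[_ @^-1` _]setTI; exact: measurable_cons. Qed.

(** By induction every section over the first coordinate is null or conull. The set of first
    coordinates with conull section is invariant under [x] and [y], hence itself null or conull. *)
Lemma coordinatewise_invariant01 (x y : K) n (S : set (n.-tuple bK)) : generic_pair x y ->
  measurable S ->
  (forall v w : n.-tuple bK, (forall i, [\/ tnth w i = tnth v i :> K,
     tnth w i = (x * tnth v i)%g :> K | tnth w i = (y * tnth v i)%g :> K]) -> S v <-> S w) ->
  power_measure mu n S = 0%E \/ power_measure mu n S = 1%E.
Proof.
move=> xy; elim: n S => [|n IH] S mS Sinv.
  by rewrite /= diracE; case: (_ \in _); [right|left].
rewrite power_measureS.
set E := _ @^-1` S.
have mE : measurable E by exact: measurable_preimage_tuple_cons.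
have H01 z : power_measure mu n (xsection E z) = 0%E \/ power_measure mu n (xsection E z) = 1%E.
  apply: IH; first exact: measurable_xsection.
  move=> v w vw; rewrite /xsection /= !inE /E /=; apply: Sinv => i.
  by have [j ->|->] := unliftP ord0 i; [rewrite !tnthS; exact: vw | rewrite !tnth0; constructor 1].
rewrite product_xsection01//; last by apply: aeW => z; exact: H01.
have sec g z : (g = x \/ g = y) -> xsection E (g * z)%g = xsection E z.
  move=> gxy; apply/seteqP; split => v; rewrite /xsection /= !inE /E /=;
    [apply: (Sinv _ _ _).2 | apply: (Sinv _ _ _).1] => i;
    (have [j ->|->] := unliftP ord0 i; [rewrite !tnthS; constructor 1 => // | rewrite !tnth0]);
    by case: gxy => ->; [constructor 2 | constructor 3].
apply: (invariant_set_trivial Kc muH cPhi xy); first exact: measurable_xsection1.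
- by move=> z; rewrite /= sec//; left.
- by move=> z; rewrite /= sec//; right.
Qed.

(** The multiplying coordinate [a] is required to be the same in both tuples, which makes each
    replacement reversible by the inverse of that coordinate. *)
Lemma almost_invariant_iff n (phi psi : n.-tuple bK) :
  (forall i, tnth psi i = tnth phi i :> K \/ exists a, tnth phi a = tnth psi a :> K /\
     tnth psi i = (tnth phi a * tnth phi i)%g :> K) ->
  almost_invariant Phi (tnth phi) <-> almost_invariant Phi (tnth psi).
Proof.
move=> H; split; apply: (almost_invariant_words Kc muH) => i; exists i.
  by case: (H i) => [|[a [_]]] ->; [left|right; exists a; left].
case: (H i) => [->|[a [-> ->]]]; [by left|right; exists a; right].
by rewrite mulgA mulVg mul1g.
Qed.

Hypothesis generic : {ae (mu \x mu)%E, forall z : bK * bK, generic_pair z.1 z.2}.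

Lemma ae_generic_pair : {ae mu, forall x : bK, {ae mu, forall y : bK, generic_pair x y}}.
Proof.
case: generic => B [mB B0 sB].
apply: filterS (ae_xsection_null mB B0) => x Bx.
exists (xsection B x); split => //; first exact: measurable_xsection.
by move=> y /= nxy; rewrite /xsection /= inE; apply: sB.
Qed.

Lemma power_measure_head n (N : set bK) : measurable N ->
  power_measure mu n.+1 [set v | N (tnth v ord0)] = mu N.
Proof.
move=> mN; rewrite power_measureS.
rewrite (_ : _ @^-1` _ = N `*` setT); last first.
  by apply/seteqP; split => -[x v] /=; rewrite tnth0 // => -[].
rewrite product_measure1E//.
transitivity (mu N * 1)%E; last exact: mule1.
by congr (_ * _)%E; exact: (probability_setT (power_measure mu n)).
Qed.

Lemma ae_head n (P : bK -> Prop) : {ae mu, forall x, P x} ->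
  {ae power_measure mu n.+1, forall v : n.+1.-tuple bK, P (tnth v ord0)}.
Proof.
case=> N [mN N0 sN]; exists [set v | N (tnth v ord0)]; split.
- by rewrite (_ : [set _ | _] = @tnth n.+1 bK ^~ ord0 @^-1` N)// -[_ @^-1` _]setTI; exact: measurable_tnth.
- by rewrite power_measure_head.
- by move=> v; exact: sN.
Qed.

Lemma ae_generic_head n : {ae power_measure mu n.+2, forall v : n.+2.-tuple bK,
  generic_pair (tnth v ord0) (tnth v (lift ord0 ord0))}.
Proof.
case: generic => B [mB B0 sB].
pose S := [set v : n.+2.-tuple bK | B (tnth v ord0, tnth v (lift ord0 ord0))].
have mS : measurable S.
  have mp : measurable_fun setT (fun v : n.+2.-tuple bK => (tnth v ord0, tnth v (lift ord0 ord0))).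
    by apply: measurable_fun_pair; exact: measurable_tnth.
  by have := mp measurableT _ mB; rewrite setTI.
exists S; split => //; last by move=> v; exact: (sB (tnth v ord0, tnth v (lift ord0 ord0))).
rewrite power_measureS.
case: (ae_xsection_null mB B0) => N [mN N0 sN].
apply: (product_null (N := N)) => //; first exact: measurable_preimage_tuple_cons.
move=> x Nx.
have <- : mu (xsection B x) = 0%E by apply: contrapT => h; apply: Nx; exact: sN.
rewrite -(power_measure_head n); last exact: measurable_xsection.
congr (power_measure mu n.+1 _); apply/seteqP.
by split => v; rewrite /xsection /= !inE /S /= tnth0 tnthS.
Qed.

(** [product01] is used twice, to separate the first coordinate from the others and then, with the
    first one fixed, the second from the rest. Each remaining section has two fixed coordinates
    forming a generic pair. *)
Lemma almost_invariant01 n :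
  power_measure mu n.+3 [set phi : n.+3.-tuple bK | almost_invariant Phi (tnth phi)] = 0%E \/
  power_measure mu n.+3 [set phi : n.+3.-tuple bK | almost_invariant Phi (tnth phi)] = 1%E.
Proof.
rewrite power_measureS; set E := _ @^-1` _.
have mE : measurable E.
  by apply: measurable_preimage_tuple_cons; exact: (measurable_almost_invariant Kc).
apply: product01 => //.
- apply: (ae_imp ae_generic_pair) => x1 gx1.
  have mE1 : measurable (xsection E x1) by exact: measurable_xsection.
  rewrite power_measureS; set E1 := _ @^-1` _.
  have mE1' : measurable E1 by exact: measurable_preimage_tuple_cons.
  apply: product01 => //.
    (* With the first two coordinates fixed, every later one may be multiplied by either of them. *)
    apply: (ae_imp gx1) => x2 gx; apply: (coordinatewise_invariant01 gx).
      exact: measurable_xsection.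
    move=> v w vw; rewrite /xsection /= !inE /E1 /= /xsection /= !inE /E /=.
    apply: almost_invariant_iff => i.
    have [i1 ->|->] := unliftP ord0 i; last by left; rewrite !tnth0.
    have [i2 ->|->] := unliftP ord0 i1; last by left; rewrite !tnthS !tnth0.
    rewrite !tnthS; case: (vw i2) => ->; first by left.
      by right; exists ord0; rewrite !tnth0.
    by right; exists (lift ord0 ord0); rewrite !tnthS !tnth0.
  (* Here the second coordinate varies, and the acting pair is made of the first and third. *)
  apply: (ae_imp (ae_head n gx1)) => v gv.
  have inv g z : (g = x1 \/ g = tnth v ord0) -> ysection E1 v (g * z)%g <-> ysection E1 v z.
    move=> hg; rewrite /ysection /= !inE /E1 /= /xsection /= !inE /E /=.
    apply: iff_sym; apply: almost_invariant_iff => i.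
    have [i1 ->|->] := unliftP ord0 i; last by left; rewrite !tnth0.
    have [i2 ->|->] := unliftP ord0 i1; first by left; rewrite !tnthS.
    right; case: hg => ->; first by exists ord0; rewrite !tnth0 !tnthS !tnth0.
    by exists (lift ord0 (lift ord0 ord0)); rewrite !tnthS !tnth0.
  apply: (invariant_set_trivial Kc muH cPhi gv); first exact: measurable_ysection.
    by move=> z; apply: inv; left.
  by move=> z; apply: inv; right.
(* Here the first coordinate varies, and the second and third act on it. *)
- apply: (ae_imp (ae_generic_head n)) => w gw.
  have inv g z : (g = tnth w ord0 \/ g = tnth w (lift ord0 ord0)) ->
      ysection E w (g * z)%g <-> ysection E w z.
    move=> hg; rewrite /ysection /= !inE /E /=.
    apply: iff_sym; apply: almost_invariant_iff => i.
    have [i1 ->|->] := unliftP ord0 i; first by left; rewrite !tnthS.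
    right; case: hg => ->; [exists (lift ord0 ord0)|exists (lift ord0 (lift ord0 ord0))];
      by rewrite !tnthS !tnth0.
  apply: (invariant_set_trivial Kc muH cPhi gw); first exact: measurable_ysection.
    by move=> z; apply: inv; left.
  by move=> z; apply: inv; right.
Qed.
End words_zero_one.

Section dichotomy.
Variables (R : realType) (K : topologicalGroupType).
Hypothesis Kc : compact [set: K].
Local Notation bK := (Defs_borel__canonical__measurable_structure_Measurable K).
Variable mu : probability bK R.
Hypothesis muH : is_haar mu.

Variables (T : set K) (w : K) (F : nat -> K -> R).
Hypothesis Tdense : forall U : set K, nbhs (1%g : K) U ->
  exists x0, forall t, T t -> exists k : nat, exists2 v, U v & t = (v * x0 ^+ k)%g.
Hypothesis Tgen : forall g, exists t1 t2 t3, [/\ T t1, T t2, T t3 &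
  g = (t1 * (w * t2 * w^-1) * t3)%g].
Hypothesis Kconn : forall H : set K, nbhs (1%g : K) H ->
  (forall x y : K, H x -> H y -> H (x * y)%g) -> H = [set: K].
Hypothesis repF : forall i, rep (F i).
Hypothesis Fborel : @measurable _ bK = <<s [set [set x | 0 < F i x] | i in [set: nat]] >>.

Lemma ae_generic_pair_frames (Phi : nat -> onfr mu) :
  {ae (mu \x mu)%E, forall z : bK * bK, generic_pair Phi z.1 z.2}.
Proof.
have /choice[B HB] : forall j, exists B : set (bK * bK), [/\ measurable B, (mu \x mu)%E B = 0%E &
    forall x y : K, ~ B (x, y) -> forall u : 'rV[R]_(od (Phi j)),
    u *m oA (Phi j) x = u -> u *m oA (Phi j) y = u -> u = 0].
  by move=> j; exact: (generic_pair_frame Kc muH (onfrP (Phi j)) Tdense Tgen Kconn).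
exists (\bigcup_j B j); split.
- by apply: bigcupT_measurable => j; case: (HB j).
- apply/eqP; rewrite -measure_le0.
  have := @measure_sigma_subadditive _ _ _ (mu \x mu)%E _ B.
  move=> /(_ (\bigcup_j B j)) h; apply: le_trans (h _ _ _) _ => //.
  + by move=> j; case: (HB j).
  + by apply: bigcupT_measurable => j; case: (HB j).
  + by rewrite eseries0// => j _ _; case: (HB j).
- move=> [x y] /= nxy; apply: contrapT => nB; apply: nxy => j u.
  by case: (HB j) => _ _; apply => Bxy; apply: nB; exists j.
Qed.

Lemma lambda1_dichotomy n : (3 <= n)%N ->
  {ae power_measure mu n, forall phi : n.-tuple (borel K),
    (lambda1 mu phi < (2 * n)%:R%:E)%E} \/
  {ae power_measure mu n, forall phi : n.-tuple (borel K),
    lambda1 mu phi = (2 * n)%:R%:E}.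
Proof.
case: n => [//|[//|[//|n]]] _.
have [Phi cPhi] := complete_frames Kc muH repF Fborel.
set AI := [set phi : n.+3.-tuple bK | almost_invariant Phi (tnth phi)].
have mAI : measurable AI by exact: (measurable_almost_invariant Kc).
have [AI0|AI1] := almost_invariant01 Kc muH cPhi (ae_generic_pair_frames Phi) n; [left|right].
  exists AI; split => // phi /= nlt; apply: (lambda1_eq_almost_invariant Kc muH cPhi).
  by apply/eqP; rewrite eq_le (lambda1_le Kc muH cPhi) leNgt; apply/negP.
exists (~` AI); split; first exact: measurableC.
  by rewrite (probability_setC _ mAI) [X in (_ - X)%E]AI1 subee.
move=> phi /= ne AIphi; apply: ne.
exact: (almost_invariant_lambda1 Kc muH cPhi).
Qed.
End dichotomy.

(** * Quotients of SU(2)^a x (S^1)^b *)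

Lemma continuous_complex_Re (R : realType) : continuous (@complex.Re R : R[i] -> R).
Proof.
move=> z A /nbhs_ballP[e /= e0 eA]; apply/(@nbhs_ballP _ R[i]%type); exists e%:C%C => /=; first by rewrite ltcR.
move=> y zy; apply: eA; rewrite /ball /= -ltcR -raddfB; apply: le_lt_trans (normc_ge_Re _) _.
exact: zy.
Qed.
Lemma continuous_complex_Im (R : realType) : continuous (@complex.Im R : R[i] -> R).
Proof.
move=> z A /nbhs_ballP[e /= e0 eA]; apply/(@nbhs_ballP _ R[i]%type); exists e%:C%C => /=; first by rewrite ltcR.
move=> y zy; apply: eA; rewrite /ball /=.
have -> : complex.Im z - complex.Im y = - complex.Re ('i%C * (z - y)).
  by case: z {zy} => p q; case: y => r s /=; ring.
rewrite normrN -ltcR; apply: le_lt_trans (normc_ge_Re _) _.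
rewrite normrM (_ : `|'i%C : R[i]| = 1) ?mul1r; first exact: zy.
by rewrite normc_def /= expr0n expr1n add0r sqrtr1.
Qed.

Section su2_torus_group.
Variables (R : realType) (a b : nat).
Local Notation amb := (SU2_torus_ambient R a b).
Implicit Types x y z : amb.

Lemma SU2_torus_ambientP x y : (forall i, x.1 i = y.1 i) -> (forall j, x.2 j = y.2 j) -> x = y.
Proof. by case: x => x1 x2; case: y => y1 y2 /= h1 h2; congr (_, _); apply/funext. Qed.

Definition SU2_torus1 : amb := (fun=> 1%:M, fun=> 1).

Definition SU2_torusV x : amb := (fun i => invmx (x.1 i), fun j => (x.2 j)^-1).

Lemma SU2_torus_mulA x y z :
  SU2_torus_mul x (SU2_torus_mul y z) = SU2_torus_mul (SU2_torus_mul x y) z.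
Proof. by apply: SU2_torus_ambientP => i /=; [rewrite mulmxA | rewrite mulrA]. Qed.

Lemma SU2_torus_1G : SU2_torus SU2_torus1.
Proof.
split=> [i|j]; last by rewrite /circle /= normr1.
by split; [apply/unitarymxP; rewrite trmx1 map_mx1 mulmx1 | rewrite det1].
Qed.

Lemma SU2_torus_mul1 x : SU2_torus_mul SU2_torus1 x = x.
Proof. by apply: SU2_torus_ambientP => i /=; [rewrite mul1mx | rewrite mul1r]. Qed.

Lemma SU2_torus_mulG x y : SU2_torus x -> SU2_torus y -> SU2_torus (SU2_torus_mul x y).
Proof.
move=> [x1 x2] [y1 y2]; split => [i|j] /=.
  have [ux dx] := x1 i; have [uy dy] := y1 i.
  by split; [exact: mul_unitarymx | rewrite det_mulmx dx dy mulr1].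
by rewrite /circle /= normrM x2 y2 mulr1.
Qed.

Lemma SU2_torus_VG x : SU2_torus x -> SU2_torus (SU2_torusV x).
Proof.
move=> [x1 x2]; split => [i|j] /=.
  have [ux dx] := x1 i.
  by split; [rewrite invmx_unitary// trmxC_unitary | rewrite det_inv dx invr1].
by rewrite /circle /= normfV x2 invr1.
Qed.

Lemma SU2_torus_mulV x : SU2_torus x -> SU2_torus_mul (SU2_torusV x) x = SU2_torus1.
Proof.
move=> [x1 x2]; apply: SU2_torus_ambientP => i /=.
  by have [ux _] := x1 i; rewrite mulVmx// unitarymx_unit.
by rewrite mulVf// -normr_eq0 (x2 i) oner_eq0.
Qed.

Lemma SU2_torus_mulrV x : SU2_torus x -> SU2_torus_mul x (SU2_torusV x) = SU2_torus1.
Proof.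
move=> [x1 x2]; apply: SU2_torus_ambientP => i /=.
  by have [ux _] := x1 i; rewrite mulmxV// unitarymx_unit.
by rewrite mulfV// -normr_eq0 (x2 i) oner_eq0.
Qed.

Lemma SU2_torus_mul1r x : SU2_torus_mul x SU2_torus1 = x.
Proof. by apply: SU2_torus_ambientP => i /=; [rewrite mulmx1 | rewrite mulr1]. Qed.

Let J : finType := (('I_a * ('I_2 * 'I_2) + 'I_b) * bool)%type.

Definition complex_coord x (j : 'I_a * ('I_2 * 'I_2) + 'I_b) : R[i] :=
  match j with inl (i, (k, l)) => x.1 i k l | inr j => x.2 j end.

Definition real_coord x (j : 'I_#|{: J}|) : R :=
  let k := enum_val j in
  if k.2 then complex.Re (complex_coord x k.1) else complex.Im (complex_coord x k.1).

Lemma real_coord_inj x y : (forall j, real_coord x j = real_coord y j) -> x = y.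
Proof.
move=> H.
have E c : complex_coord x c = complex_coord y c.
  have := H (enum_rank ((c, true) : J)); have := H (enum_rank ((c, false) : J)).
  rewrite /real_coord !enum_rankK /=.
  by case: (complex_coord x c) => u v; case: (complex_coord y c) => u' v' /= -> ->.
apply: SU2_torus_ambientP => [i|j]; last exact: (E (inr j)).
by apply/matrixP => k l; exact: (E (inl (i, (k, l)))).
Qed.

Definition linear_form (f : amb -> R) := exists d : 'I_#|{: J}| -> R,
  forall x, f x = \sum_j d j * real_coord x j.

Lemma linear_form_coord j : linear_form (fun x => real_coord x j).
Proof.
exists (fun k => (k == j)%:R) => x; rewrite (bigD1 j)//= eqxx mul1r big1 ?addr0// => k /negPf ->.
by rewrite mul0r.
Qed.

Lemma linear_formD f g : linear_form f -> linear_form g -> linear_form (fun x => f x + g x).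
Proof.
move=> [d Hd] [d' Hd']; exists (fun j => d j + d' j) => x.
by rewrite Hd Hd' -big_split; apply: eq_bigr => j _; rewrite mulrDl.
Qed.

Lemma linear_formZ c f : linear_form f -> linear_form (fun x => c * f x).
Proof.
by move=> [d Hd]; exists (fun j => c * d j) => x; rewrite Hd mulr_sumr; apply: eq_bigr => j _; rewrite mulrA.
Qed.

Lemma linear_form_complex_mul (w : R[i]) c :
  linear_form (fun x => complex.Re (w * complex_coord x c)) /\
  linear_form (fun x => complex.Im (w * complex_coord x c)).
Proof.
case: w => u v.
have rl : linear_form (fun x => complex.Re (complex_coord x c)).
  have := linear_form_coord (enum_rank ((c, true) : J)).
  by congr linear_form; apply/funext => x; rewrite /real_coord enum_rankK.
have il : linear_form (fun x => complex.Im (complex_coord x c)).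
  have := linear_form_coord (enum_rank ((c, false) : J)).
  by congr linear_form; apply/funext => x; rewrite /real_coord enum_rankK.
split.
  have := linear_formD (linear_formZ u rl) (linear_formZ (- v) il).
  by congr linear_form; apply/funext => x; case: (complex_coord x c) => s t /=; rewrite mulNr.
have := linear_formD (linear_formZ u il) (linear_formZ v rl).
by congr linear_form; apply/funext => x; case: (complex_coord x c) => s t /=.
Qed.

(** Left multiplication is real-linear in the entries; this is why polynomials in the coordinates
    have translates spanning a finite-dimensional space. *)
Lemma linear_form_translate z j : linear_form (fun x => real_coord (SU2_torus_mul z x) j).
Proof.
rewrite /real_coord; case: (enum_val j) => -[[i [k l]]|i] e /=; last first.
  by have [h1 h2] := linear_form_complex_mul (z.2 i) (inr i); case: e.
have [h1 h2] := linear_form_complex_mul (z.1 i k 0) (inl (i, (0, l))).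
have [h3 h4] := linear_form_complex_mul (z.1 i k 1) (inl (i, (1, l))).
case: e; [have := linear_formD h1 h3 | have := linear_formD h2 h4];
  (congr linear_form; apply/funext => x /=); rewrite mxE !big_ord_recl big_ord0 addr0 raddfD /=;
  by rewrite (_ : lift ord0 ord0 = 1 :> 'I_2)//; exact/val_inj.
Qed.

End su2_torus_group.

Lemma continuous_real_coord (R : realType) a b j :
  continuous (fun x : SU2_torus_ambient R a b => real_coord x j).
Proof.
have c1 (i : 'I_a) k l : continuous (fun x : SU2_torus_ambient R a b => x.1 i k l).
  move=> x; apply: (@continuous_comp _ _ _ (fun x : SU2_torus_ambient R a b => x.1 i) (fun M => M k l)).
    apply: (@continuous_comp _ _ _ (fun x : SU2_torus_ambient R a b => x.1) (@proj _ _ i)); first exact: cvg_fst.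
    exact: proj_continuous.
  exact: coord_continuous.
have c2 (i : 'I_b) : continuous (fun x : SU2_torus_ambient R a b => x.2 i).
  move=> x; apply: (@continuous_comp _ _ _ (fun x : SU2_torus_ambient R a b => x.2) (@proj _ _ i)); first exact: cvg_snd.
  exact: proj_continuous.
rewrite /real_coord; case: (enum_val j) => -[[i [k l]]|i] [] /= x.
- apply: (@continuous_comp _ _ _ (fun x : SU2_torus_ambient R a b => x.1 i k l)); first exact: c1.
  exact: continuous_complex_Re.
- apply: (@continuous_comp _ _ _ (fun x : SU2_torus_ambient R a b => x.1 i k l)); first exact: c1.
  exact: continuous_complex_Im.
- apply: (@continuous_comp _ _ _ (fun x : SU2_torus_ambient R a b => x.2 i)); first exact: c2.
  exact: continuous_complex_Re.
- apply: (@continuous_comp _ _ _ (fun x : SU2_torus_ambient R a b => x.2 i)); first exact: c2.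
  exact: continuous_complex_Im.
Qed.

Section quotient.
Variables (R : realType) (K : topologicalGroupType) (a b : nat).
Local Notation amb := (SU2_torus_ambient R a b).
Local Notation G := (@SU2_torus R a b).
Variable p : amb -> K.
Hypothesis Hp : is_finite_central_quotient p.

Lemma quotientM x y : G x -> G y -> p (SU2_torus_mul x y) = (p x * p y)%g.
Proof. by case: Hp => h _ _ _ _; exact: h. Qed.

Lemma quotient1 : p (SU2_torus1 R a b) = 1%g.
Proof.
apply: (@mulgI _ (p (SU2_torus1 R a b))).
by rewrite -quotientM ?SU2_torus_mul1 ?mulg1//; exact: SU2_torus_1G.
Qed.

Lemma quotientV x : G x -> p (SU2_torusV x) = (p x)^-1%g.
Proof.
move=> Gx; apply: (@mulgI _ (p x)).
by rewrite -quotientM ?SU2_torus_mulrV ?quotient1 ?mulgV//; exact: SU2_torus_VG.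
Qed.

Definition lift_quotient k : amb := xget (SU2_torus1 R a b) [set x | G x /\ p x = k].

Lemma lift_quotientP k : G (lift_quotient k) /\ p (lift_quotient k) = k.
Proof.
have [_ surj _ _ _] := Hp.
have : [set: K] k by [].
rewrite -surj => -[x Gx pk].
by apply: (@xgetPex _ (SU2_torus1 R a b) [set x | G x /\ p x = k]); exists x.
Qed.

Definition quotient_kernel : {fset amb} := fset_set [set z | G z /\ p z = 1%g].

Lemma mem_quotient_kernel z : z \in quotient_kernel <-> G z /\ p z = 1%g.
Proof. by have [_ _ fin _ _] := Hp; rewrite in_fset_set// inE. Qed.

(* The product over a fibre of [p] makes a function on SU(2)^a x (S^1)^b descend to [K]. *)
Definition fiber_prod (f : amb -> R) k : R :=
  \prod_(z <- quotient_kernel) f (SU2_torus_mul z (lift_quotient k)).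

(** The chosen lift of [p h] differs from [h] by a kernel element, and right multiplication by that
    element permutes the kernel. *)
Lemma fiber_prodE f h : G h -> \prod_(z <- quotient_kernel) f (SU2_torus_mul z h) = fiber_prod f (p h).
Proof.
move=> Gh; rewrite /fiber_prod.
have [Gs ps] := lift_quotientP (p h); set s := lift_quotient (p h) in Gs ps *.
pose z0 := SU2_torus_mul h (SU2_torusV s).
have Gz0 : G z0 by apply: SU2_torus_mulG => //; exact: SU2_torus_VG.
have z0h : SU2_torus_mul z0 s = h by rewrite -SU2_torus_mulA SU2_torus_mulV// SU2_torus_mul1r.
have pz0 : p z0 = 1%g by rewrite quotientM ?quotientV ?ps ?mulgV//; exact: SU2_torus_VG.
rewrite -z0h; under eq_bigr do rewrite SU2_torus_mulA.
rewrite -(big_map (fun z => SU2_torus_mul z z0) predT (fun z => f (SU2_torus_mul z s))).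
apply: perm_big; apply: uniq_perm; last 2 first.
- exact: fset_uniq.
- move=> z; apply/mapP/idP.
    case=> y /mem_quotient_kernel[Gy py] ->; apply/mem_quotient_kernel.
    by split; [exact: SU2_torus_mulG | rewrite quotientM// py pz0 mulg1].
  move=> /mem_quotient_kernel[Gz pz]; exists (SU2_torus_mul z (SU2_torusV z0)).
    apply/mem_quotient_kernel; split; first by apply: SU2_torus_mulG => //; exact: SU2_torus_VG.
    by rewrite quotientM ?quotientV ?pz ?pz0 ?invg1 ?mulg1//; exact: SU2_torus_VG.
  by rewrite -SU2_torus_mulA SU2_torus_mulV// SU2_torus_mul1r.
- rewrite map_inj_in_uniq; first exact: fset_uniq.
  move=> x y /mem_quotient_kernel[Gx _] /mem_quotient_kernel[Gy _] xy.
  by rewrite -[x]SU2_torus_mul1r -(SU2_torus_mulrV Gz0) SU2_torus_mulA xy -SU2_torus_mulA SU2_torus_mulrV// SU2_torus_mul1r.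
Qed.

(** [K] has the quotient topology, so continuity is tested after composition with [p], where
    [fiber_prodE] gives a product of continuous functions. *)
Lemma continuous_fiber_prod f : (forall z, continuous (fun x : amb => f (SU2_torus_mul z x))) ->
  continuous (fiber_prod f).
Proof.
move=> cf; apply/continuousP => U oU.
have [_ _ _ _ quo] := Hp; apply/quo; rewrite -open_subspaceIT.
pose g (x : amb) := \prod_(z <- quotient_kernel) f (SU2_torus_mul z x).
have -> : (p @^-1` (fiber_prod f @^-1` U) : set (subspace G)) `&` G = (g @^-1` U) `&` G.
  by apply/seteqP; split => x /= [h Gx]; split => //; move: h; rewrite /g fiber_prodE.
rewrite open_subspaceIT; apply: open_subspaceW; apply: open_comp oU => x _.
exact: continuous_bigprod.
Qed.

(** Expanding the product over the kernel of sums of [N] terms gives finitely many monomials, one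
    for each map from the kernel to the [N] indices. They are evaluated at an arbitrary lift, so
    they need not be continuous on [K]. *)
Lemma rep_fiber_prod f N (M : 'I_N -> amb -> R) :
  (forall z, continuous (fun x : amb => f (SU2_torus_mul z x))) ->
  (forall z, exists c : 'I_N -> R, forall x, f (SU2_torus_mul z x) = \sum_i c i * M i x) ->
  rep (fiber_prod f).
Proof.
move=> cf fM; split; first exact: continuous_fiber_prod.
have /choice[c Hc] := fM.
pose B := {ffun 'I_(size quotient_kernel) -> 'I_N}.
pose zi (i : 'I_(size quotient_kernel)) := nth (SU2_torus1 R a b) quotient_kernel i.
exists #|{: B}|, (fun k => \col_j \prod_i M ((enum_val j : B) i) (lift_quotient k)) => g.
pose sg := SU2_torusV (lift_quotient g).
exists (\row_j \prod_i c (SU2_torus_mul (zi i) sg) ((enum_val j : B) i)) => k.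
have [Gg pg] := lift_quotientP g; have [Gk pk] := lift_quotientP k.
have Gsg : G sg by exact: SU2_torus_VG.
have -> : (g^-1 * k)%g = p (SU2_torus_mul sg (lift_quotient k)).
  by rewrite quotientM// quotientV// pg pk.
rewrite -fiber_prodE; last exact: SU2_torus_mulG.
rewrite (big_nth (SU2_torus1 R a b)) big_mkord.
under eq_bigr do rewrite SU2_torus_mulA Hc.
rewrite bigA_distr_bigA /= mxE (reindex (@enum_val _ {: B})) /=; last first.
  exists (enum_rank : B -> _) => x _; [exact: enum_valK | exact: enum_rankK].
by apply: eq_bigr => j _; rewrite !mxE -big_split.
Qed.

End quotient.

Lemma continuous_lincomb (R : realType) (T : topologicalType) (I : finType) (d : I -> R) (f : I -> T -> R) :
  (forall i, continuous (f i)) -> continuous (fun x => \sum_i d i * f i x).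
Proof.
move=> cf x; apply: cvg_big => [|i _]; first exact: add_continuous.
by apply: cvgM; [exact: cvg_cst | exact: cf].
Qed.

Lemma continuous_sum_sqrB (R : realType) (T : topologicalType) (I : finType) (c f : I -> T -> R) :
  (forall i, continuous (c i)) -> (forall i, continuous (f i)) ->
  continuous (fun x => \sum_i (f i x - c i x) ^+ 2).
Proof.
move=> cc cf x; apply: cvg_big => [|i _]; first exact: add_continuous.
under eq_fun do rewrite expr2.
by apply: cvgM; apply: cvgB; [exact: cf | exact: cc | exact: cf | exact: cc].
Qed.

(** * Separating functions and generators of the Borel sets *)

Section separation.
Variables (R : realType) (K : topologicalGroupType) (a b : nat).
Local Notation amb := (SU2_torus_ambient R a b).
Local Notation G := (@SU2_torus R a b).
Local Notation N := #|{: ('I_a * ('I_2 * 'I_2) + 'I_b) * bool}|.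

Definition sqdist (c : 'rV[R]_N) (x : amb) : R := \sum_j (real_coord x j - c 0 j) ^+ 2.

Lemma sqdist_eq0 x y : (sqdist (\row_j real_coord y j) x == 0) = (x == y).
Proof.
apply/idP/eqP => [|->]; last by rewrite /sqdist big1// => j _; rewrite mxE subrr expr0n.
rewrite psumr_eq0; last by move=> j _; exact: sqr_ge0.
move=> /allP H; apply: real_coord_inj => j.
by have := H j (mem_index_enum _); rewrite mxE sqrf_eq0 subr_eq0 => /eqP.
Qed.

Lemma sqdist_ge0 c x : 0 <= sqdist c x.
Proof. by apply: sumr_ge0 => j _; exact: sqr_ge0. Qed.

Lemma continuous_sqdist_translate c z : continuous (fun x : amb => sqdist c (SU2_torus_mul z x)).
Proof.
apply: continuous_sum_sqrB => j; first by move=> x; exact: cst_continuous.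
have [d Hd] := linear_form_translate z j.
under eq_fun do rewrite Hd.
by apply: continuous_lincomb => k; exact: continuous_real_coord.
Qed.

Lemma sqdist_translate_span : exists m (M : 'I_m -> amb -> R), forall c z,
  exists e : 'I_m -> R, forall x, sqdist c (SU2_torus_mul z x) = \sum_i e i * M i x.
Proof.
(* The extra index carries the constant 1, so that an affine form becomes linear and its square a
   combination of products of two [X]. *)
pose X (o : 'I_N.+1) (x : amb) := if unlift ord0 o is Some j then real_coord x j else 1.
pose P := ('I_N.+1 * 'I_N.+1)%type.
exists #|{: P}|, (fun i x => X (enum_val i : P).1 x * X (enum_val i : P).2 x) => c z.
have /choice[d Hd] := @linear_form_translate R a b z.
pose D j (o : 'I_N.+1) := if unlift ord0 o is Some k then d j k else - c 0 j.
exists (fun i => \sum_j D j (enum_val i : P).1 * D j (enum_val i : P).2) => x.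
transitivity (\sum_(q : P) (\sum_j D j q.1 * D j q.2) * (X q.1 x * X q.2 x)); last first.
  rewrite (reindex (@enum_val _ {: P})) //=; exists (enum_rank : P -> _) => i _.
    exact: enum_valK.
  exact: enum_rankK.
under [RHS]eq_bigr do rewrite mulr_suml.
rewrite exchange_big; apply: eq_bigr => j _ /=.
have -> : real_coord (SU2_torus_mul z x) j - c 0 j = \sum_o D j o * X o x.
  rewrite big_ord_recl /D /X unlift_none mulr1 Hd addrC; congr (_ + _).
  by apply: eq_bigr => k _; rewrite liftK.
rewrite expr2 big_distrlr pair_big; apply: eq_bigr => q _ /=.
by rewrite mulrACA.
Qed.

Variable p : amb -> K.
Hypothesis Hp : is_finite_central_quotient p.

Lemma rep_sqdist c : rep (fiber_prod p (sqdist c)).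
Proof.
have [m [M HM]] := sqdist_translate_span.
by apply: (rep_fiber_prod Hp (M := M)); [exact: continuous_sqdist_translate | exact: HM].
Qed.

(** For the centre [c0] given by a lift of [k], the factor at the identity vanishes over [k], while
    no point over [k'] is that lift, so the product is positive there. The strict inequality
    persists for a nearby rational centre. *)
Lemma fiber_sqdist_separates k k' : k != k' -> exists (c : 'rV[rat]_N) (q : rat),
  fiber_prod p (sqdist (map_mx ratr c)) k < ratr q < fiber_prod p (sqdist (map_mx ratr c)) k'.
Proof.
move=> kk'.
pose D (c : 'rV[R]_N) := fiber_prod p (sqdist c) k' - fiber_prod p (sqdist c) k.
have cf l : continuous (fun c => fiber_prod p (sqdist c) l).
  apply: continuous_bigprod => z; apply: continuous_sum_sqrB => j c.
    exact: coord_continuous.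
  exact: cst_continuous.
pose h := lift_quotient p k.
have [Gh ph] := lift_quotientP Hp k.
pose c0 : 'rV[R]_N := \row_j real_coord h j.
have D0 : 0 < D c0.
  have -> : D c0 = fiber_prod p (sqdist c0) k'.
    rewrite /D [X in _ - X](_ : _ = 0) ?subr0//.
    have k1 : SU2_torus1 R a b \in quotient_kernel p.
      by apply/(mem_quotient_kernel Hp); split; [exact: SU2_torus_1G | exact: quotient1 Hp].
    rewrite /fiber_prod (big_rem _ k1) /= SU2_torus_mul1.
    have /eqP c0h : sqdist c0 h == 0 by rewrite sqdist_eq0.
    by rewrite -/h c0h mul0r.
  rewrite lt_neqAle eq_sym; apply/andP; split; last by apply: prodr_ge0 => z _; exact: sqdist_ge0.
  rewrite /fiber_prod prodf_seq_neq0; apply/allP => z zk; rewrite /= sqdist_eq0.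
  apply: contra kk' => /eqP zh.
  have [Gz pz] := (mem_quotient_kernel Hp z).1 zk.
  have [Gk' pk'] := lift_quotientP Hp k'.
  by rewrite -ph -/h -zh (quotientM Hp)// pz mul1g pk'.
have : nbhs c0 [set c | 0 < D c].
  have cD : continuous D.
    move=> c; apply: (@continuousB _ _ _ (fun c => fiber_prod p (sqdist c) k')
      (fun c => fiber_prod p (sqdist c) k)); exact: cf.
  exact: (cvgr_gt (D c0) (cD c0) 0 D0).
move=> /dense_rat_row[c]; rewrite /= subr_gt0 => /rat_in_itvoo[q].
by rewrite in_itv /= => qc; exists c, q.
Qed.

(** [None] stands for the integers that code no pair in the enumeration; its positivity set is
    empty. *)
Definition separating (i : option ('rV[rat]_N * rat)) k : R :=
  if i is Some (c, q) then ratr q - fiber_prod p (sqdist (map_mx ratr c)) k else 0.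

Lemma rep_separating i : rep (separating i).
Proof.
case: i => [[c q]|]; last exact: rep_cst.
by apply: repD; [exact: rep_cst | apply: repN; exact: rep_sqdist].
Qed.

Hypothesis Kc : compact [set: K].

(** Each point outside [U] has a function positive at [k] and negative there; finitely many of them
    handle the compact complement. *)
Lemma separating_base (U : set K) k : open U -> U k ->
  exists s : seq ('rV[rat]_N * rat), (forall i, i \in s -> 0 < separating (Some i) k) /\
  [set l | forall i, i \in s -> 0 < separating (Some i) l] `<=` U.
Proof.
move=> oU Uk.
pose f (i : 'rV[rat]_N * rat) := [set l | separating (Some i) l < 0].
have cU : compact (~` U) by apply: subclosed_compact Kc _ => //; exact: open_closedC.
move: cU; rewrite compact_cover => /(_ _ [set i | 0 < separating (Some i) k] f)[].
- move=> i _; have [cs _] := rep_separating (Some i).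
  have := cs; move=> /continuousP/(_ [set x | x < 0]); apply; exact: open_lt.
- move=> l nUl.
  have kl : k != l by apply/eqP => kl; apply: nUl; rewrite -kl.
  have [c [q /andP[h1 h2]]] := fiber_sqdist_separates kl.
  by exists (c, q); rewrite /= ?subr_gt0// /f /= subr_lt0.
move=> s sP cov; exists (enum_fset s); split => [i /sP|l Hl].
  by rewrite inE.
apply: contrapT => /cov[i is_]; rewrite /f /= => lt.
by have := Hl _ is_; rewrite ltNge (ltW lt).
Qed.

Local Notation bK := (Defs_borel__canonical__measurable_structure_Measurable K).

Definition separating_nat n k := separating (obind id (choice.unpickle n)) k.

(* Finite intersections of the sets [0 < separating i] form a countable base of the topology. *)
Lemma borel_separating : @measurable _ bK =
  <<s [set [set x | 0 < separating_nat n x] | n in [set: nat]] >>.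
Proof.
apply/seteqP; split; last first.
  apply: smallest_sub; first exact: sigma_algebra_measurable.
  move=> _ [n _ <-]; apply: open_borel.
  have [cs _] := rep_separating (obind id (choice.unpickle n)).
  have := cs; move=> /continuousP/(_ [set x | 0 < x]); apply; exact: open_gt.
apply: smallest_sub; first exact: smallest_sigma_algebra.
set S := <<s _ >>.
have sS : sigma_algebra [set: K] S by exact: smallest_sigma_algebra.
pose T := g_sigma_algebraType [set [set x | 0 < separating_nat n x] | n in [set: nat]].
have mF i : @measurable _ T [set x | 0 < separating (Some i) x].
  apply: sub_sigma_algebra; exists (choice.pickle (Some i)) => //.
  by rewrite /separating_nat choice.pickleK.
move=> U oU.
pose V (s : seq ('rV[rat]_N * rat)) := [set l | forall i, i \in s -> 0 < separating (Some i) l].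
have -> : U = \bigcup_(s in [set s | V s `<=` U]) V s.
  apply/seteqP; split => [k Uk|k [s sU]]; last exact: sU.
  by have [s [s1 s2]] := separating_base oU Uk; exists s.
suff : @measurable _ T (\bigcup_(s in [set s | V s `<=` U]) V s) by [].
rewrite bigcup_mkcond; apply: countable_bigcupT_measurable => [|s]; first exact: countableP.
case: ifP => // _.
have -> : V s = \bigcap_(i in [set` s]) [set x | 0 < separating (Some i) x] by [].
apply: fin_bigcap_measurable => //.
Qed.

End separation.

(** * Maximal tori and Euler angles *)

Section euler_angles.
Variable R : realType.
Implicit Types (t : R) (z : R[i]).

Definition cis t : R[i] := (cos t +i* sin t)%C.

Lemma cis0 : cis 0 = 1. Proof. by rewrite /cis cos0 sin0. Qed.

Lemma cisD t s : cis (t + s) = cis t * cis s.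
Proof. by rewrite /cis cosD sinD; apply/eqP; rewrite eq_complex /= eqxx /= addrC mulrC [X in _ + X]mulrC. Qed.

Lemma conj_cis t : (cis t)^* = cis (- t).
Proof. by rewrite /cis cosN sinN. Qed.

Lemma cisN t : cis t * cis (- t) = 1.
Proof. by rewrite -cisD subrr cis0. Qed.

Lemma norm_cis t : `|cis t| = 1.
Proof. by rewrite normc_def /= cos2Dsin2 sqrtr1. Qed.

Lemma cis_surj z : `|z| = 1 -> exists t, z = cis t.
Proof.
case: z => x y; rewrite normc_def /= => -[/(congr1 (fun u => u ^+ 2))].
rewrite sqr_sqrtr ?addr_ge0 ?sqr_ge0// expr1n => xy1.
have y0 : 0 <= y ^+ 2 by exact: sqr_ge0.
have x1 : -1 <= x <= 1 by apply/andP; split; rewrite leNgt; apply/negP => ?; nra.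
have sq : sin (acos x) ^+ 2 = y ^+ 2.
  by rewrite sin_acos// sqr_sqrtr; [lra | rewrite subr_ge0 -xy1 lerDl sqr_ge0].
move/eqP: sq; rewrite eqf_sqr => /orP[/eqP h|/eqP h]; [exists (acos x)|exists (- acos x)].
  by rewrite /cis acosK// h.
by rewrite /cis cosN sinN acosK// h opprK.
Qed.

Lemma polar z : exists t, z = `|z| * cis t.
Proof.
have [->|z0] := eqVneq z 0; first by exists 0; rewrite normr0 mul0r.
have [t zt] := @cis_surj (z / `|z|) ltac:(by rewrite normf_div normr_id mulfV ?normr_eq0).
by exists t; rewrite -zt mulrCA mulfV ?mulr1 ?normr_eq0.
Qed.

Lemma ord2_cases (i : 'I_2) : i = 0 \/ i = 1.
Proof. by case: i => -[|[|//]] lt; [left|right]; exact/val_inj. Qed.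

Definition mx2 (p q r s : R[i]) : 'M[R[i]]_2 :=
  \matrix_(i, j) if i == 0 then (if j == 0 then p else q) else (if j == 0 then r else s).

Lemma mx2M p q r s p' q' r' s' : mx2 p q r s *m mx2 p' q' r' s' =
  mx2 (p * p' + q * r') (p * q' + q * s') (r * p' + s * r') (r * q' + s * s').
Proof.
apply/matrixP => i j; rewrite !mxE !big_ord_recl big_ord0 addr0 !mxE /=.
by case: (i == 0); case: (j == 0).
Qed.

Lemma mx2_eta (M : 'M[R[i]]_2) : M = mx2 (M 0 0) (M 0 1) (M 1 0) (M 1 1).
Proof.
by apply/matrixP => i j; rewrite mxE; case: (ord2_cases i) => ->; case: (ord2_cases j) => ->.
Qed.

Lemma mx2_1 : mx2 1 0 0 1 = 1%:M.
Proof. by apply/matrixP => i j; rewrite !mxE; case: (ord2_cases i) => ->; case: (ord2_cases j) => ->. Qed.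

Lemma mx2_trmxC p q r s : map_mx Num.conj (mx2 p q r s)^T = mx2 p^* r^* q^* s^*.
Proof. by apply/matrixP => i j; rewrite !mxE; case: (ord2_cases i) => ->; case: (ord2_cases j) => ->. Qed.

Lemma det_mx2 p q r s : \det (mx2 p q r s) = p * s - q * r.
Proof.
rewrite (expand_det_row _ 0) !big_ord_recl big_ord0 addr0 /cofactor !det_mx11 !mxE /=.
by rewrite expr0 expr1; ring.
Qed.

Lemma SU2P p q r s : SU2 (mx2 p q r s) <-> [/\ r = - q^*, s = p^* & p * p^* + q * q^* = 1].
Proof.
rewrite /SU2 /= det_mx2; split.
  case=> /unitarymxP; rewrite mx2_trmxC mx2M -mx2_1 => E d.
  have := congr1 (fun M : 'M[R[i]]_2 => M 0 0) E; rewrite !mxE /= => e00.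
  have := congr1 (fun M : 'M[R[i]]_2 => M 1 0) E; rewrite !mxE /= => e10.
  split => //.
    have : r * (p * p^* + q * q^*) + q^* * (p * s - q * r) = p * (r * p^* + s * q^*) by ring.
    by rewrite e00 d e10 !mulr1 mulr0 => /eqP; rewrite addr_eq0 => /eqP.
  have : s * (p * p^* + q * q^*) - p^* * (p * s - q * r) = q * (r * p^* + s * q^*) by ring.
  by rewrite e00 d e10 !mulr1 mulr0 => /eqP; rewrite subr_eq0 => /eqP.
case=> -> -> pq; split.
  apply/unitarymxP; rewrite mx2_trmxC mx2M -mx2_1; congr mx2; rewrite ?rmorphN /= ?conjCK //.
  - by ring.
  - by ring.
  - by rewrite -pq; ring.
by rewrite mulrN opprK.
Qed.

Definition torus2 t := mx2 (cis t) 0 0 (cis (- t)).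

Definition isqrt2 : R := (Num.sqrt 2)^-1.

Lemma isqrt2K : isqrt2 * isqrt2 = 2^-1.
Proof. by rewrite /isqrt2 -invfM -expr2 sqr_sqrtr. Qed.

(** Conjugation by this element takes the diagonal torus to the real rotations. *)
Definition quarter_turn : 'M[R[i]]_2 :=
  mx2 isqrt2%:C%C (0 +i* isqrt2)%C (0 +i* isqrt2)%C isqrt2%:C%C.

Lemma SU2_torus2 t : SU2 (torus2 t).
Proof. by apply/SU2P; rewrite rmorph0 oppr0 mul0r addr0 conj_cis cisN. Qed.

Lemma torus2D t s : torus2 (t + s) = torus2 t *m torus2 s.
Proof. by rewrite /torus2 mx2M !(mulr0, mul0r, addr0, add0r) opprD !cisD. Qed.

Lemma SU2_quarter_turn : SU2 quarter_turn.
Proof.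
have k2 := isqrt2K.
by apply/SU2P; split; apply/eqP; rewrite eq_complex /=; apply/andP; split; apply/eqP; lra.
Qed.

Lemma quarter_turn_torus2 t : quarter_turn *m torus2 t *m invmx quarter_turn =
  mx2 (cos t)%:C%C (sin t)%:C%C (- sin t)%:C%C (cos t)%:C%C.
Proof.
have [uq _] := SU2_quarter_turn.
rewrite (invmx_unitary uq) mx2_trmxC !mx2M.
have kc : isqrt2 * isqrt2 * cos t = 2^-1 * cos t by rewrite isqrt2K.
have ks : isqrt2 * isqrt2 * sin t = 2^-1 * sin t by rewrite isqrt2K.
by congr mx2; apply/eqP; rewrite eq_complex /= cosN sinN; apply/andP; split; apply/eqP; lra.
Qed.

Lemma SU2_euler (M : 'M[R[i]]_2) : SU2 M -> exists t1 t2 t3,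
  M = torus2 t1 *m (quarter_turn *m torus2 t2 *m invmx quarter_turn) *m torus2 t3.
Proof.
rewrite [M]mx2_eta; move: (M 0 0) (M 0 1) (M 1 0) (M 1 1) => z u r s /SU2P[-> -> zu].
have [tz zE] := polar z; have [tu uE] := polar u.
have [t2 [zt ut]] : exists t, `|z| = (cos t)%:C%C /\ `|u| = (sin t)%:C%C.
  have [x xE] : exists x : R, `|z| = x%:C%C by rewrite normc_def; eexists.
  have [y yE] : exists y : R, `|u| = y%:C%C by rewrite normc_def; eexists.
  have xy1 : x ^+ 2 + y ^+ 2 = 1.
    move: zu; rewrite -!normCK xE yE !expr2 => /(congr1 (@complex.Re R)) /=.
    by rewrite !mul0r !subr0.
  rewrite xE yE.
  have [|t [-> ->]] := @cis_surj (x +i* y)%C; last by exists t.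
  by rewrite normc_def /= xy1 sqrtr1.
(* The entries of the product in the first row have phases [t1 + t3] and [t1 - t3], to be matched
   with those of [z] and [u]; their moduli give the middle angle. *)
pose t1 := (tz + tu) / 2; pose t3 := (tz - tu) / 2.
have tzE : tz = t1 + t3 by rewrite /t1 /t3; field.
have tuE : tu = t1 - t3 by rewrite /t1 /t3; field.
exists t1, t2, t3.
rewrite quarter_turn_torus2 /torus2 !mx2M !(mulr0, mul0r, addr0, add0r).
rewrite raddfN /= -zt -ut.
have zc : z^* = `|z| * cis (- tz) by rewrite {1}zE rmorphM /= conj_cis conj_normC.
have uc : u^* = `|u| * cis (- tu) by rewrite {1}uE rmorphM /= conj_cis conj_normC.
congr mx2; [rewrite {1}zE tzE | rewrite {1}uE tuE | rewrite uc tuE | rewrite zc tzE];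
  rewrite ?opprD ?opprK cisD.
- by rewrite [RHS]mulrAC [RHS]mulrC.
- by rewrite [RHS]mulrAC [RHS]mulrC.
- by rewrite mulrN mulNr [in RHS]mulrAC [X in _ = - X]mulrC.
- by rewrite [RHS]mulrAC [RHS]mulrC.
Qed.
End euler_angles.

Lemma continuous_complex (R : realType) (T : topologicalType) (f g : T -> R) :
  continuous f -> continuous g -> continuous (fun x => (f x +i* g x)%C).
Proof.
move=> cf cg x A /(@nbhs_ballP _ R[i]%type)[e /= e0 eA].
have [r r0 er] : exists2 r : R, 0 < r & e = r%:C%C.
  by case: e e0 {eA} => r s; rewrite ltcE /= => /andP[/eqP -> r0]; exists r.
have r2 : 0 < r / 2 by exact: divr_gt0.
have /cvgrPdist_lt/(_ _ r2) nf := cf x.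
have /cvgrPdist_lt/(_ _ r2) ng := cg x.
apply: filterS (filterI nf ng) => y [/= h1 h2]; apply: eA.
suff : `|(f x +i* g x)%C - (f y +i* g y)%C| < e by exact: id.
rewrite er.
have -> : (f x +i* g x)%C - (f y +i* g y)%C = (f x - f y)%:C%C + 'i%C * (g x - g y)%:C%C.
  by apply/eqP; rewrite eq_complex /=; apply/andP; split; apply/eqP; ring.
apply: le_lt_trans (ler_normD _ _) _.
have nR (u : R) : `|u%:C%C| = `|u|%:C%C :> R[i] by rewrite normc_def /= expr0n addr0 sqrtr_sqr.
rewrite normrM !nR (_ : `|'i%C : R[i]| = 1) ?mul1r.
  by rewrite -raddfD ltcR; lra.
by rewrite normc_def /= expr0n expr1n add0r sqrtr1.
Qed.

Lemma continuous_ptws (T : topologicalType) (I : Type) (V : topologicalType) (f : T -> {ptws I -> V}) :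
  (forall i, continuous (fun x => f x i)) -> continuous f.
Proof.
move=> cf x; apply/cvg_sup => i; rewrite cvg_image; last first.
  by rewrite eqEsubset; split=> v // _; exists (cst v).
move=> W /= nW; exists (@^~ i @^-1` W) => //; first exact: (cf i x).
by rewrite eqEsubset; split => [j [? + <-//]|j Wj]; exists (fun _ => j).
Qed.

Lemma continuous_mx (T : topologicalType) (V : topologicalType) m n (f : T -> 'M[V]_(m, n)) :
  (forall i j, continuous (fun x => f x i j)) -> continuous f.
Proof.
move=> cf x A [P nP PA].
have h i : nbhs x [set y | forall j, P i j (f y i j)].
  by apply: filter_forall => j; apply: (cf i j x); exact: nP.
have h' : nbhs x [set y | forall i j, P i j (f y i j)] :=
  @filter_forall _ _ _ _ (nbhs_filter x) h.
suff : nbhs x (f @^-1` A) by exact: id.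
by apply: filterS h' => y Hy; apply: PA => i j; exact: Hy.
Qed.

(** * The torus of [K] and its conjugate *)

Section torus.
Variables (R : realType) (K : topologicalGroupType) (a b : nat).
Local Notation amb := (SU2_torus_ambient R a b).
Local Notation G := (@SU2_torus R a b).
Variable p : amb -> K.
Hypothesis Hp : is_finite_central_quotient p.

Definition torus_map (v : 'rV[R]_(a + b)) : amb :=
  (fun i => torus2 (v 0 (lshift b i)), fun j => cis (v 0 (rshift a j))).

Lemma torus_mapG v : G (torus_map v).
Proof. by split => [i|j]; [exact: SU2_torus2 | exact: norm_cis]. Qed.

Lemma torus_mapD v w : torus_map (v + w) = SU2_torus_mul (torus_map v) (torus_map w).
Proof. by apply: SU2_torus_ambientP => i /=; rewrite mxE ?torus2D ?cisD. Qed.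

Lemma torus_map0 : torus_map 0 = SU2_torus1 R a b.
Proof. by apply: SU2_torus_ambientP => i /=; rewrite mxE ?cis0// /torus2 oppr0 cis0 mx2_1. Qed.

Lemma continuous_torus_map : continuous torus_map.
Proof.
have cc : continuous (@cis R).
  by apply: continuous_complex; [exact: continuous_cos | exact: continuous_sin].
have cv j : continuous (fun v : 'rV[R]_(a + b) => cis (v 0 j)).
  by move=> v; apply: continuous_comp (@coord_continuous _ _ _ 0 j v) (cc _).
have cvN j : continuous (fun v : 'rV[R]_(a + b) => cis (- v 0 j)).
  move=> v; apply: (@continuous_comp _ _ _ (fun v : 'rV[R]_(a + b) => - v 0 j) (@cis R)); last exact: cc.
  by apply: (@continuousN _ _ _ (fun v : 'rV[R]_(a + b) => v 0 j)); exact: coord_continuous.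
have c1 : continuous (fun v : 'rV[R]_(a + b) => (torus_map v).1).
  apply: continuous_ptws => i; apply: continuous_mx => k l; rewrite /torus_map /= /torus2.
  under eq_fun do rewrite mxE.
  by case: (k == 0); case: (l == 0); [exact: cv | move=> v; exact: cst_continuous
    | move=> v; exact: cst_continuous | exact: cvN].
have c2 : continuous (fun v : 'rV[R]_(a + b) => (torus_map v).2).
  by apply: continuous_ptws => i; exact: cv.
move=> v; exact: (cvg_pair (c1 v) (c2 v)).
Qed.

Definition torus_hom v : K := p (torus_map v).

Lemma torus_homD v w : torus_hom (v + w) = (torus_hom v * torus_hom w)%g.
Proof. by rewrite /torus_hom torus_mapD (quotientM Hp)//; exact: torus_mapG. Qed.

Lemma torus_hom0 : torus_hom 0 = 1%g.
Proof. by rewrite /torus_hom torus_map0 (quotient1 Hp). Qed.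

Lemma torus_homMn v k : torus_hom (v *+ k) = (torus_hom v ^+ k)%g.
Proof. by elim: k => [|k IH]; rewrite ?mulr0n ?torus_hom0// mulrS expgS torus_homD IH. Qed.

Lemma torus_hom_small (U : set K) : nbhs (1%g : K) U ->
  exists2 d : R, 0 < d & forall v : 'rV[R]_(a + b), (forall j, `|v 0 j| < d) -> U (torus_hom v).
Proof.
rewrite nbhsE => -[V [oV V1] VU].
have [_ _ _ _ quo] := Hp.
have /open_subspaceP[W oW WE] := (quo V).1 oV.
have W1 : W (torus_map 0).
  rewrite torus_map0.
  have [] : (W `&` G) (SU2_torus1 R a b); last by [].
  by rewrite WE; split; [rewrite /preimage /= (quotient1 Hp) | exact: SU2_torus_1G].
have : nbhs (0 : 'rV[R]_(a + b)) (torus_map @^-1` W).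
  by apply: continuous_torus_map; exact: open_nbhs_nbhs.
move=> /nbhs_ballP[d /= d0 dW]; exists d => // v vd; apply: VU.
have Wv : W (torus_map v).
  by apply: dW; split => // i j; rewrite ord1 mxE /ball /= sub0r normrN; exact: vd.
have [] : ((p @^-1` V) `&` G) (torus_map v); last by [].
by rewrite -WE; split => //; exact: torus_mapG.
Qed.

Lemma torus_hom_periodic (q : 'I_(a + b) -> int) :
  torus_hom (\row_j (pi *+ 2 *~ q j)) = 1%g.
Proof.
have c1 k : cis (pi *+ 2 *+ k) = 1 :> R[i].
  elim: k => [|k IH]; first by rewrite mulr0n cis0.
  by rewrite mulrS cisD IH mulr1 /cis cos2pi sin2pi.
have c2 k : cis (- (pi *+ 2 *+ k)) = 1 :> R[i] by rewrite -[LHS]mul1r -(c1 k) cisN c1.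
have c3 k : cis (pi *+ 2 *~ k) = 1 :> R[i].
  by case: k => k; [rewrite -pmulrn c1 | rewrite NegzE mulrNz -pmulrn c2].
rewrite -torus_hom0 /torus_hom torus_map0; congr (p _).
by apply: SU2_torus_ambientP => i /=; rewrite mxE ?c3// /torus2 -mulrNz !c3 mx2_1.
Qed.

Lemma exists_nat_with_digits (N r : nat) (d : nat -> nat) : (0 < N)%N -> (forall i, d i < N)%N ->
  exists2 k, (k < N ^ r)%N & forall j, (j < r)%N ->
    exists q l, k = (q * N ^ j.+1 + d j * N ^ j + l)%N /\ (l < N ^ j)%N.
Proof.
move=> N0 dN; elim: r => [|r [k kr Hk]]; first by exists 0%N.
exists (d r * N ^ r + k)%N.
  apply: (@leq_trans ((d r).+1 * N ^ r)); first by rewrite mulSn addnC ltn_add2r.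
  by rewrite expnS leq_mul2r dN orbT.
move=> j; rewrite ltnS leq_eqVlt => /predU1P[->|jr]; first by exists 0%N, k; rewrite mul0n.
have [q [l [kE lj]]] := Hk _ jr.
exists (d r * N ^ (r - j.+1) + q)%N, l; split => //.
by rewrite mulnDl -mulnA -expnD subnK// {1}kE !addnA.
Qed.

(* The [j]th angle of [x0] is [2 pi / N^(j+1)], so that the [j]th angle of [x0^k] is determined, up to
   [2 pi / N], by the [j]th base-[N] digit of [k]. *)
Lemma torus_dense_cyclic (U : set K) : nbhs (1%g : K) U ->
  exists x0, forall t, range torus_hom t -> exists k : nat, exists2 v, U v & t = (v * x0 ^+ k)%g.
Proof.
move=> /torus_hom_small[d d0 dU].
have pi2 : 0 < pi *+ 2 :> R by rewrite mulrn_wgt0// pi_gt0.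
have [N Npos Nd] : exists2 N : nat, (0 < N)%N & pi *+ 2 / N%:R < d.
  exists (Num.trunc (pi *+ 2 / d)).+1 => //.
  by rewrite ltr_pdivrMr// mulrC -ltr_pdivrMr//; exact: truncnS_gt.
have N0 : 0 < N%:R :> R by rewrite ltr0n.
pose om : 'rV[R]_(a + b) := \row_j (pi *+ 2 / N%:R ^+ j.+1).
exists (torus_hom om) => _ [th _ <-].
(* [f j] is the fractional part of the [j]th angle in full turns, and [dg j] below is its first
   base-[N] digit. *)
pose f j : R := th 0 j / (pi *+ 2) - (Num.floor (th 0 j / (pi *+ 2)))%:~R.
have f0 j : 0 <= f j by rewrite subr_ge0 ge_floor.
have f1 j : f j < 1 by rewrite ltrBlDl -[X in _ < _ + X]/(1%:~R) -intrD floorD1_gt.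
pose dg (j : nat) : nat :=
  if (insub j : option 'I_(a + b)) is Some i then Num.trunc (N%:R * f i) else 0%N.
have dgN j : (dg j < N)%N.
  rewrite /dg; case: insubP => [i _ _|_] //.
  have /andP[h _] := truncn_itv (mulr_ge0 (ltW N0) (f0 i)).
  by rewrite -(ltr_nat R); apply: le_lt_trans h _; rewrite gtr_pMr.
have [k kN Hk] := @exists_nat_with_digits N (a + b) dg Npos dgN.
have /choice[q Hq] : forall j : 'I_(a + b), exists q : int,
    `|th 0 j - om 0 j *+ k + pi *+ 2 *~ q| < d.
  move=> j; have [q [l [kE lj]]] := Hk j (ltn_ord j).
  exists (q%:Z - Num.floor (th 0 j / (pi *+ 2))).
  have dE : dg j = Num.trunc (N%:R * f j) by rewrite /dg valK.
  have := truncn_itv (mulr_ge0 (ltW N0) (f0 j)); rewrite -dE => /andP[D1 D2].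
  have M0 : 0 < N%:R ^+ j :> R by exact: exprn_gt0.
  pose y : R := l%:R / N%:R ^+ j.
  have y0 : 0 <= y by rewrite divr_ge0// ltW.
  have y1 : y < 1 by rewrite ltr_pdivrMr// mul1r -natrX ltr_nat.
  (* Modulo full turns the error is [2 pi / N] times a difference of two numbers in [0, 1): the rest
     of [N * f j] after its digit, and the contribution [y] of the lower digits of [k]. *)
  have -> : th 0 j - om 0 j *+ k + pi *+ 2 *~ (q%:Z - Num.floor (th 0 j / (pi *+ 2))) =
      pi *+ 2 / N%:R * (N%:R * f j - (dg j)%:R - y).
    have thE : th 0 j = pi *+ 2 * (th 0 j / (pi *+ 2)) by rewrite mulrC divfK// gt_eqF.
    have kR : k%:R = q%:R * (N%:R * N%:R ^+ j) + (dg j)%:R * N%:R ^+ j + l%:R :> R.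
      by rewrite kE !natrD !natrM !natrX exprS.
    have -> : om 0 j *+ k = pi *+ 2 / (N%:R * N%:R ^+ j) * k%:R.
      by rewrite mxE -[LHS]mulr_natr exprS.
    rewrite -[pi *+ 2 *~ _]mulrzr intrB -[q%:Z%:~R]/(q%:R : R) kR /y /f {1}thE.
    move: (th 0 j / _) (_ %:~R) ((dg j)%:R : R) (q%:R : R) (l%:R : R) => x z e q' l'.
    by field; rewrite !gt_eqF.
  rewrite normrM (ger0_norm (ltW (divr_gt0 pi2 N0))).
  apply: le_lt_trans Nd; rewrite ger_pMr ?divr_gt0// ler_norml.
  by apply/andP; split; lra.
exists k, (torus_hom (th - om *+ k + \row_j (pi *+ 2 *~ q j))).
  by apply: dU => j; have := Hq j; rewrite !mxE mulmxnE mxE.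
rewrite torus_homD torus_hom_periodic mulg1 -torus_homMn -torus_homD.
by rewrite subrK.
Qed.

Definition torus_twist : amb := (fun=> quarter_turn R, fun=> 1).

Lemma torus_twistG : G torus_twist.
Proof. by split => [i|j]; [exact: SU2_quarter_turn | rewrite /circle /= normr1]. Qed.

Lemma torus_euler g : exists t1 t2 t3, [/\ range torus_hom t1, range torus_hom t2, range torus_hom t3 &
  g = (t1 * (p torus_twist * t2 * (p torus_twist)^-1) * t3)%g].
Proof.
have [Gh ph] := lift_quotientP Hp g; set h := lift_quotient p g in Gh ph.
have [h1 h2] := Gh.
have /choice[t1 /choice[t2 /choice[t3 Ht]]] := fun i => SU2_euler (h1 i).
have /choice[s Hs] := fun j => cis_surj (h2 j).
(* The circle coordinates are all put into the first factor. *)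
pose v1 : 'rV[R]_(a + b) := row_mx (\row_i t1 i) (\row_j s j).
pose v2 : 'rV[R]_(a + b) := row_mx (\row_i t2 i) 0.
pose v3 : 'rV[R]_(a + b) := row_mx (\row_i t3 i) 0.
exists (torus_hom v1), (torus_hom v2), (torus_hom v3).
split; [by exists v1 | by exists v2 | by exists v3 |].
have GT v := torus_mapG v.
have GW := torus_twistG.
have GV := SU2_torus_VG GW; have GWT := SU2_torus_mulG GW (GT v2).
have GC := SU2_torus_mulG GWT GV; have GTC := SU2_torus_mulG (GT v1) GC.
rewrite -ph /torus_hom -(quotientV Hp)// -!(quotientM Hp)//.
congr (p _); apply: SU2_torus_ambientP => i /=.
  by rewrite Ht !row_mxEl !mxE.
by rewrite Hs !row_mxEr !mxE cis0 invr1 !mulr1.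
Qed.

(** Every torus element is a power of one near the identity, obtained by dividing the angles, so the
    torus and its conjugate lie in [H]; the Euler decomposition then yields all of [K]. *)
Lemma torus_connected (H : set K) : nbhs (1%g : K) H ->
  (forall x y : K, H x -> H y -> H (x * y)%g) -> H = [set: K].
Proof.
move=> H1 HM.
set w := p torus_twist.
have Hw : nbhs (1%g : K) [set g | H (w * g * w^-1)%g].
  have cw : continuous (fun g : K => (w * g * w^-1)%g).
    move=> g; apply: (@continuous_comp _ _ _ (fun g : K => (w * g)%g) (fun g => (g * w^-1)%g)).
      exact: continuous_mulgl.
    exact: continuous_mulgr.
  by apply: cw; rewrite /= mulg1 mulgV.
have [d d0 dH] := torus_hom_small (filterI H1 Hw).
have pow x k : H x -> H (x ^+ k.+1)%g.
  by move=> Hx; elim: k => [|k IH]; rewrite ?expg1// expgS; exact: HM.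
have conj x k : (w * x ^+ k * w^-1 = (w * x * w^-1) ^+ k)%g.
  elim: k => [|k IH]; first by rewrite !expg0 mulg1 mulgV.
  by rewrite !expgS -IH !mulgA mulgVK.
have TH v : H (torus_hom v) /\ H (w * torus_hom v * w^-1)%g.
  have [k Hk] : exists k : nat, forall j, `|(k.+1%:R^-1 *: v) 0 j| < d.
    exists (Num.trunc ((\sum_j `|v 0 j|) / d)) => j.
    rewrite mxE normrM ger0_norm ?invr_ge0// mulrC ltr_pdivrMr ?ltr0n//.
    apply: (@le_lt_trans _ _ (\sum_j `|v 0 j|)).
      by rewrite (bigD1 j)//= lerDl sumr_ge0.
    by rewrite mulrC -ltr_pdivrMr//; exact: truncnS_gt.
  have [h1 h2] := dH _ Hk.
  have -> : torus_hom v = (torus_hom (k.+1%:R^-1 *: v) ^+ k.+1)%g.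
    by rewrite -torus_homMn -scaler_nat scalerA mulfV ?scale1r// pnatr_eq0.
  by split; [exact: pow | rewrite conj; exact: pow].
apply/seteqP; split => // g _.
have [_ [_ [_ [[v1 _ <-] [v2 _ <-] [v3 _ <-] ->]]]] := torus_euler g.
by apply: (HM _ _ (HM _ _ _ _)); case: (TH v1); case: (TH v2); case: (TH v3).
Qed.

End torus.

Theorem mainTheorem2 (R : realType) (n : nat) (n_ge3 : (3 <= n)%N)
    (K : topologicalGroupType)
    (K_compact : compact [set: K]) (K_hausdorff : hausdorff_space K)
    (K_adp : almost_direct_product R K)
    (mu : probability (borel K) R) (mu_haar : is_haar mu) :
  {ae power_measure mu n, forall phi : n.-tuple (borel K),
    (lambda1 mu phi < (2 * n)%:R%:E)%E} \/
  {ae power_measure mu n, forall phi : n.-tuple (borel K),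
    lambda1 mu phi = (2 * n)%:R%:E}.
Proof.
have [a [b [p Hp]]] := K_adp.
exact: (lambda1_dichotomy K_compact mu_haar (torus_dense_cyclic Hp) (torus_euler Hp)
  (torus_connected Hp) (fun i => rep_separating Hp _) (borel_separating Hp K_compact) n_ge3).
Qed.
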